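(* Let $S$ be a constant with $S\ge\frac12+\sqrt{\frac{4\pi^2-9}{12}}$ (equivalently, $S>0$ and $S^2\ge S+\frac{\pi^2}{3}-1$). The smooth Toeplitz algebra $\mathcal{T}^\infty$ is a $*$-Fréchet algebra with respect to the following submultiplicative norms, $M,N\in\mathbb{Z}_{\ge0}$: $$\|T(f)+c\|_{M,N}:=S\|f\|_{C^{M+N+2}}+\|c\|_{M,N},\qquad f\in C^\infty(\mathbb{R}/\mathbb{Z}),\ c\in\mathcal{K}^\infty.$$
   Context: $H$ is a separable infinite-dimensional complex Hilbert space with a fixed orthonormal basis $\{E_k\}_{k\ge0}$; $P_{k,l}$ is the operator with $P_{k,l}E_l=E_k$ and $P_{k,l}E_m=0$ for $m\ne l$. $\mathcal{K}^\infty$ is the set of operators $c=\sum_{k,l\ge0}c_{k,l}P_{k,l}$ with rapidly decaying coefficients: $\sup_{k,l}(1+k)^M(1+l)^N|c_{k,l}|<\infty$ for all $M,N\ge0$. $\mathbb{K}$ is the diagonal operator $\mathbb{K}E_k=kE_k$, $\delta_{\mathbb{K}}(c)=[\mathbb{K},c]$ (so $\delta_{\mathbb{K}}^j(c)$ has matrix coefficients $(k-l)^jc_{k,l}$), $\|c\|_{0,N}=\|c(I+\mathbb{K})^N\|$ (operator norm), and for $c\in\mathcal{K}^\infty$, $\|c\|_{M,N}=\sum_{j=0}^M\binom Mj\|\delta_{\mathbb{K}}^j(c)\|_{0,N}$. On $C^\infty(\mathbb{R}/\mathbb{Z})$, $\|f\|_{C^l}=\sum_{j=0}^l\binom lj\left\|\left(\frac1{2\pi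 i}\frac d{dx}\right)^jf\right\|_\infty$. $U$ is the unilateral shift $UE_k=E_{k+1}$; for $f\in C^\infty(\mathbb{R}/\mathbb{Z})$ with Fourier series $\sum_nf_ne^{2\pi inx}$, $T(f)=\sum_{n\ge0}f_nU^n+\sum_{n<0}f_n(U^* )^{-n}$. $\mathcal{T}^\infty=\{T(f)+c:f\in C^\infty(\mathbb{R}/\mathbb{Z}),\ c\in\mathcal{K}^\infty\}$, the decomposition $T(f)+c$ being unique. A $*$-Fréchet algebra is a $*$-algebra that is a Fréchet space with continuous multiplication and involution; submultiplicative means $\|ab\|_{M,N}\le\|a\|_{M,N}\|b\|_{M,N}$. *)

(* Defs.v *)
From Stdlib Require Import Reals ZArith FunctionalExtensionality.
From Coquelicot Require Import Coquelicot.
Open Scope R_scope.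

(** * Hilbert spaces and their operators *)

(* A complex Hilbert space is a complete normed space over [C] whose norm comes
   from an inner product; the inner product is linear in its second variable. *)
Record is_inner_product {H : CompleteNormedModule C_AbsRing} (ip : H -> H -> C)
  : Prop := {
  ip_plus_r : forall x y z : H, ip x (plus y z) = Cplus (ip x y) (ip x z);
  ip_scal_r : forall (x : H) (a : C) (y : H), ip x (scal a y) = Cmult a (ip x y);
  ip_conj : forall x y : H, ip y x = Cconj (ip x y);
  ip_norm : forall x : H, ip x x = RtoC (norm x ^ 2) }.

Record is_orthonormal_basis {H : CompleteNormedModule C_AbsRing}
    (ip : H -> H -> C) (E : nat -> H) : Prop := {
  onb_norm : forall k : nat, ip (E k) (E k) = RtoC 1;
  onb_orth : forall k l : nat, k <> l -> ip (E k) (E l) = RtoC 0;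
  onb_expand : forall x : H, is_series (fun k => scal (ip (E k) x) (E k)) x }.

Definition Op (H : CompleteNormedModule C_AbsRing) : Type := H -> H.

Definition op_plus {H : CompleteNormedModule C_AbsRing} (a b : Op H) : Op H :=
  fun x => plus (a x) (b x).
Definition op_zero {H : CompleteNormedModule C_AbsRing} : Op H :=
  fun _ => zero.
Definition op_opp {H : CompleteNormedModule C_AbsRing} (a : Op H) : Op H :=
  fun x => opp (a x).
Definition op_scal {H : CompleteNormedModule C_AbsRing} (k : C) (a : Op H) : Op H :=
  fun x => scal k (a x).

Definition op_AbelianMonoid_mixin (H : CompleteNormedModule C_AbsRing) :
  AbelianMonoid.mixin_of (Op H).
Proof.
refine (AbelianMonoid.Mixin (Op H) op_plus op_zero _ _ _).
- intros a b; apply functional_extensionality; intro x; apply plus_comm.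
- intros a b c; apply functional_extensionality; intro x; apply plus_assoc.
- intros a; apply functional_extensionality; intro x; apply plus_zero_r.
Defined.

Canonical op_AbelianMonoid (H : CompleteNormedModule C_AbsRing) :=
  AbelianMonoid.Pack (Op H) (op_AbelianMonoid_mixin H) (Op H).

Definition op_AbelianGroup_mixin (H : CompleteNormedModule C_AbsRing) :
  AbelianGroup.mixin_of (op_AbelianMonoid H).
Proof.
refine (AbelianGroup.Mixin (op_AbelianMonoid H) op_opp _).
intros a; apply functional_extensionality; intro x.
exact (plus_opp_r (G := H) (a x)).
Defined.

Canonical op_AbelianGroup (H : CompleteNormedModule C_AbsRing) :=
  AbelianGroup.Pack (Op H)
    (AbelianGroup.Class _ _ (op_AbelianGroup_mixin H)) (Op H).

Definition op_ModuleSpace_mixin (H : CompleteNormedModule C_AbsRing) :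
  ModuleSpace.mixin_of C_Ring (op_AbelianGroup H).
Proof.
refine (ModuleSpace.Mixin C_Ring (op_AbelianGroup H) op_scal _ _ _ _).
- intros k l a; apply functional_extensionality; intro x.
  exact (scal_assoc (V := H) k l (a x)).
- intros a; apply functional_extensionality; intro x.
  exact (scal_one (V := H) (a x)).
- intros k a b; apply functional_extensionality; intro x.
  exact (scal_distr_l (V := H) k (a x) (b x)).
- intros k l a; apply functional_extensionality; intro x.
  exact (scal_distr_r (V := H) k l (a x)).
Defined.

Canonical op_ModuleSpace (H : CompleteNormedModule C_AbsRing) :=
  ModuleSpace.Pack C_Ring (Op H)
    (ModuleSpace.Class _ _ _ (op_ModuleSpace_mixin H)) (Op H).

Definition op_comp {H : CompleteNormedModule C_AbsRing} (a b : Op H) : Op H :=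
  fun x => a (b x).

(* The least upper bound is taken in [Rbar]; it is finite on bounded operators. *)
Definition op_norm {H : CompleteNormedModule C_AbsRing} (a : Op H) : R :=
  real (Lub_Rbar (fun r => exists x : H, norm x <= 1 /\ r = norm (a x))).

(* [iota] is definite description: [adj ip a y] is the unique [z] with
   <z, x> = <y, a x> for all [x], which exists when [a] is bounded and linear. *)
Definition adj {H : CompleteNormedModule C_AbsRing} (ip : H -> H -> C)
    (a : Op H) : Op H :=
  fun y => iota (fun z : H => forall x : H, ip z x = ip y (a x)).

Definition hsum {H : CompleteNormedModule C_AbsRing} (u : nat -> H) : H :=
  iota (fun s : H => is_series u s).

(** * Smooth compact operators *)

Definition matrix_unit {H : CompleteNormedModule C_AbsRing} (ip : H -> H -> C)
    (E : nat -> H) (k l : nat) : Op H :=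
  fun x => scal (ip (E l) x) (E k).

Definition rapid_decay (m : nat -> nat -> C) : Prop :=
  forall M N : nat, exists B : R, forall k l : nat,
    (1 + INR k) ^ M * (1 + INR l) ^ N * Cmod (m k l) <= B.

Definition Kinf {H : CompleteNormedModule C_AbsRing} (ip : H -> H -> C)
    (E : nat -> H) (c : Op H) : Prop :=
  exists m : nat -> nat -> C, rapid_decay m /\
    forall x : H,
      filterlim
        (fun n => sum_n (fun k => sum_n (fun l =>
           scal (m k l) (matrix_unit ip E k l x)) n) n)
        eventually (locally (c x)).

(* The unbounded operator K E_k = k E_k, meaningful on its natural domain (where
   the series converges); below it is only applied to vectors of that domain. *)
Definition diagK {H : CompleteNormedModule C_AbsRing} (ip : H -> H -> C)
    (E : nat -> H) : Op H :=
  fun x => hsum (fun k => scal (Cmult (RtoC (INR k)) (ip (E k) x)) (E k)).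

(* The everywhere defined operator obtained by extending a densely defined
   bounded operator from the basis vectors by linearity and continuity. *)
Definition dense_ext {H : CompleteNormedModule C_AbsRing} (ip : H -> H -> C)
    (E : nat -> H) (a : Op H) : Op H :=
  fun x => hsum (fun l => scal (ip (E l) x) (a (E l))).

Definition deltaK {H : CompleteNormedModule C_AbsRing} (ip : H -> H -> C)
    (E : nat -> H) (c : Op H) : Op H :=
  dense_ext ip E (fun x => minus (diagK ip E (c x)) (c (diagK ip E x))).

Definition norm0 {H : CompleteNormedModule C_AbsRing} (ip : H -> H -> C)
    (E : nat -> H) (N : nat) (c : Op H) : R :=
  op_norm (dense_ext ip E
    (fun x => c (Nat.iter N (fun y => plus y (diagK ip E y)) x))).

Definition Knorm {H : CompleteNormedModule C_AbsRing} (ip : H -> H -> C)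
    (E : nat -> H) (M N : nat) (c : Op H) : R :=
  sum_n (fun j =>
    Binomial.C M j * norm0 ip E N (Nat.iter j (deltaK ip E) c)) M.

(** * Smooth functions on R/Z, as 1-periodic functions on R *)

Definition Dtorus (f : R -> C) : R -> C := fun x =>
  Cmult (Cinv (Cmult (RtoC (2 * PI)) Ci))
    (Derive (fun t => fst (f t)) x, Derive (fun t => snd (f t)) x).

Definition smooth_torus (f : R -> C) : Prop :=
  (forall x : R, f (x + 1) = f x) /\
  (forall (n : nat) (x : R),
     ex_derive (V := C_R_NormedModule) (Nat.iter n Dtorus f) x).

Definition supnorm (f : R -> C) : R :=
  real (Lub_Rbar (fun r => exists x : R, r = Cmod (f x))).

Definition Clnorm (l : nat) (f : R -> C) : R :=
  sum_n (fun j => Binomial.C l j * supnorm (Nat.iter j Dtorus f)) l.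

Definition fourier (f : R -> C) (n : Z) : C :=
  RInt (V := C_R_CompleteNormedModule)
    (fun x => Cmult (f x)
       (cos (2 * PI * IZR n * x), - sin (2 * PI * IZR n * x))) 0 1.

(** * The smooth Toeplitz algebra *)

Definition shift {H : CompleteNormedModule C_AbsRing} (ip : H -> H -> C)
    (E : nat -> H) : Op H :=
  fun x => hsum (fun k => scal (ip (E k) x) (E (S k))).

Definition toeplitz {H : CompleteNormedModule C_AbsRing} (ip : H -> H -> C)
    (E : nat -> H) (f : R -> C) : Op H :=
  fun x =>
    plus
      (hsum (fun n => scal (fourier f (Z.of_nat n))
                        (Nat.iter n (shift ip E) x)))
      (hsum (fun n => scal (fourier f (- Z.of_nat (S n)))
                        (Nat.iter (S n) (adj ip (shift ip E)) x))).

Definition Tinf {H : CompleteNormedModule C_AbsRing} (ip : H -> H -> C)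
    (E : nat -> H) (a : Op H) : Prop :=
  exists (f : R -> C) (c : Op H),
    smooth_torus f /\ Kinf ip E c /\ a = plus (toeplitz ip E f) c.

(* The value read off the (unique) decomposition a = T(f) + c. *)
Definition Tnorm {H : CompleteNormedModule C_AbsRing} (ip : H -> H -> C)
    (E : nat -> H) (s : R) (M N : nat) (a : Op H) : R :=
  iota (fun r : R => exists (f : R -> C) (c : Op H),
    smooth_torus f /\ Kinf ip E c /\ a = plus (toeplitz ip E f) c /\
    r = s * Clnorm (M + N + 2) f + Knorm ip E M N c).

(** * *-Fréchet algebras

    An algebra is a subset [A] of a complex vector space [V], with a product
    and an involution given on [V] and required to satisfy the axioms on [A]. *)

Record is_star_algebra {V : ModuleSpace C_Ring} (A : V -> Prop)
    (mul : V -> V -> V) (star : V -> V) : Prop := {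
  sa_zero : A zero;
  sa_plus : forall a b, A a -> A b -> A (plus a b);
  sa_scal : forall (k : C) a, A a -> A (scal k a);
  sa_mul : forall a b, A a -> A b -> A (mul a b);
  sa_star : forall a, A a -> A (star a);
  sa_mul_assoc : forall a b c, A a -> A b -> A c ->
    mul a (mul b c) = mul (mul a b) c;
  sa_mul_plus_l : forall a b c, A a -> A b -> A c ->
    mul (plus a b) c = plus (mul a c) (mul b c);
  sa_mul_plus_r : forall a b c, A a -> A b -> A c ->
    mul a (plus b c) = plus (mul a b) (mul a c);
  sa_mul_scal_l : forall (k : C) a b, A a -> A b ->
    mul (scal k a) b = scal k (mul a b);
  sa_mul_scal_r : forall (k : C) a b, A a -> A b ->
    mul a (scal k b) = scal k (mul a b);
  sa_star_plus : forall a b, A a -> A b ->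
    star (plus a b) = plus (star a) (star b);
  sa_star_scal : forall (k : C) a, A a ->
    star (scal k a) = scal (Cconj k) (star a);
  sa_star_mul : forall a b, A a -> A b ->
    star (mul a b) = mul (star b) (star a);
  sa_star_star : forall a, A a -> star (star a) = a }.

Record is_seminorm_on {V : ModuleSpace C_Ring} (A : V -> Prop) (p : V -> R)
  : Prop := {
  sn_ge0 : forall a, A a -> 0 <= p a;
  sn_triangle : forall a b, A a -> A b -> p (plus a b) <= p a + p b;
  sn_scal : forall (k : C) a, A a -> p (scal k a) = Cmod k * p a }.

Record is_norm_on {V : ModuleSpace C_Ring} (A : V -> Prop) (p : V -> R)
  : Prop := {
  norm_seminorm : is_seminorm_on A p;
  norm_definite : forall a, A a -> p a = 0 -> a = zero }.

(* Neighbourhood filter of [a] in the topology on [A] defined by the seminorms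
   [p M N]: the boxes over M, N <= K are cofinal among the finite subfamilies. *)
Definition seminorm_nbhs {V : ModuleSpace C_Ring} (A : V -> Prop)
    (p : nat -> nat -> V -> R) (a : V) : (V -> Prop) -> Prop :=
  fun P => exists (K : nat) (eps : posreal), forall b, A b ->
    (forall M N, (M <= K)%nat -> (N <= K)%nat -> p M N (minus b a) < eps) ->
    P b.

Record is_frechet_space {V : ModuleSpace C_Ring} (A : V -> Prop)
    (p : nat -> nat -> V -> R) : Prop := {
  fr_seminorm : forall M N, is_seminorm_on A (p M N);
  fr_hausdorff : forall a, A a -> (forall M N, p M N a = 0) -> a = zero;
  fr_complete : forall u : nat -> V, (forall n, A (u n)) ->
    (forall M N (eps : posreal), exists n0 : nat, forall n m : nat,
       (n0 <= n)%nat -> (n0 <= m)%nat -> p M N (minus (u n) (u m)) < eps) ->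
    exists a, A a /\ filterlim u eventually (seminorm_nbhs A p a) }.

Record is_star_frechet_algebra {V : ModuleSpace C_Ring} (A : V -> Prop)
    (mul : V -> V -> V) (star : V -> V) (p : nat -> nat -> V -> R) : Prop := {
  sfa_algebra : is_star_algebra A mul star;
  sfa_frechet : is_frechet_space A p;
  sfa_mul_cont : forall a b, A a -> A b ->
    filterlim (fun z => mul (fst z) (snd z))
      (filter_prod (seminorm_nbhs A p a) (seminorm_nbhs A p b))
      (seminorm_nbhs A p (mul a b));
  sfa_star_cont : forall a, A a ->
    filterlim star (seminorm_nbhs A p a) (seminorm_nbhs A p (star a)) }.

Definition submultiplicative_on {V : Type} (A : V -> Prop) (mul : V -> V -> V)
    (p : V -> R) : Prop :=
  forall a b, A a -> A b -> p (mul a b) <= p a * p b.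

(* Main.v *)
(* Every smooth operator is handled through its matrix in the basis [E]: a
   bounded operator is determined by it, [T(f)] is the matrix [f_(k - l)], the
   operators [K^infty] are those with rapidly decaying matrix, [delta_K]
   multiplies the (k, l) coefficient by [k - l] and right multiplication by
   [(1 + K)^N] multiplies it by [(1 + l)^N]. Pascal's rule turns both families
   of norms into the recursion |x|_(m+1) = |x|_m + |D x|_m, so that all product
   estimates follow by induction from the Leibniz rule and the case m = 0:
   |T(f)| <= |f|_oo (the form of [T(f)] is an integral against trigonometric
   polynomials), T(g) (1 + K) = (1 + K) T(g) - T(D g), and
     T(f) T(g) - T(f g) = - sum_(n >= 1) g_(-n) T(f e_(-n)) Q_n,
   with [Q_n] the projection on [E 0, ..., E (n - 1)]. The coefficients [g_(-n)]
   being bounded by |g|_(C^(N+2)) (1 + n)^(-N-2), the last operator has norm at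
   most |f|_oo |g|_(C^(N+2)) after multiplication by [(1 + K)^N]; hence
   submultiplicativity as soon as S >= 1 and S^2 >= S + 1.

   The matrix identity for [T(f) T(g)] needs the convolution formula, that is
   uniform convergence of Fourier series. Pointwise convergence at [x] is proved
   by writing g - g(x) = h (e_1 e_(-1)(x) - 1) with [h] continuous: the Fourier
   terms of [g] at [x] then telescope, up to Fourier coefficients of [h] which
   tend to 0 by Bessel's inequality. *)

From Stdlib Require Import Reals ZArith Lra Lia FunctionalExtensionality.
From Stdlib Require Import ClassicalEpsilon.
From Coquelicot Require Import Coquelicot.
From Corelib Require Import ssreflect.
Require Import Defs.
Open Scope general_if_scope.
Open Scope R_scope.

(* [ring] and [field] need the carrier of an equation in canonical form. *)
Ltac eq_in T := match goal with |- @eq _ ?a ?b => change (@eq T a b) end.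

(** * Complex-valued functions of a real variable *)

Local Notation funext := functional_extensionality.

(** The operator K is unbounded, and [hsum], [diagK], [deltaK] and [adj] rest on definite
    description, so none of them can be computed with directly. Each time, an operator with the
    expected matrix is built first; density or uniqueness then identifies it with the described one.
    The weight (1 + K)^N stands on the right only. Hence T(g) as a right factor costs derivatives of
    g, and the involution does not preserve the norms: its continuity is obtained, with a loss of
    indices, by comparing the norms with weighted suprema of the matrix entries. The same comparison
    gives the completeness of K^infty. The number pi^2/3 - 1 is the sum of (1 + |n|)^(-2) over all
    integers n. The semicommutator involves only the negative frequencies of g, whose share a
    telescoping sum bounds by 1; the hypothesis on S enters as S >= 2, which follows from pi >= 3.
    For integrals, a b <= (a^2 + b^2) / 2 replaces Schwarz's inequality; rescaling one of the two
    vectors recovers the sharp operator norm. *)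

Lemma ball_pair (x y : C) (eps : R) :
  @ball C_UniformSpace x eps y <->
  ball (fst x) eps (fst y) /\ ball (snd x) eps (snd y).
Proof. by []. Qed.

Lemma RtoC_m1 : RtoC (-1) = Copp (RtoC 1).
Proof. by rewrite -RtoC_opp. Qed.

Definition ccont (f : R -> C) : Prop :=
  forall x : R, continuous (U := C_UniformSpace) f x.

Lemma ccont_components (f : R -> C) :
  (forall x, continuous (fun t => fst (f t)) x) ->
  (forall x, continuous (fun t => snd (f t)) x) -> ccont f.
Proof.
move=> H1 H2 x.
apply: (filterlim_ext (fun t => (fst (f t), snd (f t)))).
  by move=> t; case: (f t).
rewrite /continuous (surjective_pairing (f x)).
move=> P [eps HP].
have L1 : locally x (fun t => ball (fst (f x)) eps (fst (f t))).
  exact: (H1 x _ (locally_ball (fst (f x)) eps)).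
have L2 : locally x (fun t => ball (snd (f x)) eps (snd (f t))).
  exact: (H2 x _ (locally_ball (snd (f x)) eps)).
refine (filter_imp _ _ _ (filter_and _ _ L1 L2)) => t [A B].
by apply: HP; split.
Qed.

Lemma ccont_fst (f : R -> C) :
  ccont f -> forall x, continuous (fun t => fst (f t)) x.
Proof.
move=> Hf x P [eps HP].
have L : locally x (fun t => ball (f x : C_UniformSpace) eps (f t)).
  exact: (Hf x _ (locally_ball (f x : C_UniformSpace) eps)).
refine (filter_imp _ _ _ L) => t Ht.
by apply: HP; apply (proj1 (proj1 (ball_pair _ _ _) Ht)).
Qed.

Lemma ccont_snd (f : R -> C) :
  ccont f -> forall x, continuous (fun t => snd (f t)) x.
Proof.
move=> Hf x P [eps HP].
have L : locally x (fun t => ball (f x : C_UniformSpace) eps (f t)).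
  exact: (Hf x _ (locally_ball (f x : C_UniformSpace) eps)).
refine (filter_imp _ _ _ L) => t Ht.
by apply: HP; apply (proj2 (proj1 (ball_pair _ _ _) Ht)).
Qed.

Lemma ccont_const (c : C) : ccont (fun _ => c).
Proof. by move=> x; apply: continuous_const. Qed.

Lemma ccont_plus (f g : R -> C) :
  ccont f -> ccont g -> ccont (fun x => Cplus (f x) (g x)).
Proof. by move=> Hf Hg x; apply: (continuous_plus (V := C_R_NormedModule)). Qed.

Lemma ccont_mult (f g : R -> C) :
  ccont f -> ccont g -> ccont (fun x => Cmult (f x) (g x)).
Proof.
move=> Hf Hg; apply: ccont_components => x /=.
- apply: (continuous_minus (V := R_NormedModule)); apply: (continuous_mult (K := R_AbsRing));
  by [apply: ccont_fst | apply: ccont_snd].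
- apply: (continuous_plus (V := R_NormedModule)); apply: (continuous_mult (K := R_AbsRing));
  by [apply: ccont_fst | apply: ccont_snd].
Qed.

Lemma ccont_conj (f : R -> C) : ccont f -> ccont (fun x => Cconj (f x)).
Proof.
move=> Hf; apply: ccont_components => x /=; first exact: ccont_fst.
by apply: (continuous_opp (V := R_NormedModule)); apply: ccont_snd.
Qed.

Lemma ccont_sum (F : nat -> R -> C) (n : nat) :
  (forall k, ccont (F k)) -> ccont (fun t => sum_n (fun k => F k t) n).
Proof.
move=> HF; elim: n => [|n IH] x.
  by apply: (continuous_ext (F 0%nat)) (HF 0%nat x) => t; rewrite sum_O.
apply: (continuous_ext (fun t => Cplus (sum_n (fun k => F k t) n) (F (S n) t))).
  by move=> t; rewrite sum_Sn.
exact: (ccont_plus _ _ IH (HF (S n))).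
Qed.

(** * Integration over a period *)

Definition cint (f : R -> C) : C := RInt (V := C_R_CompleteNormedModule) f 0 1.

Lemma ccont_is_RInt (f : R -> C) :
  ccont f -> is_RInt (V := C_R_NormedModule) f 0 1 (cint f).
Proof.
move=> Hf; apply: (RInt_correct (V := C_R_CompleteNormedModule)).
apply: (ex_RInt_continuous (V := C_R_CompleteNormedModule)) => z _.
exact: Hf.
Qed.

Lemma cint_unique (f : R -> C) (l : C) :
  is_RInt (V := C_R_NormedModule) f 0 1 l -> cint f = l.
Proof. exact: (is_RInt_unique (V := C_R_CompleteNormedModule)). Qed.

Lemma cint_ext (f g : R -> C) : (forall x, f x = g x) -> cint f = cint g.
Proof. by move=> H; congr cint; apply: funext. Qed.

Lemma cint_plus (f g : R -> C) :
  ccont f -> ccont g ->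
  cint (fun x => Cplus (f x) (g x)) = Cplus (cint f) (cint g).
Proof.
move=> Hf Hg; apply: cint_unique.
exact: (is_RInt_plus (V := C_R_NormedModule) _ _ _ _ _ _
          (ccont_is_RInt _ Hf) (ccont_is_RInt _ Hg)).
Qed.

(** The integral is that of a real normed space, so complex linearity is checked on real and
    imaginary parts. *)
Lemma cint_scal (a : C) (f : R -> C) :
  ccont f -> cint (fun x => Cmult a (f x)) = Cmult a (cint f).
Proof.
move=> Hf; apply: cint_unique.
have H := ccont_is_RInt _ Hf.
have H1 := is_RInt_fct_extend_fst _ _ _ _ H.
have H2 := is_RInt_fct_extend_snd _ _ _ _ H.
apply: (is_RInt_fct_extend_pair (U := R_NormedModule) (V := R_NormedModule)) => /=.
- exact: (is_RInt_minus (V := R_NormedModule) _ _ _ _ _ _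
    (is_RInt_scal _ _ _ (fst a) _ H1) (is_RInt_scal _ _ _ (snd a) _ H2)).
- exact: (is_RInt_plus (V := R_NormedModule) _ _ _ _ _ _
    (is_RInt_scal _ _ _ (fst a) _ H2) (is_RInt_scal _ _ _ (snd a) _ H1)).
Qed.

Lemma cint_conj (f : R -> C) :
  ccont f -> cint (fun x => Cconj (f x)) = Cconj (cint f).
Proof.
move=> Hf; apply: cint_unique.
have H := ccont_is_RInt _ Hf.
apply: (is_RInt_fct_extend_pair (U := R_NormedModule) (V := R_NormedModule)) => /=.
- exact: (is_RInt_fct_extend_fst _ _ _ _ H).
- exact: (is_RInt_opp (V := R_NormedModule) _ _ _ _ (is_RInt_fct_extend_snd _ _ _ _ H)).
Qed.

Lemma cint_sum (F : nat -> R -> C) (n : nat) :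
  (forall k, ccont (F k)) ->
  cint (fun t => sum_n (fun k => F k t) n) = sum_n (fun k => cint (F k)) n.
Proof.
move=> HF; elim: n => [|n IH].
  by rewrite sum_O; apply: cint_ext => t; rewrite sum_O.
rewrite sum_Sn -IH -[plus _ _]/(Cplus _ _) -cint_plus //; last exact: ccont_sum.
by apply: cint_ext => t; rewrite sum_Sn.
Qed.

(** The majorant is the real part of a complex function, so that the identities for [cint], Parseval
    in particular, evaluate its integral. *)
Lemma cint_dominated (f g : R -> C) :
  ccont f -> ccont g -> (forall t, Cmod (f t) <= fst (g t)) ->
  Cmod (cint f) <= fst (cint g).
Proof.
move=> Hf Hg H; rewrite Cmod_norm.
apply: (norm_RInt_le (V := C_R_NormedModule) f (fun t => fst (g t)) 0 1) => //.
- lra.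
- by move=> x _; have := H x; rewrite Cmod_norm.
- exact: ccont_is_RInt.
- exact: (is_RInt_fct_extend_fst _ _ _ _ (ccont_is_RInt _ Hg)).
Qed.

Lemma cint_const (c : C) : cint (fun _ => c) = c.
Proof.
apply: cint_unique.
have := is_RInt_const (V := C_R_NormedModule) 0 1 c.
by rewrite Rminus_0_r (scal_one (V := C_R_NormedModule)).
Qed.

Lemma cint_bound (f : R -> C) (B : R) :
  ccont f -> (forall t, Cmod (f t) <= B) -> Cmod (cint f) <= B.
Proof.
move=> Hf HB.
have := cint_dominated f (fun _ => RtoC B) Hf (ccont_const _) HB.
by rewrite cint_const.
Qed.

(** * Characters of the circle *)

Definition echar (n : Z) (t : R) : C :=
  (cos (2 * PI * IZR n * t), sin (2 * PI * IZR n * t)).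

Lemma echar_0 (t : R) : echar 0 t = RtoC 1.
Proof. by rewrite /echar Rmult_0_r Rmult_0_l cos_0 sin_0. Qed.

Lemma echar_plus (n m : Z) (t : R) :
  echar (n + m) t = Cmult (echar n t) (echar m t).
Proof.
rewrite /echar plus_IZR /Cmult /=.
have -> : 2 * PI * (IZR n + IZR m) * t = 2 * PI * IZR n * t + 2 * PI * IZR m * t by ring.
by rewrite cos_plus sin_plus; congr pair; ring.
Qed.

Lemma echar_conj (n : Z) (t : R) : Cconj (echar n t) = echar (- n) t.
Proof.
rewrite /echar /Cconj opp_IZR /=.
have -> : 2 * PI * - IZR n * t = - (2 * PI * IZR n * t) by ring.
by rewrite cos_neg sin_neg.
Qed.

Lemma Cmod_echar (n : Z) (t : R) : Cmod (echar n t) = 1.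
Proof.
rewrite /Cmod /echar /=.
have := sin2_cos2 (2 * PI * IZR n * t); rewrite /Rsqr => H.
by rewrite !Rmult_1_r Rplus_comm H sqrt_1.
Qed.

Lemma echar_periodic (n : Z) (t : R) : echar n (t + 1) = echar n t.
Proof.
rewrite /echar.
have -> : 2 * PI * IZR n * (t + 1) = 2 * PI * IZR n * t + 2 * IZR n * PI by ring.
case: (Z_le_gt_dec 0 n) => Hn.
- rewrite -(Z2Nat.id n Hn) -INR_IZR_INZ.
  by rewrite cos_period sin_period.
- have Hm : (0 <= - n)%Z by lia.
  rewrite -(cos_period (_ + _) (Z.to_nat (- n))) -(sin_period (_ + _) (Z.to_nat (- n))).
  rewrite INR_IZR_INZ Z2Nat.id // opp_IZR.
  by congr pair; [congr cos | congr sin]; ring.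
Qed.

(** * Differentiation on the circle *)

(* [d] is the value of (2 pi i)^{-1} f' at [x]. *)
Definition has_D (f : R -> C) (x : R) (d : C) : Prop :=
  is_derive (fun t => fst (f t)) x (- (2 * PI) * snd d) /\
  is_derive (fun t => snd (f t)) x (2 * PI * fst d).

Lemma two_PI_neq0 : 2 * PI <> 0.
Proof. by have := PI_RGT_0; lra. Qed.

Lemma Cinv_2PI_Ci : Cinv (Cmult (RtoC (2 * PI)) Ci) = (0, - / (2 * PI)).
Proof.
have P := PI_RGT_0.
by rewrite /Cinv /Ci /Cmult /RtoC /=; congr pair; field; lra.
Qed.

Lemma has_D_Dtorus (f : R -> C) (x : R) (d : C) : has_D f x d -> Dtorus f x = d.
Proof.
move=> [H1 H2]; rewrite /Dtorus (is_derive_unique _ _ _ H1) (is_derive_unique _ _ _ H2).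
have P := two_PI_neq0.
rewrite Cinv_2PI_Ci /Cmult (surjective_pairing d) /=.
have P' := PI_RGT_0.
by congr pair; field; lra.
Qed.

(** [Derive] has a value at every point, differentiable or not; this predicate says that the value
    of [Dtorus] is a genuine derivative. *)
Definition cdiff (f : R -> C) : Prop :=
  forall x : R, has_D f x (Dtorus f x).

Lemma ex_derive_cdiff (f : R -> C) :
  (forall x, ex_derive (V := C_R_NormedModule) f x) <-> cdiff f.
Proof.
split=> H x.
- have [l Hl] := H x.
  have H1 : is_derive (fun t => fst (f t)) x (fst l).
    by apply: (filterdiff_comp' f fst x _ fst Hl (filterdiff_linear _ is_linear_fst)).
  have H2 : is_derive (fun t => snd (f t)) x (snd l).
    by apply: (filterdiff_comp' f snd x _ snd Hl (filterdiff_linear _ is_linear_snd)).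
  have P := two_PI_neq0.
  have Hd : has_D f x (snd l / (2 * PI), - fst l / (2 * PI)).
    split=> /=.
    + by have -> : - (2 * PI) * (- fst l / (2 * PI)) = fst l by field; lra.
    + by have -> : (2 * PI) * (snd l / (2 * PI)) = snd l by field; lra.
  by rewrite (has_D_Dtorus _ _ _ Hd).
- have [H1 H2] := H x.
  exists (- (2 * PI) * snd (Dtorus f x), 2 * PI * fst (Dtorus f x)).
  apply: (is_derive_ext (fun t => (fst (f t), snd (f t)) : C_R_NormedModule)).
    by move=> t; case: (f t).
  apply: (filterdiff_comp'_2 (fun t => fst (f t)) (fun t => snd (f t))
    (fun u v => (u, v) : C_R_NormedModule) x _ _ (fun u v => (u, v)) H1 H2).
  apply: (filterdiff_ext_lin _ (fun t => t)); last by case.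
  by apply: (filterdiff_ext (fun t => t)); [case | exact: filterdiff_id].
Qed.

Lemma cdiff_ccont (f : R -> C) : cdiff f -> ccont f.
Proof.
move=> H x; apply: (ex_derive_continuous (V := C_R_NormedModule)).
exact: (proj2 (ex_derive_cdiff f) H x).
Qed.

Lemma has_D_const (c : C) (x : R) : has_D (fun _ => c) x (RtoC 0).
Proof.
by split=> /=; rewrite Rmult_0_r; apply: is_derive_const.
Qed.

Lemma has_D_plus (f g : R -> C) (x : R) (a b : C) :
  has_D f x a -> has_D g x b -> has_D (fun t => Cplus (f t) (g t)) x (Cplus a b).
Proof.
move=> [H1 H2] [H3 H4]; split=> /=; rewrite Rmult_plus_distr_l.
- exact: (is_derive_plus (V := R_NormedModule) _ _ _ _ _ H1 H3).
- exact: (is_derive_plus (V := R_NormedModule) _ _ _ _ _ H2 H4).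
Qed.

Lemma has_D_mult (f g : R -> C) (x : R) (a b : C) :
  has_D f x a -> has_D g x b ->
  has_D (fun t => Cmult (f t) (g t)) x (Cplus (Cmult a (g x)) (Cmult (f x) b)).
Proof.
move=> [H1 H2] [H3 H4]; split=> /=.
- have -> : - (2 * PI) * (fst a * snd (g x) + snd a * fst (g x) +
       (fst (f x) * snd b + snd (f x) * fst b)) =
     (- (2 * PI) * snd a * fst (g x) + fst (f x) * (- (2 * PI) * snd b)) -
     (2 * PI * fst a * snd (g x) + snd (f x) * (2 * PI * fst b)) by ring.
  apply: (is_derive_minus (V := R_NormedModule));
    by apply: (is_derive_mult (K := R_AbsRing)) => //; apply: Rmult_comm.
- have -> : 2 * PI * (fst a * fst (g x) - snd a * snd (g x) +
       (fst (f x) * fst b - snd (f x) * snd b)) =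
     (- (2 * PI) * snd a * snd (g x) + fst (f x) * (2 * PI * fst b)) +
     (2 * PI * fst a * fst (g x) + snd (f x) * (- (2 * PI) * snd b)) by ring.
  apply: (is_derive_plus (V := R_NormedModule));
    by apply: (is_derive_mult (K := R_AbsRing)) => //; apply: Rmult_comm.
Qed.

Lemma has_D_conj (f : R -> C) (x : R) (a : C) :
  has_D f x a -> has_D (fun t => Cconj (f t)) x (Copp (Cconj a)).
Proof.
move=> [H1 H2]; split=> /=.
- by have -> : - (2 * PI) * - - snd a = - (2 * PI) * snd a by ring.
- have -> : 2 * PI * - fst a = - (2 * PI * fst a) by ring.
  exact: (is_derive_opp (V := R_NormedModule)).
Qed.

Lemma has_D_echar (n : Z) (x : R) :
  has_D (echar n) x (Cmult (RtoC (IZR n)) (echar n x)).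
Proof.
split=> /=; auto_derive=> //; ring.
Qed.

Lemma ccont_echar (n : Z) : ccont (echar n).
Proof.
apply: cdiff_ccont => x; rewrite (has_D_Dtorus _ _ _ (has_D_echar n x)).
exact: has_D_echar.
Qed.

(** Recursion on the function instead of [Nat.iter]: with the Leibniz rule, stability under products
    follows by induction on the order, without a formula for iterated derivatives. *)
Fixpoint cdiff_n (n : nat) (f : R -> C) : Prop :=
  match n with
  | 0%nat => cdiff f
  | S m => cdiff f /\ cdiff_n m (Dtorus f)
  end.

Lemma cdiff_n_pred (n : nat) (f : R -> C) : cdiff_n (S n) f -> cdiff_n n f.
Proof. by elim: n f => [|n IH] f [H1 H2] //; split=> //; apply: IH. Qed.

Lemma cdiff_n_iter (n : nat) (f : R -> C) :
  (forall k, cdiff (Nat.iter k Dtorus f)) -> cdiff_n n f.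
Proof.
elim: n f => [|n IH] f H; first exact: (H 0%nat).
split; first exact: (H 0%nat).
by apply: IH => k; rewrite -Nat.iter_succ_r; apply: H.
Qed.

Lemma smooth_cdiff_n (f : R -> C) :
  smooth_torus f <-> (forall x, f (x + 1) = f x) /\ (forall n, cdiff_n n f).
Proof.
split=> [[Hp Hs]|[Hp Hs]]; split=> // n.
- by apply: cdiff_n_iter => k; apply/ex_derive_cdiff => x; apply: Hs.
- apply/ex_derive_cdiff; have := Hs n.
  elim: n f {Hp Hs} => [|n IH] f //= [_ H].
  by have := IH _ H; rewrite -Nat.iter_succ_r.
Qed.

Lemma Dtorus_plus (f g : R -> C) : cdiff f -> cdiff g ->
  Dtorus (fun t => Cplus (f t) (g t)) = (fun t => Cplus (Dtorus f t) (Dtorus g t)).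
Proof.
move=> Hf Hg; apply: funext => x; apply: has_D_Dtorus.
exact: has_D_plus.
Qed.

Lemma Dtorus_mult (f g : R -> C) : cdiff f -> cdiff g ->
  Dtorus (fun t => Cmult (f t) (g t)) =
  (fun t => Cplus (Cmult (Dtorus f t) (g t)) (Cmult (f t) (Dtorus g t))).
Proof.
move=> Hf Hg; apply: funext => x; apply: has_D_Dtorus.
exact: has_D_mult.
Qed.

Lemma Dtorus_const (c : C) : Dtorus (fun _ => c) = (fun _ => RtoC 0).
Proof.
apply: funext => x; apply: has_D_Dtorus; exact: has_D_const.
Qed.

Lemma cdiff_const (c : C) : cdiff (fun _ => c).
Proof. by move=> x; rewrite Dtorus_const; apply: has_D_const. Qed.

Lemma Dtorus_scal (k : C) (f : R -> C) : cdiff f ->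
  Dtorus (fun t => Cmult k (f t)) = (fun t => Cmult k (Dtorus f t)).
Proof.
move=> Hf; rewrite (Dtorus_mult _ _ (cdiff_const k) Hf) Dtorus_const.
by apply: funext => x; ring.
Qed.

Lemma Dtorus_conj (f : R -> C) : cdiff f ->
  Dtorus (fun t => Cconj (f t)) = (fun t => Cmult (RtoC (-1)) (Cconj (Dtorus f t))).
Proof.
move=> Hf; apply: funext => x; apply: has_D_Dtorus.
have -> : Cmult (RtoC (-1)) (Cconj (Dtorus f x)) = Copp (Cconj (Dtorus f x)).
  by rewrite /Cmult /Copp /=; congr pair; ring.
exact: has_D_conj.
Qed.

Lemma cdiff_plus (f g : R -> C) : cdiff f -> cdiff g ->
  cdiff (fun t => Cplus (f t) (g t)).
Proof. by move=> Hf Hg x; rewrite Dtorus_plus //; apply: has_D_plus. Qed.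

Lemma cdiff_mult (f g : R -> C) : cdiff f -> cdiff g ->
  cdiff (fun t => Cmult (f t) (g t)).
Proof. by move=> Hf Hg x; rewrite Dtorus_mult //; apply: has_D_mult. Qed.

Lemma cdiff_conj (f : R -> C) : cdiff f -> cdiff (fun t => Cconj (f t)).
Proof.
move=> Hf x; have := has_D_conj _ _ _ (Hf x) => H.
by rewrite (has_D_Dtorus _ _ _ H).
Qed.

Lemma cdiff_n_plus (n : nat) (f g : R -> C) : cdiff_n n f -> cdiff_n n g ->
  cdiff_n n (fun t => Cplus (f t) (g t)).
Proof.
elim: n f g => [|n IH] f g; first exact: cdiff_plus.
move=> [H1 H2] [H3 H4]; split; first exact: cdiff_plus.
by rewrite Dtorus_plus //; apply: IH.
Qed.

Lemma cdiff_n_mult (n : nat) (f g : R -> C) : cdiff_n n f -> cdiff_n n g ->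
  cdiff_n n (fun t => Cmult (f t) (g t)).
Proof.
elim: n f g => [|n IH] f g; first exact: cdiff_mult.
move=> Hf Hg.
have [[H1 H2] [H3 H4]] := (Hf, Hg).
split; first exact: cdiff_mult.
rewrite Dtorus_mult //; apply: cdiff_n_plus; apply: IH => //; exact: cdiff_n_pred.
Qed.

Lemma cdiff_n_const (n : nat) (c : C) : cdiff_n n (fun _ => c).
Proof.
elim: n c => [|n IH] c; first exact: cdiff_const.
by split; [apply: cdiff_const | rewrite Dtorus_const; apply: IH].
Qed.

Lemma cdiff_n_conj (n : nat) (f : R -> C) : cdiff_n n f ->
  cdiff_n n (fun t => Cconj (f t)).
Proof.
elim: n f => [|n IH] f; first exact: cdiff_conj.
move=> [H1 H2]; split; first exact: cdiff_conj.
rewrite Dtorus_conj //; apply: cdiff_n_mult; first exact: cdiff_n_const.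
exact: IH.
Qed.

Lemma smooth_plus (f g : R -> C) : smooth_torus f -> smooth_torus g ->
  smooth_torus (fun t => Cplus (f t) (g t)).
Proof.
move=> /smooth_cdiff_n [Pf Hf] /smooth_cdiff_n [Pg Hg]; apply/smooth_cdiff_n.
by split=> [x|n]; [rewrite Pf Pg | apply: cdiff_n_plus].
Qed.

Lemma smooth_mult (f g : R -> C) : smooth_torus f -> smooth_torus g ->
  smooth_torus (fun t => Cmult (f t) (g t)).
Proof.
move=> /smooth_cdiff_n [Pf Hf] /smooth_cdiff_n [Pg Hg]; apply/smooth_cdiff_n.
by split=> [x|n]; [rewrite Pf Pg | apply: cdiff_n_mult].
Qed.

Lemma smooth_const (c : C) : smooth_torus (fun _ => c).
Proof. by apply/smooth_cdiff_n; split=> // n; apply: cdiff_n_const. Qed.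

Lemma smooth_scal (k : C) (f : R -> C) : smooth_torus f ->
  smooth_torus (fun t => Cmult k (f t)).
Proof. by move=> Hf; apply: smooth_mult => //; apply: smooth_const. Qed.

Lemma smooth_conj (f : R -> C) : smooth_torus f -> smooth_torus (fun t => Cconj (f t)).
Proof.
move=> /smooth_cdiff_n [Pf Hf]; apply/smooth_cdiff_n.
by split=> [x|n]; [rewrite Pf | apply: cdiff_n_conj].
Qed.

Lemma smooth_cdiff (f : R -> C) : smooth_torus f -> cdiff f.
Proof. by move=> /smooth_cdiff_n [_ H]; apply: (H 0%nat). Qed.

Lemma smooth_ccont (f : R -> C) : smooth_torus f -> ccont f.
Proof. by move=> H; apply: cdiff_ccont; apply: smooth_cdiff. Qed.

Lemma smooth_Dtorus (f : R -> C) : smooth_torus f -> smooth_torus (Dtorus f).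
Proof.
move=> /smooth_cdiff_n [Pf Hf]; apply/smooth_cdiff_n; split.
- move=> x; apply: has_D_Dtorus.
  have [H1 H2] := Hf 0%nat x.
  (* By periodicity f is its own composite with y - 1, so the chain rule carries the derivative from
     x to x + 1. *)
  have Hs : is_derive (fun y : R => y - 1) (x + 1) 1 by auto_derive.
  have Hx : x + 1 - 1 = x by ring.
  rewrite -{1}Hx in H1; rewrite -{1}Hx in H2.
  split.
  + have := is_derive_comp (fun t => fst (f t)) (fun y => y - 1) _ _ _ H1 Hs.
    rewrite /scal /= /mult /= Rmult_1_l.
    by apply: is_derive_ext => t; rewrite -(Pf (t - 1)); congr (fst (f _)); ring.
  + have := is_derive_comp (fun t => snd (f t)) (fun y => y - 1) _ _ _ H2 Hs.
    rewrite /scal /= /mult /= Rmult_1_l.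
    by apply: is_derive_ext => t; rewrite -(Pf (t - 1)); congr (snd (f _)); ring.
- by move=> n; have [] := Hf (S n).
Qed.

Lemma smooth_iter_Dtorus (k : nat) (f : R -> C) :
  smooth_torus f -> smooth_torus (Nat.iter k Dtorus f).
Proof. by move=> H; elim: k => [|k IH] //=; apply: smooth_Dtorus. Qed.

(** * Suprema and the C^l norms *)

(** [real] sends an infinite bound to 0; a point of P and an upper bound exclude that case. *)
Lemma lub_finite (P : R -> Prop) (x0 B : R) :
  P x0 -> (forall x, P x -> x <= B) ->
  (forall x, P x -> x <= real (Lub_Rbar P)) /\ real (Lub_Rbar P) <= B.
Proof.
move=> H0 HB; have [U L] := Lub_Rbar_correct P.
have LB : Rbar_le (Lub_Rbar P) B by apply: L => x Hx; apply: HB.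
have L0 := U x0 H0.
case E : (Lub_Rbar P) LB L0 => [l| |] //= LB L0.
by split=> // x Hx; have := U x Hx; rewrite E.
Qed.

Lemma periodic_Z (f : R -> C) (n : Z) (x : R) :
  (forall x, f (x + 1) = f x) -> f (x + IZR n) = f x.
Proof.
move=> Pf.
have Hn : forall m y, f (y + INR m) = f y.
  elim=> [|m IH] y; first by rewrite Rplus_0_r.
  by rewrite S_INR -Rplus_assoc Pf.
case: (Z_le_gt_dec 0 n) => H.
- by rewrite -(Z2Nat.id n H) -INR_IZR_INZ.
- have Hm : (0 <= - n)%Z by lia.
  rewrite -(Hn (Z.to_nat (- n)) (x + IZR n)) INR_IZR_INZ Z2Nat.id // opp_IZR.
  by congr f; ring.
Qed.

Lemma periodic_bounded (f : R -> C) :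
  (forall x, f (x + 1) = f x) -> ccont f -> exists B, forall x, Cmod (f x) <= B.
Proof.
move=> Pf Cf.
have [M HM] := bounded_continuity (V := C_R_NormedModule) f 0 1 (fun x _ => Cf x).
exists M => x.
have [H1 H2] := archimed x.
rewrite -(periodic_Z f (1 - up x) x Pf) minus_IZR Cmod_norm.
apply: Rlt_le; apply: HM; lra.
Qed.

Lemma supnorm_spec (f : R -> C) (B : R) :
  (forall x, Cmod (f x) <= B) ->
  (forall x, Cmod (f x) <= supnorm f) /\ supnorm f <= B.
Proof.
move=> HB.
have [H1 H2] := lub_finite (fun r => exists x : R, r = Cmod (f x)) (Cmod (f 0)) B
  (ex_intro _ 0 eq_refl) ltac:(by move=> r [x ->]).
by split=> // x; apply: H1; exists x.
Qed.

Lemma smooth_bounded (f : R -> C) : smooth_torus f -> exists B, forall x, Cmod (f x) <= B.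
Proof.
by move=> H; apply: periodic_bounded; [case: H | apply: smooth_ccont].
Qed.

Lemma supnorm_ub (f : R -> C) (x : R) : smooth_torus f -> Cmod (f x) <= supnorm f.
Proof. by move=> /smooth_bounded [B HB]; apply: (proj1 (supnorm_spec f B HB)). Qed.

Lemma supnorm_le (f : R -> C) (B : R) : (forall x, Cmod (f x) <= B) -> supnorm f <= B.
Proof. by move=> HB; apply: (proj2 (supnorm_spec f B HB)). Qed.

Lemma supnorm_ge0 (f : R -> C) : smooth_torus f -> 0 <= supnorm f.
Proof. by move=> H; apply: Rle_trans (supnorm_ub f 0 H); apply: Cmod_ge_0. Qed.

Lemma supnorm_plus (f g : R -> C) : smooth_torus f -> smooth_torus g ->
  supnorm (fun t => Cplus (f t) (g t)) <= supnorm f + supnorm g.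
Proof.
move=> Hf Hg; apply: supnorm_le => x; apply: Rle_trans (Cmod_triangle _ _) _.
by apply: Rplus_le_compat; apply: supnorm_ub.
Qed.

Lemma supnorm_mult (f g : R -> C) : smooth_torus f -> smooth_torus g ->
  supnorm (fun t => Cmult (f t) (g t)) <= supnorm f * supnorm g.
Proof.
move=> Hf Hg; apply: supnorm_le => x; rewrite Cmod_mult.
by apply: Rmult_le_compat; try exact: Cmod_ge_0; apply: supnorm_ub.
Qed.

Lemma supnorm_scal (k : C) (f : R -> C) : smooth_torus f ->
  supnorm (fun t => Cmult k (f t)) = Cmod k * supnorm f.
Proof.
move=> Hf; apply: Rle_antisym.
- apply: supnorm_le => x; rewrite Cmod_mult.
  by apply: Rmult_le_compat_l; [apply: Cmod_ge_0 | apply: supnorm_ub].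
- have [->|Hk] := Req_dec (Cmod k) 0.
    by rewrite Rmult_0_l; apply: supnorm_ge0; apply: smooth_scal.
  have Hk' : 0 < Cmod k by have := Cmod_ge_0 k; lra.
  rewrite Rmult_comm; apply/(Rle_div_r _ _ _ Hk'); apply: supnorm_le => x.
  apply/(Rle_div_r _ _ _ Hk'); rewrite Rmult_comm -Cmod_mult.
  by apply: (supnorm_ub (fun t => Cmult k (f t))); apply: smooth_scal.
Qed.

Lemma supnorm_conj (f : R -> C) : supnorm (fun t => Cconj (f t)) = supnorm f.
Proof.
rewrite /supnorm; congr real; apply: Lub_Rbar_eqset => r.
by split=> -[x ->]; exists x; rewrite Cmod_conj.
Qed.

Lemma binomial_sum_succ (a : nat -> R) (l : nat) :
  sum_n (fun j => Binomial.C (S l) j * a j) (S l) =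
  sum_n (fun j => Binomial.C l j * a j) l + sum_n (fun j => Binomial.C l j * a (S j)) l.
Proof.
(* The partial sums up to m differ by one boundary term, which Pascal's rule absorbs at the next
   step; at m = l its coefficient is 1 and it is the last term of the left-hand sum. *)
have key : forall m, (m <= l)%nat ->
    sum_n (fun j => Binomial.C (S l) j * a j) m + Binomial.C l m * a (S m) =
    sum_n (fun j => Binomial.C l j * a j) m + sum_n (fun j => Binomial.C l j * a (S j)) m.
  elim=> [|m IH] Hm; first by rewrite !sum_O !C_n_0.
  rewrite !sum_Sn /plus /= -(pascal l m); last lia.
  have := IH ltac:(lia); lra.
have := key l (le_n l); rewrite C_n_n => <-.
by rewrite sum_Sn C_n_n.
Qed.

Lemma Clnorm_0 (f : R -> C) : Clnorm 0 f = supnorm f.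
Proof. by rewrite /Clnorm sum_O C_n_0 Rmult_1_l. Qed.

Lemma Clnorm_succ (l : nat) (f : R -> C) :
  Clnorm (S l) f = Clnorm l f + Clnorm l (Dtorus f).
Proof.
rewrite /Clnorm binomial_sum_succ; congr Rplus.
by apply: sum_n_ext => j; rewrite Nat.iter_succ_r.
Qed.

Lemma Clnorm_ge0 (l : nat) (f : R -> C) : smooth_torus f -> 0 <= Clnorm l f.
Proof.
elim: l f => [|l IH] f Hf; first by rewrite Clnorm_0; apply: supnorm_ge0.
rewrite Clnorm_succ; apply: Rplus_le_le_0_compat; apply: IH => //.
exact: smooth_Dtorus.
Qed.

Lemma Clnorm_plus (l : nat) (f g : R -> C) : smooth_torus f -> smooth_torus g ->
  Clnorm l (fun t => Cplus (f t) (g t)) <= Clnorm l f + Clnorm l g.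
Proof.
elim: l f g => [|l IH] f g Hf Hg; first by rewrite !Clnorm_0; apply: supnorm_plus.
rewrite !Clnorm_succ Dtorus_plus; try exact: smooth_cdiff.
have := IH _ _ Hf Hg.
have := IH _ _ (smooth_Dtorus _ Hf) (smooth_Dtorus _ Hg); lra.
Qed.

Lemma Clnorm_scal (l : nat) (k : C) (f : R -> C) : smooth_torus f ->
  Clnorm l (fun t => Cmult k (f t)) = Cmod k * Clnorm l f.
Proof.
elim: l f => [|l IH] f Hf; first by rewrite !Clnorm_0; apply: supnorm_scal.
rewrite !Clnorm_succ Dtorus_scal; last exact: smooth_cdiff.
rewrite IH // IH; last exact: smooth_Dtorus.
ring.
Qed.

Lemma Clnorm_conj (l : nat) (f : R -> C) : smooth_torus f ->
  Clnorm l (fun t => Cconj (f t)) = Clnorm l f.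
Proof.
elim: l f => [|l IH] f Hf; first by rewrite !Clnorm_0; apply: supnorm_conj.
rewrite !Clnorm_succ Dtorus_conj; last exact: smooth_cdiff.
have Hd := smooth_Dtorus _ Hf.
rewrite IH // Clnorm_scal; last exact: smooth_conj.
by rewrite IH // Cmod_R Rabs_left; lra.
Qed.

(** In the expansion of (|f| + |D f|) (|g| + |D g|), the Leibniz rule uses three of the four terms,
    and the fourth is nonnegative. The product estimates for operators below repeat this induction
    step. *)
Lemma Clnorm_mult (l : nat) (f g : R -> C) : smooth_torus f -> smooth_torus g ->
  Clnorm l (fun t => Cmult (f t) (g t)) <= Clnorm l f * Clnorm l g.
Proof.
elim: l f g => [|l IH] f g Hf Hg; first by rewrite !Clnorm_0; apply: supnorm_mult.
have [Hf' Hg'] := (smooth_Dtorus _ Hf, smooth_Dtorus _ Hg).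
rewrite !Clnorm_succ Dtorus_mult; try exact: smooth_cdiff.
have := IH _ _ Hf Hg; have := IH _ _ Hf' Hg; have := IH _ _ Hf Hg'.
have := Clnorm_plus l _ _ (smooth_mult _ _ Hf' Hg) (smooth_mult _ _ Hf Hg').
have := Rmult_le_pos _ _ (Clnorm_ge0 l _ Hf') (Clnorm_ge0 l _ Hg').
move=> ? ? ? ? ?; lra.
Qed.

Lemma Clnorm_mono (l l' : nat) (f : R -> C) :
  smooth_torus f -> (l <= l')%nat -> Clnorm l f <= Clnorm l' f.
Proof.
move=> Hf; elim=> [|m _ IH]; first lra.
rewrite Clnorm_succ; have := Clnorm_ge0 m _ (smooth_Dtorus _ Hf); lra.
Qed.

Lemma supnorm_iter_Dtorus_le (k l : nat) (f : R -> C) :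
  smooth_torus f -> (k <= l)%nat -> supnorm (Nat.iter k Dtorus f) <= Clnorm l f.
Proof.
elim: k l f => [|k IH] l f Hf Hkl.
  by rewrite -Clnorm_0 /=; apply: Clnorm_mono => //; lia.
case: l Hkl => [|l] Hkl; first lia.
rewrite Nat.iter_succ_r Clnorm_succ.
have := IH l _ (smooth_Dtorus _ Hf) ltac:(lia); have := Clnorm_ge0 l _ Hf; lra.
Qed.

Lemma Clnorm_eq0 (l : nat) (f : R -> C) :
  smooth_torus f -> Clnorm l f = 0 -> f = (fun _ => RtoC 0).
Proof.
move=> Hf H0; apply: funext => x; apply: Cmod_eq_0.
have := supnorm_ub f x Hf; have := supnorm_iter_Dtorus_le 0 l f Hf ltac:(lia).
rewrite /= H0; have := Cmod_ge_0 (f x); lra.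
Qed.

(** * Limits of sequences in a normed space *)

Definition nlim {V : NormedModule C_AbsRing} (u : nat -> V) (l : V) : Prop :=
  is_lim_seq (fun n => norm (minus (u n) l)) 0.

Local Notation climit := (nlim (V := C_NormedModule)).

Lemma nlim_filterlim {V : NormedModule C_AbsRing} (u : nat -> V) (l : V) :
  nlim u l <-> filterlim u eventually (locally l).
Proof.
split=> H.
- apply/filterlim_locally_ball_norm => eps.
  have [N HN] := proj2 (is_lim_seq_spec _ _) H eps.
  exists N => n Hn; have := HN n Hn.
  by rewrite Rminus_0_r Rabs_pos_eq //; apply: norm_ge_0.
- apply/is_lim_seq_spec => eps.
  have [N HN] := proj1 (filterlim_locally_ball_norm u l) H eps.
  exists N => n Hn; have := HN n Hn.
  by rewrite Rminus_0_r Rabs_pos_eq //; apply: norm_ge_0.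
Qed.

Lemma is_lim_seq_0_le (u v : nat -> R) :
  (forall n, 0 <= u n <= v n) -> is_lim_seq v 0 -> is_lim_seq u 0.
Proof.
move=> H Hv; apply: (is_lim_seq_le_le (fun _ => 0) u v) => //.
exact: is_lim_seq_const.
Qed.

Lemma nlim_le {V : NormedModule C_AbsRing} (u : nat -> V) (l : V) (v : nat -> R) :
  (forall n, norm (minus (u n) l) <= v n) -> is_lim_seq v 0 -> nlim u l.
Proof.
move=> H; apply: is_lim_seq_0_le => n; split=> //; exact: norm_ge_0.
Qed.

Lemma nlim_const {V : NormedModule C_AbsRing} (l : V) : nlim (fun _ => l) l.
Proof.
apply: (is_lim_seq_ext (fun _ => 0)); last exact: is_lim_seq_const.
by move=> n; rewrite minus_eq_zero norm_zero.
Qed.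

Lemma nlim_eventually_const {V : NormedModule C_AbsRing} (u : nat -> V) (l : V) (N : nat) :
  (forall n, (N <= n)%nat -> u n = l) -> nlim u l.
Proof.
move=> Hu; apply: (is_lim_seq_ext_loc (fun _ => 0)); last exact: is_lim_seq_const.
by exists N => n Hn; rewrite Hu // minus_eq_zero norm_zero.
Qed.

Lemma nlim_plus {V : NormedModule C_AbsRing} (u v : nat -> V) (l m : V) :
  nlim u l -> nlim v m -> nlim (fun n => plus (u n) (v n)) (plus l m).
Proof.
move=> /nlim_filterlim Hu /nlim_filterlim Hv; apply/nlim_filterlim.
exact: (filterlim_comp_2 u v plus Hu Hv (filterlim_plus l m)).
Qed.

Lemma nlim_scal {V : NormedModule C_AbsRing} (k : C) (u : nat -> V) (l : V) :
  nlim u l -> nlim (fun n => scal k (u n)) (scal k l).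
Proof.
move=> /nlim_filterlim Hu; apply/nlim_filterlim.
exact: (filterlim_comp _ _ _ _ _ _ _ _ Hu (filterlim_scal_r k l)).
Qed.

Lemma nlim_unique {V : NormedModule C_AbsRing} (u : nat -> V) (l m : V) :
  nlim u l -> nlim u m -> l = m.
Proof.
move=> /nlim_filterlim Hu /nlim_filterlim Hv.
exact: (filterlim_locally_unique _ _ _ Hu Hv).
Qed.

Lemma nlim_ext {V : NormedModule C_AbsRing} (u v : nat -> V) (l : V) :
  (forall n, u n = v n) -> nlim u l -> nlim v l.
Proof. by move=> E; apply: is_lim_seq_ext => n; rewrite E. Qed.

Lemma nlim_norm {V : NormedModule C_AbsRing} (u : nat -> V) (l : V) :
  nlim u l -> is_lim_seq (fun n => norm (u n)) (norm l).
Proof.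
move=> /nlim_filterlim Hu.
exact: (filterlim_comp _ _ _ _ _ _ _ _ Hu (filterlim_norm l)).
Qed.

Lemma nlim_norm_le {V : NormedModule C_AbsRing} (u : nat -> V) (l : V) (B : R) :
  nlim u l -> (forall n, norm (u n) <= B) -> norm l <= B.
Proof.
move=> Hu HB.
exact: (is_lim_seq_le _ _ _ _ HB (nlim_norm _ _ Hu) (is_lim_seq_const B)).
Qed.

(** * Finite sums and inverse squares *)

Lemma sum_n_le (u v : nat -> R) (n : nat) :
  (forall k, (k <= n)%nat -> u k <= v k) -> sum_n u n <= sum_n v n.
Proof.
elim: n => [|n IH] H; first by rewrite !sum_O; apply: H.
rewrite !sum_Sn; apply: Rplus_le_compat; last exact: H.
by apply: IH => k Hk; apply: H; lia.
Qed.

Lemma sum_n_norm_le {V : NormedModule C_AbsRing} (u : nat -> V) (v : nat -> R) (n : nat) :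
  (forall k, norm (u k) <= v k) -> norm (sum_n u n) <= sum_n v n.
Proof.
move=> H; elim: n => [|n IH]; first by rewrite !sum_O.
by rewrite !sum_Sn; apply: Rle_trans (norm_triangle _ _) _; apply: Rplus_le_compat.
Qed.

Lemma sum_n_nonneg (u : nat -> R) (n : nat) : (forall k, 0 <= u k) -> 0 <= sum_n u n.
Proof.
move=> H; elim: n => [|n IH]; first by rewrite sum_O.
by rewrite sum_Sn; apply: Rplus_le_le_0_compat.
Qed.

Lemma csum_ext_loc (u v : nat -> C) (n : nat) :
  (forall k, (k <= n)%nat -> u k = v k) -> sum_n u n = sum_n v n.
Proof. exact: sum_n_ext_loc. Qed.

Lemma csum_ext (u v : nat -> C) (n : nat) :
  (forall k, u k = v k) -> sum_n u n = sum_n v n.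
Proof. exact: sum_n_ext. Qed.

Lemma csum_scal (a : C) (u : nat -> C) (n : nat) :
  sum_n (fun k => Cmult a (u k)) n = Cmult a (sum_n u n).
Proof. exact: (sum_n_mult_l (K := C_Ring)). Qed.

Lemma csum_conj (u : nat -> C) (n : nat) :
  Cconj (sum_n u n) = sum_n (fun k => Cconj (u k)) n.
Proof.
elim: n => [|n IH]; first by rewrite !sum_O.
by rewrite !sum_Sn -IH /Cconj /plus /= /Cplus /=; congr pair; ring.
Qed.

Lemma csum_RtoC (u : nat -> R) (n : nat) :
  sum_n (fun k => RtoC (u k)) n = RtoC (sum_n u n).
Proof.
elim: n => [|n IH]; first by rewrite !sum_O.
by rewrite !sum_Sn IH -[plus _ _]/(Cplus _ _) -RtoC_plus.
Qed.

Lemma bounded_ex_series (b : nat -> R) (M : R) :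
  (forall n, 0 <= b n) -> (forall n, sum_n b n <= M) -> ex_series b.
Proof.
move=> H0 HM.
have [l Hl] := ex_finite_lim_seq_incr (sum_n b) M
  ltac:(by move=> n; rewrite sum_Sn /plus /=; have := H0 (S n); lra) HM.
by exists l.
Qed.

(** Telescoping, by 1 / (j + 2)^2 <= 1 / (j + 1) - 1 / (j + 2). With n = j + 1 these are the weights
    (1 + n)^(-2) of the negative frequencies in the semicommutator, and the bound 1 is the constant
    in S^2 >= S + 1. *)
Lemma sum_inv_sq_shift (n : nat) : sum_n (fun j => / (2 + INR j) ^ 2) n <= 1.
Proof.
have H : sum_n (fun j => / (2 + INR j) ^ 2) n <= 1 - / (2 + INR n).
  elim: n => [|n IH]; first by rewrite sum_O /=; lra.
  rewrite sum_Sn S_INR /plus /=.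
  have P := pos_INR n.
  have -> : 2 + (INR n + 1) = 3 + INR n by ring.
  have E : / (2 + INR n) - / (3 + INR n) = / ((2 + INR n) * (3 + INR n)) by field; lra.
  have : / ((3 + INR n) * ((3 + INR n) * 1)) <= / ((2 + INR n) * (3 + INR n)).
    by apply: Rinv_le_contravar; nra.
  simpl in IH; lra.
have : 0 < / (2 + INR n) by apply: Rinv_0_lt_compat; have := pos_INR n; lra.
lra.
Qed.

Lemma sum_inv_sq (n : nat) : sum_n (fun j => / (1 + INR j) ^ 2) n <= 2.
Proof.
case: n => [|n]; first by rewrite sum_O /=; lra.
rewrite /sum_n sum_Sn_m; last lia.
rewrite -sum_n_m_S /plus /=.
have -> : sum_n_m (fun j => / ((1 + INR (S j)) * ((1 + INR (S j)) * 1))) 0 n =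
          sum_n (fun j => / (2 + INR j) ^ 2) n.
  apply: sum_n_ext => j; rewrite S_INR /=; congr Rinv; ring.
have := sum_inv_sq_shift n; lra.
Qed.

(** * Fourier coefficients *)

Lemma fourierE (f : R -> C) (n : Z) :
  fourier f n = cint (fun x => Cmult (f x) (echar (- n) x)).
Proof. by apply: cint_ext => x; rewrite -echar_conj. Qed.

Lemma ccont_fourier_integrand (f : R -> C) (n : Z) :
  ccont f -> ccont (fun x => Cmult (f x) (echar n x)).
Proof. by move=> Hf; apply: ccont_mult => //; apply: ccont_echar. Qed.

Lemma fourier_plus (f g : R -> C) (n : Z) : ccont f -> ccont g ->
  fourier (fun t => Cplus (f t) (g t)) n = Cplus (fourier f n) (fourier g n).
Proof.
move=> Hf Hg; rewrite !fourierE -cint_plus; try exact: ccont_fourier_integrand.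
by apply: cint_ext => x; ring.
Qed.

Lemma fourier_scal (k : C) (f : R -> C) (n : Z) : ccont f ->
  fourier (fun t => Cmult k (f t)) n = Cmult k (fourier f n).
Proof.
move=> Hf; rewrite !fourierE -cint_scal; try exact: ccont_fourier_integrand.
by apply: cint_ext => x; ring.
Qed.

Lemma fourier_sum (F : nat -> R -> C) (m : nat) (n : Z) : (forall k, ccont (F k)) ->
  fourier (fun t => sum_n (fun k => F k t) m) n = sum_n (fun k => fourier (F k) n) m.
Proof.
move=> HF; elim: m => [|m IH].
  by rewrite sum_O; congr fourier; apply: funext => t; rewrite sum_O.
rewrite sum_Sn -IH -[plus _ _]/(Cplus _ _) -fourier_plus //; last exact: ccont_sum.
by congr fourier; apply: funext => t; rewrite sum_Sn.
Qed.

Lemma fourier_conj (f : R -> C) (n : Z) : ccont f ->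
  fourier (fun t => Cconj (f t)) n = Cconj (fourier f (- n)).
Proof.
move=> Hf; rewrite !fourierE -cint_conj; last exact: ccont_fourier_integrand.
by apply: cint_ext => x; rewrite Cmult_conj echar_conj Z.opp_involutive.
Qed.

Lemma fourier_echar (f : R -> C) (m n : Z) :
  fourier (fun t => Cmult (f t) (echar m t)) n = fourier f (n - m).
Proof.
rewrite !fourierE; apply: cint_ext => x; rewrite -Cmult_assoc -echar_plus.
by congr (Cmult _ (echar _ _)); ring.
Qed.

Lemma fourier_bound (f : R -> C) (n : Z) (B : R) :
  ccont f -> (forall x, Cmod (f x) <= B) -> Cmod (fourier f n) <= B.
Proof.
move=> Hf HB; rewrite fourierE; apply: cint_bound; first exact: ccont_fourier_integrand.
by move=> x; rewrite Cmod_mult Cmod_echar Rmult_1_r.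
Qed.

(** Integration by parts: the derivative of f e_(-n) has integral 0 over a period. *)
Lemma fourier_Dtorus (f : R -> C) (n : Z) : smooth_torus f ->
  fourier (Dtorus f) n = Cmult (RtoC (IZR n)) (fourier f n).
Proof.
move=> Hf.
have Hc := smooth_ccont _ Hf; have Hd := smooth_ccont _ (smooth_Dtorus _ Hf).
pose F := fun t => Cmult (f t) (echar (- n) t).
have HF : forall t, has_D F t
    (Cplus (Cmult (Dtorus f t) (echar (- n) t))
           (Cmult (f t) (Cmult (RtoC (IZR (- n))) (echar (- n) t)))).
  by move=> t; apply: has_D_mult (smooth_cdiff _ Hf t) (has_D_echar _ _).
have EF : Dtorus F = (fun t => Cplus (Cmult (Dtorus f t) (echar (- n) t))
           (Cmult (f t) (Cmult (RtoC (IZR (- n))) (echar (- n) t)))).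
  by apply: funext => t; apply: has_D_Dtorus.
have C1 := ccont_fourier_integrand _ (- n) Hd.
have C2 := ccont_fourier_integrand _ (- n) Hc.
have CF : ccont (Dtorus F).
  rewrite EF; apply: ccont_plus => //.
  apply: ccont_mult => //; apply: ccont_mult; [exact: ccont_const | exact: ccont_echar].
have E1 : F 1 = F 0.
  by rewrite /F -(Rplus_0_l 1) echar_periodic (proj1 Hf).
have P := PI_RGT_0.
have Z : cint (Dtorus F) = RtoC 0.
  apply: cint_unique.
  apply: (is_RInt_fct_extend_pair (U := R_NormedModule) (V := R_NormedModule)) => /=.
  - have := is_RInt_derive (V := R_CompleteNormedModule) (fun t => snd (F t))
      (fun t => 2 * PI * fst (Dtorus F t)) 0 1
      (fun t _ => ltac:(rewrite EF; exact: (proj2 (HF t))))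
      (fun t _ => continuous_scal_r (V := R_NormedModule) (2 * PI) _ t (ccont_fst _ CF t)).
    rewrite E1 minus_eq_zero => H.
    have := is_RInt_scal _ _ _ (/ (2 * PI)) _ H.
    rewrite scal_zero_r; apply: is_RInt_ext => t _.
    by rewrite /scal /= /mult /=; field; lra.
  - have := is_RInt_derive (V := R_CompleteNormedModule) (fun t => fst (F t))
      (fun t => - (2 * PI) * snd (Dtorus F t)) 0 1
      (fun t _ => ltac:(rewrite EF; exact: (proj1 (HF t))))
      (fun t _ => continuous_scal_r (V := R_NormedModule) (- (2 * PI)) _ t (ccont_snd _ CF t)).
    rewrite E1 minus_eq_zero => H.
    have := is_RInt_scal _ _ _ (/ - (2 * PI)) _ H.
    rewrite scal_zero_r; apply: is_RInt_ext => t _.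
    by rewrite /scal /= /mult /=; field; lra.
have E2 : cint (Dtorus F) =
    Cplus (fourier (Dtorus f) n) (Cmult (RtoC (- IZR n)) (fourier f n)).
  rewrite !fourierE -cint_scal // -cint_plus //; last by apply: ccont_mult => //; exact: ccont_const.
  rewrite EF; apply: cint_ext => x; rewrite opp_IZR; ring.
rewrite Z RtoC_opp in E2.
have -> : fourier (Dtorus f) n = Cplus (Cplus (fourier (Dtorus f) n)
   (Cmult (Copp (RtoC (IZR n))) (fourier f n))) (Cmult (RtoC (IZR n)) (fourier f n)) by ring.
by rewrite -E2; ring.
Qed.

(** For n <> 0 the previous lemma gives 0 = n c_n. This is the orthogonality of the characters,
    obtained without integrating a trigonometric function. *)
Lemma fourier_const (c : C) (n : Z) :
  fourier (fun _ => c) n = if Z.eqb n 0 then c else RtoC 0.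
Proof.
case: (Z.eqb_spec n 0) => [->|Hn].
  by rewrite fourierE -[RHS]cint_const; apply: cint_ext => x; rewrite echar_0; ring.
have := fourier_Dtorus (fun _ => c) n (smooth_const c).
rewrite Dtorus_const.
have -> : fourier (fun _ => RtoC 0) n = RtoC 0.
  rewrite fourierE -[RHS]cint_const; apply: cint_ext => x; ring.
move=> E.
have Hn' : RtoC (IZR n) <> RtoC 0 by move=> /RtoC_inj /eq_IZR.
have -> : fourier (fun _ => c) n =
  Cmult (Cinv (RtoC (IZR n))) (Cmult (RtoC (IZR n)) (fourier (fun _ => c) n)) by field.
by rewrite -E; ring.
Qed.

(** One factor 1 + |n| adds |f_n| and |(D f)_n|, which is exactly the recursion of [Clnorm]; this is
    why no constant appears. *)
Lemma fourier_decay (f : R -> C) (N : nat) (n : Z) : smooth_torus f ->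
  (1 + Rabs (IZR n)) ^ N * Cmod (fourier f n) <= Clnorm N f.
Proof.
elim: N f => [|N IH] f Hf.
  rewrite Clnorm_0 Rmult_1_l; apply: fourier_bound; first exact: smooth_ccont.
  by move=> x; apply: supnorm_ub.
have -> : (1 + Rabs (IZR n)) ^ S N * Cmod (fourier f n) =
   (1 + Rabs (IZR n)) ^ N * Cmod (fourier f n) +
   (1 + Rabs (IZR n)) ^ N * (Rabs (IZR n) * Cmod (fourier f n)) by rewrite /=; ring.
have -> : Rabs (IZR n) * Cmod (fourier f n) = Cmod (fourier (Dtorus f) n).
  by rewrite fourier_Dtorus // Cmod_mult Cmod_R.
rewrite Clnorm_succ; apply: Rplus_le_compat; apply: IH => //.
exact: smooth_Dtorus.
Qed.

(** * Trigonometric polynomials *)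

Lemma sum_n_zero {G : AbelianMonoid} (m : nat) : sum_n (fun _ => zero) m = (zero : G).
Proof. by elim: m => [|m IH]; rewrite ?sum_O ?sum_Sn ?IH ?plus_zero_l. Qed.

Lemma sum_n_single {G : AbelianMonoid} (u : nat -> G) (m j : nat) :
  (j <= m)%nat -> (forall l, (l <= m)%nat -> l <> j -> u l = zero) -> sum_n u m = u j.
Proof.
elim: m => [|m IH] Hj H0.
  by rewrite sum_O; congr u; lia.
have [E|Hne] := Nat.eq_dec j (S m).
- rewrite E sum_Sn (sum_n_ext_loc _ (fun _ => zero)).
    by rewrite sum_n_zero plus_zero_l.
  by move=> l Hl; apply: H0; lia.
- rewrite sum_Sn IH; [|lia|by move=> l Hl; apply: H0; lia].
  by rewrite (H0 (S m)) ?plus_zero_r //; lia.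
Qed.

Definition tpoly (m : nat) (s : nat -> Z) (x : nat -> C) (t : R) : C :=
  sum_n (fun l => Cmult (x l) (echar (s l) t)) m.

Lemma ccont_tpoly (m : nat) (s : nat -> Z) (x : nat -> C) : ccont (tpoly m s x).
Proof.
apply: (ccont_sum (fun l t => Cmult (x l) (echar (s l) t))) => l.
by apply: ccont_mult; [apply: ccont_const | apply: ccont_echar].
Qed.

Lemma cint_mult_conj_tpoly (F : R -> C) (m : nat) (s : nat -> Z) (x : nat -> C) :
  ccont F ->
  cint (fun t => Cmult (F t) (Cconj (tpoly m s x t))) =
  sum_n (fun l => Cmult (Cconj (x l)) (fourier F (s l))) m.
Proof.
move=> HF.
have Hc : forall l, ccont (fun t => Cmult (F t) (echar (- s l) t)).
  by move=> l; apply: ccont_fourier_integrand.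
rewrite (cint_ext _ (fun t => sum_n (fun l =>
   Cmult (Cconj (x l)) (Cmult (F t) (echar (- s l) t))) m)).
  rewrite (cint_sum (fun l t => Cmult (Cconj (x l)) (Cmult (F t) (echar (- s l) t)))).
    by apply: csum_ext => l; rewrite cint_scal // fourierE.
  by move=> l; apply: ccont_mult => //; apply: ccont_const.
move=> t; rewrite /tpoly csum_conj -csum_scal; apply: csum_ext => l.
by rewrite Cmult_conj echar_conj; ring.
Qed.

Lemma fourier_mult_tpoly (f : R -> C) (m : nat) (s : nat -> Z) (x : nat -> C) (n : Z) :
  ccont f ->
  fourier (fun t => Cmult (f t) (tpoly m s x t)) n =
  sum_n (fun l => Cmult (x l) (fourier f (n - s l))) m.
Proof.
move=> Hf.
have Hc : forall l, ccont (fun t => Cmult (f t) (echar (s l) t)).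
  by move=> l; apply: ccont_fourier_integrand.
transitivity (fourier (fun t => sum_n (fun l =>
    Cmult (x l) (Cmult (f t) (echar (s l) t))) m) n).
  congr fourier; apply: funext => t.
  by rewrite /tpoly -csum_scal; apply: csum_ext => l; ring.
rewrite (fourier_sum (fun l t => Cmult (x l) (Cmult (f t) (echar (s l) t)))).
  by apply: csum_ext => l; rewrite fourier_scal // fourier_echar.
by move=> l; apply: ccont_mult => //; apply: ccont_const.
Qed.

Lemma fourier_tpoly (m : nat) (s : nat -> Z) (x : nat -> C) (j : nat) :
  (forall k l, s k = s l -> k = l) -> (j <= m)%nat -> fourier (tpoly m s x) (s j) = x j.
Proof.
move=> Hs Hj.
have -> : tpoly m s x = (fun t => Cmult (RtoC 1) (tpoly m s x t)).
  by apply: funext => t; ring.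
rewrite fourier_mult_tpoly; last exact: ccont_const.
rewrite (sum_n_single _ _ j Hj).
  by rewrite fourier_const Z.sub_diag /=; ring.
move=> l _ Hl; rewrite fourier_const; case: Z.eqb_spec => [E|_].
  by case: Hl; apply: Hs; lia.
exact: Cmult_0_r.
Qed.

Lemma tpoly_parseval (m : nat) (s : nat -> Z) (x : nat -> C) :
  (forall k l, s k = s l -> k = l) ->
  cint (fun t => Cmult (tpoly m s x t) (Cconj (tpoly m s x t))) =
  RtoC (sum_n (fun l => Cmod (x l) ^ 2) m).
Proof.
move=> Hs; rewrite (cint_mult_conj_tpoly _ _ _ _ (ccont_tpoly m s x)) -csum_RtoC.
apply: csum_ext_loc => l Hl.
by rewrite (fourier_tpoly m s x l Hs Hl) Cmod2_conj; ring.
Qed.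

Lemma fst_mult_conj (z : C) : fst (Cmult z (Cconj z)) = Cmod z ^ 2.
Proof. by rewrite -Cmod2_conj. Qed.

(* Schwarz and Parseval for the integral of [f * X * conj Y * e_{-n}], where
   [X] and [Y] are the trigonometric polynomials with coefficients [x], [y]. *)
Lemma toeplitz_form_bound (f : R -> C) (B : R) (m : nat) (n : Z) (x y : nat -> C) :
  ccont f -> (forall t, Cmod (f t) <= B) ->
  Cmod (sum_n (fun k => sum_n (fun l => Cmult (Cconj (y k))
     (Cmult (fourier f (Z.of_nat k - Z.of_nat l + n)) (x l))) m) m) <=
  B * ((sum_n (fun k => Cmod (x k) ^ 2) m + sum_n (fun k => Cmod (y k) ^ 2) m) / 2).
Proof.
move=> Hf HB.
pose X := tpoly m Z.of_nat x; pose Y := tpoly m Z.of_nat y.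
have HX : ccont X by apply: ccont_tpoly.
have HY : ccont Y by apply: ccont_tpoly.
pose g := fun t => Cmult (f t) (echar (- n) t).
have Hg : ccont g by apply: ccont_fourier_integrand.
pose F := fun t => Cmult (g t) (X t).
have HF : ccont F by apply: ccont_mult.
(* Pointwise, B |X| |Y| <= B (|X|^2 + |Y|^2) / 2, and the integral of this majorant is given by
   Parseval. *)
pose G := fun t => Cmult (RtoC (B / 2)) (Cplus (Cmult (X t) (Cconj (X t))) (Cmult (Y t) (Cconj (Y t)))).
have HXX : ccont (fun t => Cmult (X t) (Cconj (X t))) by apply: ccont_mult => //; apply: ccont_conj.
have HYY : ccont (fun t => Cmult (Y t) (Cconj (Y t))) by apply: ccont_mult => //; apply: ccont_conj.
have HG : ccont G by apply: ccont_mult; [apply: ccont_const | apply: ccont_plus].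
have E1 : cint (fun t => Cmult (F t) (Cconj (Y t))) =
   sum_n (fun k => sum_n (fun l => Cmult (Cconj (y k))
     (Cmult (fourier f (Z.of_nat k - Z.of_nat l + n)) (x l))) m) m.
  rewrite (cint_mult_conj_tpoly _ _ _ _ HF); apply: csum_ext => k.
  rewrite (fourier_mult_tpoly _ _ _ _ _ Hg) -csum_scal; apply: csum_ext => l.
  rewrite /g fourier_echar.
  have -> : (Z.of_nat k - Z.of_nat l - - n = Z.of_nat k - Z.of_nat l + n)%Z by ring.
  by ring.
have inj : forall k l, Z.of_nat k = Z.of_nat l -> k = l by move=> k l; lia.
have E2 : fst (cint G) =
  B * ((sum_n (fun k => Cmod (x k) ^ 2) m + sum_n (fun k => Cmod (y k) ^ 2) m) / 2).
  rewrite /G cint_scal; last exact: ccont_plus.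
  rewrite cint_plus // /X /Y !tpoly_parseval //=; field.
rewrite -E1 -E2; apply: cint_dominated => //.
  by apply: ccont_mult => //; apply: ccont_conj.
move=> t; rewrite /F /g !Cmod_mult Cmod_conj Cmod_echar Rmult_1_r.
have -> : fst (G t) = B / 2 * (Cmod (X t) ^ 2 + Cmod (Y t) ^ 2).
  by rewrite -!fst_mult_conj /G /=; ring.
have H0 := HB t; have := Cmod_ge_0 (X t); have := Cmod_ge_0 (Y t); have := Cmod_ge_0 (f t).
move: (Cmod (f t)) (Cmod (X t)) (Cmod (Y t)) H0 => a b c H0 Ha Hc Hb.
have Hbc : a * b * c <= B * (b * c) by rewrite Rmult_assoc; apply: Rmult_le_compat_r => //; nra.
have := pow2_ge_0 (b - c); nra.
Qed.

(** Integrating h against the conjugate of its own partial sum P gives the sum of squares; |h P| <=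
    (B^2 + |P|^2) / 2 and Parseval for P then absorb half of it. The bound on h is asked on [0, 1],
    where continuity provides it without periodicity. *)
Lemma bessel (h : R -> C) (B : R) (s : nat -> Z) (m : nat) :
  ccont h -> (forall t, 0 <= t <= 1 -> Cmod (h t) <= B) ->
  (forall k l, s k = s l -> k = l) ->
  sum_n (fun j => Cmod (fourier h (s j)) ^ 2) m <= B ^ 2.
Proof.
move=> Hh HB Hs.
pose P := tpoly m s (fun j => fourier h (s j)).
have HP : ccont P by apply: ccont_tpoly.
have HPP : ccont (fun t => Cmult (P t) (Cconj (P t))) by apply: ccont_mult => //; apply: ccont_conj.
pose G := fun t => Cmult (RtoC (1 / 2)) (Cplus (RtoC (B ^ 2)) (Cmult (P t) (Cconj (P t)))).
have HG : ccont G.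
  by apply: ccont_mult; [apply: ccont_const | apply: ccont_plus => //; apply: ccont_const].
have E : cint (fun t => Cmult (h t) (Cconj (P t))) =
   RtoC (sum_n (fun j => Cmod (fourier h (s j)) ^ 2) m).
  rewrite (cint_mult_conj_tpoly _ _ _ _ Hh) -csum_RtoC; apply: csum_ext => l.
  by rewrite Cmod2_conj; ring.
have HD : ccont (fun t => Cmult (h t) (Cconj (P t))) by apply: ccont_mult => //; apply: ccont_conj.
have D : Cmod (cint (fun t => Cmult (h t) (Cconj (P t)))) <= fst (cint G).
  rewrite Cmod_norm.
  apply: (norm_RInt_le (V := C_R_NormedModule) _ (fun t => fst (G t)) 0 1 _ _ _ _
    (ccont_is_RInt _ HD) (is_RInt_fct_extend_fst _ _ _ _ (ccont_is_RInt _ HG))); first lra.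
  move=> t Ht.
  have : Cmod (Cmult (h t) (Cconj (P t))) <= fst (G t); last by rewrite Cmod_norm.
  rewrite Cmod_mult Cmod_conj.
  have -> : fst (G t) = 1 / 2 * (B ^ 2 + Cmod (P t) ^ 2).
    by rewrite -fst_mult_conj /G /=; ring.
  have := HB t Ht; have := Cmod_ge_0 (h t); have := Cmod_ge_0 (P t).
  move: (Cmod (h t)) (Cmod (P t)) => a b Hb Ha HaB.
  have : a * b <= B * b by apply: Rmult_le_compat_r.
  have := pow2_ge_0 (B - b); nra.
move: D; rewrite E Cmod_R Rabs_pos_eq; last by apply: sum_n_nonneg => k; apply: pow2_ge_0.
rewrite /G cint_scal; last by apply: ccont_plus => //; apply: ccont_const.
rewrite cint_plus //; last exact: ccont_const.
rewrite cint_const /P tpoly_parseval //= => D; lra.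
Qed.

Lemma riemann_lebesgue (h : R -> C) (s : nat -> Z) : ccont h ->
  (forall k l, s k = s l -> k = l) ->
  is_lim_seq (fun j => Cmod (fourier h (s j))) 0.
Proof.
move=> Hh Hs.
have [B HB] := bounded_continuity (V := C_R_NormedModule) h 0 1 (fun x _ => Hh x).
have HB' : forall t, 0 <= t <= 1 -> Cmod (h t) <= B.
  by move=> t Ht; rewrite Cmod_norm; apply: Rlt_le; apply: HB.
have Ex : ex_series (fun j => Cmod (fourier h (s j)) ^ 2).
  apply: (bounded_ex_series _ (B ^ 2)) => n; first exact: pow2_ge_0.
  exact: bessel.
have L := ex_series_lim_0 _ Ex.
apply: (is_lim_seq_ext (fun j => sqrt (Cmod (fourier h (s j)) ^ 2))).
  by move=> n; apply: sqrt_pow2; apply: Cmod_ge_0.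
rewrite -sqrt_0; apply: (is_lim_seq_continuous sqrt _ 0) => //.
apply: continuity_pt_sqrt; lra.
Qed.

(** * Fourier inversion *)

(** Caratheodory's form of the derivative: the factorisation is exact everywhere, so a quotient of
    two functions vanishing at the same point becomes a quotient of slopes. *)
Lemma caratheodory_slope (f : R -> R) (x l : R) : is_derive f x l ->
  exists phi : R -> R, continuous phi x /\ phi x = l /\
    forall t, f t - f x = phi t * (t - x).
Proof.
move=> /is_derive_Reals D.
exists (fun t => if Req_EM_T t x then l else (f t - f x) / (t - x)); split; last split.
- case: (Req_EM_T x x) => [_|//] P.
  rewrite /filtermap /=; case: (Req_EM_T x x) => // _ [eps HP].
  have [d Hd] := D eps (cond_pos eps).
  exists d => t Ht; apply: HP; case: (Req_EM_T t x) => [_|Hne]; first exact: ball_center.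
  have Ht' : Rabs (t - x) < d by exact: Ht.
  have := Hd (t - x) ltac:(lra) Ht'.
  by have -> : x + (t - x) = t by ring.
- by case: (Req_EM_T x x).
- move=> t; case: (Req_EM_T t x) => [->|Hne]; first by rewrite !Rminus_diag Rmult_0_r.
  by field; lra.
Qed.

Lemma sin_eq_0_shift (t x : R) :
  sin (PI * (t - x)) = 0 -> exists k : Z, t = x + IZR k.
Proof.
move=> /sin_eq_0_0 [k Hk]; exists k.
have P := PI_RGT_0.
have : PI * (t - x - IZR k) = 0 by lra.
by move=> /Rmult_integral [|]; lra.
Qed.

(** Since e_1(t) e_(-1)(x) - 1 = 2 i sin(theta) exp(i theta) with theta = pi (t - x), dividing by
    this function amounts to dividing by a real sine, which acts on real and imaginary parts
    separately. At the zeros of the sine the value is the one given by l'Hospital's rule. *)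
Definition sine_quotient (u : R -> R) (x t : R) : R :=
  if Req_EM_T (sin (PI * (t - x))) 0 then Derive u t / (PI * cos (PI * (t - x)))
  else (u t - u x) / sin (PI * (t - x)).

Lemma sine_quotient_mult (u : R -> R) (x t : R) : (forall y (k : Z), u (y + IZR k) = u y) ->
  sine_quotient u x t * sin (PI * (t - x)) = u t - u x.
Proof.
move=> Pu; rewrite /sine_quotient; case: Req_EM_T => [E|E]; last by field.
rewrite E; have [k ->] := sin_eq_0_shift _ _ E; rewrite Pu; lra.
Qed.

Lemma sine_quotient_continuous (u : R -> R) (x t : R) :
  (forall y (k : Z), u (y + IZR k) = u y) -> (forall y, ex_derive u y) ->
  continuous (sine_quotient u x) t.
Proof.
move=> Pu Du; have P := PI_RGT_0.
have Cs : continuous (fun t => sin (PI * (t - x))) t.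
  by apply: (ex_derive_continuous (V := R_NormedModule)); auto_derive.
case: (Req_EM_T (sin (PI * (t - x))) 0) => E.
- have Ec : cos (PI * (t - x)) <> 0.
    by move=> Ec; have := sin2_cos2 (PI * (t - x)); rewrite E Ec /Rsqr; lra.
  (* At a zero of the sine, [u t = u x], so with the slopes phi of u and psi of the sine the
     quotient equals phi / psi near t, the point t included. *)
  have [phi [Cphi [phit Hphi]]] := caratheodory_slope u t _ (Derive_correct _ _ (Du t)).
  have Ds : is_derive (fun t => sin (PI * (t - x))) t (PI * cos (PI * (t - x))).
    by auto_derive=> //; rewrite /Rminus; ring.
  have [psi [Cpsi [psit Hpsi]]] := caratheodory_slope _ _ _ Ds.
  have Hb : psi t <> 0 by rewrite psit; apply: Rmult_integral_contrapositive; split; lra.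
  have Ut : u t = u x by have [k ->] := sin_eq_0_shift _ _ E; apply: Pu.
  have L : locally t (fun r => psi r <> 0).
    exact: (Cpsi _ (open_neq 0 (psi t) Hb)).
  apply: (continuous_ext_loc _ (fun r => phi r / psi r)).
    refine (filter_imp _ _ _ L) => r Hr; rewrite /sine_quotient.
    have H1 := Hphi r; have H2 := Hpsi r; rewrite E Rminus_0_r in H2.
    case: (Req_EM_T r t) => [->|Hne].
      by case: Req_EM_T => // _; rewrite phit psit.
    case: Req_EM_T => E'.
      by rewrite E' in H2; have [|] := Rmult_integral _ _ (eq_sym H2); lra.
    rewrite H2 -Ut H1; eq_in R; field; split; lra.
  apply: (continuous_mult (K := R_AbsRing)) => //.
  exact: continuous_Rinv_comp.
- have L : locally t (fun r => sin (PI * (r - x)) <> 0).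
    exact: (Cs _ (open_neq 0 _ E)).
  apply: (continuous_ext_loc _ (fun r => (u r - u x) / sin (PI * (r - x)))).
    refine (filter_imp _ _ _ L) => r Hr.
    by rewrite /sine_quotient; case: Req_EM_T.
  apply: (continuous_mult (K := R_AbsRing)); last exact: continuous_Rinv_comp.
  apply: (continuous_minus (V := R_NormedModule)); last exact: continuous_const.
  exact: (ex_derive_continuous (V := R_NormedModule)).
Qed.

(* Dividing [g - g x] by [e_1 e_{-1}(x) - 1] makes the Fourier terms of [g]
   at [x] telescope. *)
Lemma telescoping_quotient (g : R -> C) (x : R) : smooth_torus g ->
  exists h : R -> C, ccont h /\ forall n : Z,
    Cmult (echar n x) (fourier g n) =
    Cplus (Cminus (Cmult (echar (n - 1) x) (fourier h (n - 1)))
                  (Cmult (echar n x) (fourier h n)))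
          (if Z.eqb n 0 then g x else RtoC 0).
Proof.
move=> Hg; have Cg := smooth_ccont _ Hg; have Dg := smooth_cdiff _ Hg.
have Pg : forall y k, g (y + IZR k) = g y by move=> y k; apply: periodic_Z; case: Hg.
pose u1 := fun t => fst (g t); pose u2 := fun t => snd (g t).
have P1 : forall y k, u1 (y + IZR k) = u1 y by move=> y k; rewrite /u1 Pg.
have P2 : forall y k, u2 (y + IZR k) = u2 y by move=> y k; rewrite /u2 Pg.
have D1 : forall y, ex_derive u1 y by move=> y; eexists; exact: (proj1 (Dg y)).
have D2 : forall y, ex_derive u2 y by move=> y; eexists; exact: (proj2 (Dg y)).
pose q : R -> C := fun t => (sine_quotient u1 x t, sine_quotient u2 x t).
have Cq : ccont q by apply: ccont_components => t; apply: sine_quotient_continuous.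
(* With theta = pi (t - x), w = exp(-i theta) / (2 i), and 1 / (exp(2 i theta) - 1) = w /
   sin(theta). *)
pose w : R -> C := fun t => (- sin (PI * (t - x)) / 2, - cos (PI * (t - x)) / 2).
have Cw : ccont w.
  by apply: ccont_components => t; apply: (ex_derive_continuous (V := R_NormedModule)); rewrite /w /=; auto_derive.
pose h := fun t => Cmult (q t) (w t).
have Ch : ccont h by apply: ccont_mult.
exists h; split=> // n.
have key : forall t, g t = Cplus (Cplus (Cmult (echar (- 1) x) (Cmult (h t) (echar 1 t)))
   (Cmult (RtoC (-1)) (h t))) (g x).
  move=> t.
  have Hw : Cplus (Cmult (echar (- 1) x) (Cmult (w t) (echar 1 t))) (Cmult (RtoC (-1)) (w t)) =
            RtoC (sin (PI * (t - x))).
    have -> : Cmult (echar (- 1) x) (Cmult (w t) (echar 1 t)) =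
              Cmult (w t) (cos (2 * (PI * (t - x))), sin (2 * (PI * (t - x)))).
      have -> : Cmult (echar (- 1) x) (Cmult (w t) (echar 1 t)) =
                Cmult (w t) (Cmult (echar (- 1) x) (echar 1 t)) by ring.
      congr Cmult; rewrite /echar /Cmult /=.
      have -> : 2 * (PI * (t - x)) = 2 * PI * -1 * x + 2 * PI * 1 * t by ring.
      by rewrite cos_plus sin_plus; congr pair; ring.
    rewrite cos_2a_sin sin_2a /w /Cmult /Cplus /RtoC /=.
    have := sin2_cos2 (PI * (t - x)); rewrite /Rsqr.
    move: (sin _) (cos _) => a b E; congr pair; last by field.
    have -> : - a / 2 * (1 - 2 * a * a) - - b / 2 * (2 * a * b) + (-1 * (- a / 2) - 0 * (- b / 2)) =
              a * (a * a + b * b) by field.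
    by rewrite E; ring.
  have Hq : Cmult (q t) (RtoC (sin (PI * (t - x)))) = Cminus (g t) (g x).
    rewrite /Cmult /Cminus /Cplus /Copp /=.
    have := sine_quotient_mult u1 x t P1; have := sine_quotient_mult u2 x t P2.
    rewrite /u1 /u2 => E2 E1; congr pair.
    + by rewrite Rmult_0_r Rminus_0_r E1.
    + by rewrite Rmult_0_r Rplus_0_l E2.
  have -> : g t = Cplus (Cmult (q t) (RtoC (sin (PI * (t - x))))) (g x) by rewrite Hq; ring.
  by rewrite -Hw /h; ring.
have Ch1 : ccont (fun t => Cmult (h t) (echar 1 t)) by apply: ccont_fourier_integrand.
have Ch2 : ccont (fun t => Cmult (echar (- 1) x) (Cmult (h t) (echar 1 t))).
  by apply: ccont_mult => //; apply: ccont_const.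
have Ch3 : ccont (fun t => Cmult (RtoC (-1)) (h t)) by apply: ccont_mult => //; apply: ccont_const.
have -> : fourier g n = Cplus (Cplus (Cmult (echar (- 1) x) (fourier h (n - 1)))
   (Cmult (RtoC (-1)) (fourier h n))) (if Z.eqb n 0 then g x else RtoC 0).
  have E : g = fun t => Cplus (Cplus (Cmult (echar (- 1) x) (Cmult (h t) (echar 1 t)))
   (Cmult (RtoC (-1)) (h t))) (g x) by apply: funext.
  rewrite {1}E fourier_plus; [|exact: ccont_plus|exact: ccont_const].
  by rewrite fourier_plus // !fourier_scal // fourier_echar fourier_const.
have E1 : echar (n - 1) x = Cmult (echar n x) (echar (- 1) x) by rewrite -echar_plus.
rewrite E1; case: Z.eqb_spec => [->|_]; rewrite ?echar_0; ring.
Qed.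

(* The frequencies [j - l] and [- j - 1 - l], for [j] in [nat], exhaust the integers. *)
Definition inversion_term (g : R -> C) (l : nat) (x : R) (j : nat) : C :=
  Cplus (Cmult (fourier g (Z.of_nat j - Z.of_nat l)) (echar (Z.of_nat j - Z.of_nat l) x))
        (Cmult (fourier g (- Z.of_nat (S j) - Z.of_nat l)) (echar (- Z.of_nat (S j) - Z.of_nat l) x)).

(** The convolution giving the coefficient k - l of f g, with the frequencies of g listed as in
    [inversion_term]. The first summand is a term of the matrix product T(f) T(g); the second, from
    negative intermediate indices, is missing there and makes up the semicommutator. *)
Definition convolution_term (f g : R -> C) (k l j : nat) : C :=
  Cplus (Cmult (fourier f (Z.of_nat k - Z.of_nat j)) (fourier g (Z.of_nat j - Z.of_nat l)))
        (Cmult (fourier f (Z.of_nat k + Z.of_nat (S j))) (fourier g (- Z.of_nat (S j) - Z.of_nat l))).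

Lemma fourier_inversion (g : R -> C) (l : nat) (x : R) : smooth_torus g ->
  climit (sum_n (inversion_term g l x))
    (g x).
Proof.
move=> Hg; have [h [Ch Hh]] := telescoping_quotient g x Hg.
pose a := fun n => Cmult (echar n x) (fourier h n).
have Ca : forall n, Cmod (a n) = Cmod (fourier h n).
  by move=> n; rewrite Cmod_mult Cmod_echar Rmult_1_l.
(* The sums upward from -l and downward from -1 - l share the end a(-l - 1), which cancels, so only
   the two outer ends remain. The value g x appears once the frequency 0, reached at j = l, has been
   summed. *)
have T : forall J, sum_n (inversion_term g l x) J =
   Cplus (if Nat.leb l J then g x else RtoC 0)
     (Cminus (a (- Z.of_nat (S (S J)) - Z.of_nat l)%Z) (a (Z.of_nat J - Z.of_nat l)%Z)).
  have step : forall n, Cmult (fourier g n) (echar n x) =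
     Cplus (Cminus (a (n - 1)%Z) (a n)) (if Z.eqb n 0 then g x else RtoC 0).
    by move=> n; rewrite Cmult_comm Hh.
  have neg : forall j, Cmult (fourier g (- Z.of_nat (S j) - Z.of_nat l)) (echar (- Z.of_nat (S j) - Z.of_nat l) x) =
     Cminus (a (- Z.of_nat (S (S j)) - Z.of_nat l)%Z) (a (- Z.of_nat (S j) - Z.of_nat l)%Z).
    move=> j; rewrite step; case: Z.eqb_spec => [E|_]; first lia.
    have -> : (- Z.of_nat (S j) - Z.of_nat l - 1 = - Z.of_nat (S (S j)) - Z.of_nat l)%Z by lia.
    by ring.
  elim=> [|J IH].
  - rewrite sum_O /inversion_term neg step.
    have -> : (Z.of_nat 0 - Z.of_nat l - 1 = - Z.of_nat 1 - Z.of_nat l)%Z by lia.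
    case: Z.eqb_spec => [E|E]; case: (Nat.leb_spec l 0) => E'; try lia; eq_in C; ring.
  - rewrite sum_Sn IH /inversion_term neg step -[plus _ _]/(Cplus _ _).
    have -> : (Z.of_nat (S J) - Z.of_nat l - 1 = Z.of_nat J - Z.of_nat l)%Z by lia.
    case: Z.eqb_spec => [E|E]; case: (Nat.leb_spec l J) => E';
      case: (Nat.leb_spec l (S J)) => E''; try lia; eq_in C; ring.
have I1 : forall k j, (Z.of_nat k - Z.of_nat l = Z.of_nat j - Z.of_nat l)%Z -> k = j by move=> *; lia.
have I2 : forall k j, (- Z.of_nat (S (S k)) - Z.of_nat l = - Z.of_nat (S (S j)) - Z.of_nat l)%Z -> k = j by move=> *; lia.
have L1 := riemann_lebesgue h _ Ch I1.
have L2 := riemann_lebesgue h _ Ch I2.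
have L := is_lim_seq_plus' _ _ _ _ L2 L1; rewrite Rplus_0_l in L.
apply: (is_lim_seq_ext_loc (fun J => norm (minus (Cplus (g x)
     (Cminus (a (- Z.of_nat (S (S J)) - Z.of_nat l)%Z) (a (Z.of_nat J - Z.of_nat l)%Z))) (g x) : C_NormedModule))).
  exists l => J HJ; rewrite T.
  by case: Nat.leb_spec => // ?; lia.
apply: is_lim_seq_0_le L => J; split; first exact: norm_ge_0.
have -> : minus (Cplus (g x)
     (Cminus (a (- Z.of_nat (S (S J)) - Z.of_nat l)%Z) (a (Z.of_nat J - Z.of_nat l)%Z))) (g x) =
   (Cplus (a (- Z.of_nat (S (S J)) - Z.of_nat l)%Z) (Copp (a (Z.of_nat J - Z.of_nat l)%Z))).
  by rewrite -[minus _ _]/(Cminus _ _); eq_in C; ring.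
rewrite -[norm _]/(Cmod _) -!Ca -(Cmod_opp (a (Z.of_nat J - Z.of_nat l)%Z)).
exact: Cmod_triangle.
Qed.

Lemma fourier_injective (f g : R -> C) : smooth_torus f -> smooth_torus g ->
  (forall n, fourier f n = fourier g n) -> f = g.
Proof.
move=> Hf Hg E; apply: funext => x.
apply: (nlim_unique (V := C_NormedModule) _ _ _ (fourier_inversion f 0 x Hf)).
apply: nlim_ext (fourier_inversion g 0 x Hg) => J.
by apply: sum_n_ext => j; rewrite /inversion_term !E.
Qed.

(** The hypothesis gives 1 + j <= (1 + l) (1 + |n|), which turns decay in the frequency into
    summable decay in the summation index. The case l = 0 serves for the series defining T(f). *)
Lemma fourier_decay_sq (g : R -> C) (l j : nat) (n : Z) : smooth_torus g ->
  (Z.of_nat j <= Z.of_nat l + Z.abs n)%Z ->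
  Cmod (fourier g n) <= Clnorm 2 g * (1 + INR l) ^ 2 * / (1 + INR j) ^ 2.
Proof.
move=> Hg Hj.
have Hl := pos_INR l; have Pj := pos_INR j.
have H1 : 1 + INR j <= (1 + INR l) * (1 + Rabs (IZR n)).
  have : INR j <= INR l + Rabs (IZR n).
    by rewrite -abs_IZR !INR_IZR_INZ -plus_IZR; apply: IZR_le.
  have := Rabs_pos (IZR n); nra.
have H2 : (1 + INR j) ^ 2 <= (1 + INR l) ^ 2 * (1 + Rabs (IZR n)) ^ 2.
  by rewrite -Rpow_mult_distr; apply: pow_incr; lra.
have Hp : 0 < (1 + INR j) ^ 2 by apply: pow_lt; lra.
apply/(Rle_div_r _ _ _ Hp).
have D := fourier_decay g 2 n Hg; have C0 := Cmod_ge_0 (fourier g n).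
have Hl2 : 0 < (1 + INR l) ^ 2 by apply: pow_lt; lra.
apply: Rle_trans (Rmult_le_compat_l _ _ _ C0 H2) _.
have := Rmult_le_compat_l _ _ _ (Rlt_le _ _ Hl2) D; lra.
Qed.

(** The inversion series of g is dominated by a summable sequence independent of t, so it converges
    uniformly and can be multiplied by f and integrated term by term. *)
Lemma fourier_convolution (f g : R -> C) (k l : nat) : smooth_torus f -> smooth_torus g ->
  climit (sum_n (convolution_term f g k l))
    (fourier (fun t => Cmult (f t) (g t)) (Z.of_nat k - Z.of_nat l)).
Proof.
move=> Hf Hg.
pose G := fun j t => inversion_term g l t j.
have Cf := smooth_ccont _ Hf; have Cg := smooth_ccont _ Hg.
have Ce : forall a n, ccont (fun t => Cmult a (echar n t)).
  by move=> a n; apply: ccont_mult; [apply: ccont_const | apply: ccont_echar].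
have CG : forall j, ccont (G j) by move=> j; apply: ccont_plus; apply: Ce.
pose B := Clnorm 2 g * (1 + INR l) ^ 2.
have HB : 0 <= B.
  by apply: Rmult_le_pos; [apply: Clnorm_ge0 | apply: pow2_ge_0].
pose b := fun j : nat => 2 * B * / (1 + INR j) ^ 2.
have Hb : forall j t, Cmod (G j t) <= b j.
  move=> j t; apply: Rle_trans (Cmod_triangle _ _) _.
  rewrite !Cmod_mult !Cmod_echar !Rmult_1_r /b.
  have := fourier_decay_sq g l j (Z.of_nat j - Z.of_nat l) Hg ltac:(lia).
  have := fourier_decay_sq g l j (- Z.of_nat (S j) - Z.of_nat l) Hg ltac:(lia).
  rewrite -/B; lra.
have b0 : forall j, 0 <= b j by move=> j; apply: Rle_trans (Hb j 0); apply: Cmod_ge_0.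
have sb : forall J, sum_n b J <= 2 * B * 2.
  move=> J; rewrite /b (sum_n_mult_l (K := R_Ring) (2 * B)) /mult /=.
  by apply: Rmult_le_compat_l; [lra | exact: sum_inv_sq].
have Exb := bounded_ex_series _ _ b0 sb.
pose r := fun J => Series b - sum_n b J.
have Lr : is_lim_seq r 0.
  have := is_lim_seq_minus' _ _ _ _ (is_lim_seq_const (Series b)) (Series_correct _ Exb).
  by rewrite Rminus_diag.
have tail : forall t J, Cmod (Cminus (g t) (sum_n (fun j => G j t) J)) <= r J.
  move=> t J; have L := fourier_inversion g l t Hg.
  have L' := nlim_plus (V := C_NormedModule) _ _ _ _ L (nlim_const (Copp (sum_n (fun j => G j t) J))).
  have := nlim_norm _ _ L' => L''.
  apply: (is_lim_seq_le_loc _ (fun _ => r J) (Cmod _) (r J) _ L'' (is_lim_seq_const (r J))).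
  exists J => J' HJ.
  have D : forall d, Cmod (Cplus (sum_n (fun j => G j t) (J + d)%nat) (Copp (sum_n (fun j => G j t) J)))
     <= sum_n b (J + d)%nat - sum_n b J.
    elim=> [|d IH].
      by rewrite Nat.add_0_r Cplus_opp_r Cmod_0; lra.
    rewrite Nat.add_succ_r !sum_Sn -[plus _ (b _)]/(_ + _) -[plus _ _]/(Cplus _ _).
    have -> : Cplus (Cplus (sum_n (fun j => G j t) (J + d)%nat) (G (S (J + d)) t)) (Copp (sum_n (fun j => G j t) J)) =
      Cplus (Cplus (sum_n (fun j => G j t) (J + d)%nat) (Copp (sum_n (fun j => G j t) J))) (G (S (J + d)) t) by ring.
    have := Cmod_triangle (Cplus (sum_n (fun j => G j t) (J + d)%nat) (Copp (sum_n (fun j => G j t) J))) (G (S (J + d)) t).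
    have := Hb (S (J + d)) t; lra.
  have := D (J' - J)%nat; have -> : (J + (J' - J) = J')%nat by lia.
  move=> H; apply: Rle_trans H _.
  have : sum_n b J' <= Series b.
    by apply: (is_lim_seq_incr_compare _ _ (Series_correct _ Exb)) => n; rewrite sum_Sn /plus /=; have := b0 (S n); lra.
  rewrite /r; lra.
pose M := supnorm f.
have LM : is_lim_seq (fun J => M * r J) 0.
  by rewrite -(Rmult_0_r M); apply: (is_lim_seq_scal_l r M 0).
apply: nlim_le LM => J.
pose D := fun t => Cplus (Cmult (f t) (g t)) (Cmult (RtoC (-1)) (sum_n (fun j => Cmult (f t) (G j t)) J)).
have Cfg : ccont (fun t => Cmult (f t) (g t)) by apply: ccont_mult.
have CfG : forall j, ccont (fun t => Cmult (f t) (G j t)) by move=> j; apply: ccont_mult.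
have CS : ccont (fun t => sum_n (fun j => Cmult (f t) (G j t)) J).
  exact: (ccont_sum (fun j t => Cmult (f t) (G j t))).
have CS' : ccont (fun t => Cmult (RtoC (-1)) (sum_n (fun j => Cmult (f t) (G j t)) J)).
  by apply: ccont_mult => //; apply: ccont_const.
have E : minus (sum_n (convolution_term f g k l) J)
    (fourier (fun t => Cmult (f t) (g t)) (Z.of_nat k - Z.of_nat l)) =
    Copp (fourier D (Z.of_nat k - Z.of_nat l)).
  rewrite /D fourier_plus // fourier_scal // (fourier_sum (fun j t => Cmult (f t) (G j t))) //.
  rewrite -[minus _ _]/(Cminus _ _).
  rewrite (csum_ext (fun j => fourier (fun t => Cmult (f t) (G j t)) (Z.of_nat k - Z.of_nat l)) (convolution_term f g k l)).
    by rewrite RtoC_m1; eq_in C; ring.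
  move=> j.
  have -> : (fun t => Cmult (f t) (G j t)) = (fun t => Cplus
     (Cmult (fourier g (Z.of_nat j - Z.of_nat l)) (Cmult (f t) (echar (Z.of_nat j - Z.of_nat l) t)))
     (Cmult (fourier g (- Z.of_nat (S j) - Z.of_nat l)) (Cmult (f t) (echar (- Z.of_nat (S j) - Z.of_nat l) t)))).
    by apply: funext => t; rewrite /G /inversion_term; ring.
  have Cfe : forall n, ccont (fun t => Cmult (f t) (echar n t)) by move=> n; apply: ccont_fourier_integrand.
  rewrite fourier_plus; try by apply: ccont_mult => //; apply: ccont_const.
  rewrite !fourier_scal // !fourier_echar.
  have -> : (Z.of_nat k - Z.of_nat l - (Z.of_nat j - Z.of_nat l) = Z.of_nat k - Z.of_nat j)%Z by ring.
  have -> : (Z.of_nat k - Z.of_nat l - (- Z.of_nat (S j) - Z.of_nat l) = Z.of_nat k + Z.of_nat (S j))%Z by ring.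
  by rewrite /convolution_term; ring.
rewrite E -[norm _]/(Cmod _) Cmod_opp; apply: fourier_bound; first exact: ccont_plus.
move=> t.
have -> : D t = Cmult (f t) (Cminus (g t) (sum_n (fun j => G j t) J)).
  by rewrite /D csum_scal RtoC_m1; ring.
rewrite Cmod_mult; apply: Rmult_le_compat; try exact: Cmod_ge_0; last exact: tail.
exact: supnorm_ub.
Qed.

(** * Completeness of the space of smooth functions *)

Definition fsub (f g : R -> C) : R -> C := fun t => Cplus (f t) (Cmult (RtoC (-1)) (g t)).

Lemma smooth_fsub (f g : R -> C) : smooth_torus f -> smooth_torus g -> smooth_torus (fsub f g).
Proof. by move=> Hf Hg; apply: smooth_plus => //; apply: smooth_scal. Qed.

Lemma fsubE (f g : R -> C) (t : R) : fsub f g t = Cminus (f t) (g t).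
Proof. by rewrite /fsub RtoC_m1; ring. Qed.

Lemma Dtorus_fsub (f g : R -> C) : smooth_torus f -> smooth_torus g ->
  Dtorus (fsub f g) = fsub (Dtorus f) (Dtorus g).
Proof.
move=> /smooth_cdiff Hf /smooth_cdiff Hg.
by rewrite Dtorus_plus ?Dtorus_scal //; apply: cdiff_mult => //; apply: cdiff_const.
Qed.

Lemma iter_Dtorus_fsub (k : nat) (f g : R -> C) : smooth_torus f -> smooth_torus g ->
  Nat.iter k Dtorus (fsub f g) = fsub (Nat.iter k Dtorus f) (Nat.iter k Dtorus g).
Proof.
move=> Hf Hg; elim: k => [|k IH] //=.
by rewrite IH Dtorus_fsub //; apply: smooth_iter_Dtorus.
Qed.

Lemma Clnorm_le_pow (l : nat) (f : R -> C) (e : R) :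
  (forall k, (k <= l)%nat -> supnorm (Nat.iter k Dtorus f) <= e) ->
  Clnorm l f <= 2 ^ l * e.
Proof.
elim: l f => [|l IH] f H.
  by rewrite Clnorm_0 /= Rmult_1_l; apply: (H 0%nat).
rewrite Clnorm_succ /=.
have := IH f ltac:(by move=> k Hk; apply: H; lia).
have := IH (Dtorus f) ltac:(by move=> k Hk; rewrite -Nat.iter_succ_r; apply: H; lia).
lra.
Qed.

Definition unif_cauchy (u : nat -> R -> R) : Prop :=
  forall eps : posreal, exists N : nat, forall n m x, (N <= n)%nat -> (N <= m)%nat ->
    Rabs (u n x - u m x) < eps.

Definition seq_limit (u : nat -> R -> R) (x : R) : R := real (Lim_seq (fun n => u n x)).

Lemma unif_cauchy_CVU (u : nat -> R -> R) : unif_cauchy u -> CVU_dom u (fun _ => True).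
Proof.
move=> H; apply/CVU_dom_cauchy => eps; have [N HN] := H eps.
by exists N => n m x _ Hn Hm; apply: HN.
Qed.

Lemma unif_cauchy_scal (c : R) (u : nat -> R -> R) :
  unif_cauchy u -> unif_cauchy (fun n x => c * u n x).
Proof.
move=> H eps; have Pc := Rabs_pos c.
have Hc : 0 < eps / (Rabs c + 1).
  by apply: Rdiv_lt_0_compat; [apply: cond_pos | lra].
have [N HN] := H (mkposreal _ Hc); exists N => n m x Hn Hm.
have := HN n m x Hn Hm => /= {HN} /(Rmult_lt_compat_l (Rabs c + 1) _ _ ltac:(lra)) HN.
rewrite -Rmult_minus_distr_l Rabs_mult; have Hp := Rabs_pos (u n x - u m x).
have E : (Rabs c + 1) * (eps / (Rabs c + 1)) = eps by field; lra.
nra.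
Qed.

(** The factor c is meant to be 2 pi or -2 pi: a component of f' is, up to this factor, the other
    component of D f. *)
Lemma unif_cauchy_derive (u v : nat -> R -> R) (c : R) :
  (forall n x, is_derive (u n) x (c * v n x)) -> (forall n x, continuous (v n) x) ->
  unif_cauchy u -> unif_cauchy v ->
  forall x, is_derive (seq_limit u) x (c * seq_limit v x).
Proof.
move=> Du Cv Hu Hv x.
have E : (fun n y => Derive (u n) y) = (fun n y => c * v n y).
  apply: funext => n; apply: funext => y.
  exact: is_derive_unique.
have Hcv := unif_cauchy_CVU _ (unif_cauchy_scal c v Hv).
have conn : is_connected (fun _ : R => True) by [].
have := CVU_Derive u (fun _ => True) open_true conn (unif_cauchy_CVU u Hu)
  (fun n y _ => ex_intro _ _ (Du n y)).
rewrite E => /(_ _ Hcv x I).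
have -> : (fun n => Derive (u n) x) = (fun n => c * v n x).
  by apply: funext => n; apply: is_derive_unique.
have [l Hl] : ex_finite_lim_seq (fun n => v n x).
  apply/ex_lim_seq_cauchy_corr => eps; have [N HN] := Hv eps.
  by exists N => n m Hn Hm; apply: HN.
rewrite /seq_limit (is_lim_seq_unique _ _ Hl)
  (is_lim_seq_unique _ _ (is_lim_seq_scal_l _ c _ Hl)) /=.
apply=> n y _; apply/continuity_pt_filterlim.
apply: (continuous_ext (fun y => c * v n y)).
  by move=> z; rewrite (is_derive_unique _ _ _ (Du n z)).
exact: (continuous_scal_r (V := R_NormedModule) c).
Qed.

(** Each iterated derivative converges uniformly to some [L k], and [L (S k)] is the derivative of
    [L k]; so the whole family consists of the derivatives of [L 0], which is therefore smooth. *)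
Lemma smooth_complete (f : nat -> R -> C) : (forall n, smooth_torus (f n)) ->
  (forall l (eps : posreal), exists N : nat, forall n m, (N <= n)%nat -> (N <= m)%nat ->
     Clnorm l (fsub (f n) (f m)) < eps) ->
  exists F, smooth_torus F /\ forall l (eps : posreal), exists N : nat, forall n, (N <= n)%nat ->
     Clnorm l (fsub (f n) F) < eps.
Proof.
move=> Hf HC.
pose d k n := Nat.iter k Dtorus (f n).
have Hd : forall k n, smooth_torus (d k n) by move=> k n; apply: smooth_iter_Dtorus.
have Cd : forall k (eps : posreal), exists N : nat, forall n m x, (N <= n)%nat -> (N <= m)%nat ->
    Cmod (Cminus (d k n x) (d k m x)) < eps.
  move=> k eps; have [N HN] := HC k eps; exists N => n m x Hn Hm.
  rewrite -fsubE -iter_Dtorus_fsub //; apply: Rle_lt_trans (HN n m Hn Hm).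
  have Hs := smooth_fsub _ _ (Hf n) (Hf m).
  apply: Rle_trans (supnorm_ub _ x (smooth_iter_Dtorus k _ Hs)) _.
  exact: supnorm_iter_Dtorus_le.
have fst_le : forall z : C, Rabs (fst z) <= Cmod z.
  by move=> z; apply: Rle_trans (Rmax_Cmod z); apply: Rmax_l.
have snd_le : forall z : C, Rabs (snd z) <= Cmod z.
  by move=> z; apply: Rle_trans (Rmax_Cmod z); apply: Rmax_r.
have U1 : forall k, unif_cauchy (fun n x => fst (d k n x)).
  move=> k eps; have [N HN] := Cd k eps; exists N => n m x Hn Hm.
  exact: Rle_lt_trans (fst_le (Cminus (d k n x) (d k m x))) (HN n m x Hn Hm).
have U2 : forall k, unif_cauchy (fun n x => snd (d k n x)).
  move=> k eps; have [N HN] := Cd k eps; exists N => n m x Hn Hm.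
  exact: Rle_lt_trans (snd_le (Cminus (d k n x) (d k m x))) (HN n m x Hn Hm).
pose L k x : C := (seq_limit (fun n x => fst (d k n x)) x, seq_limit (fun n x => snd (d k n x)) x).
have DL : forall k x, has_D (L k) x (L (S k) x).
  move=> k x; split.
  - apply: (unif_cauchy_derive (fun n x => fst (d k n x)) (fun n x => snd (d (S k) n x))) => // n y.
    + exact: (proj1 (smooth_cdiff _ (Hd k n) y)).
    + exact: (ccont_snd _ (smooth_ccont _ (Hd (S k) n))).
  - apply: (unif_cauchy_derive (fun n x => snd (d k n x)) (fun n x => fst (d (S k) n x))) => // n y.
    + exact: (proj2 (smooth_cdiff _ (Hd k n) y)).
    + exact: (ccont_fst _ (smooth_ccont _ (Hd (S k) n))).
have IL : forall k, Nat.iter k Dtorus (L 0%nat) = L k.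
  elim=> [|k IH] //=; rewrite IH; apply: funext => x.
  exact: has_D_Dtorus.
have SL : smooth_torus (L 0%nat).
  split.
  - by move=> x; rewrite /L /seq_limit; congr (real (Lim_seq _), real (Lim_seq _));
      apply: funext => n; rewrite (proj1 (Hd 0%nat n)).
  - move=> n; apply/ex_derive_cdiff => x; rewrite IL (has_D_Dtorus _ _ _ (DL n x)).
    exact: DL.
have CL : forall k (eps : posreal), exists N : nat, forall n, (N <= n)%nat -> forall x,
    Cmod (Cminus (d k n x) (L k x)) <= eps.
  move=> k eps.
  have He : 0 < eps / 2 by have := cond_pos eps; lra.
  have [N1 HN1] := unif_cauchy_CVU _ (U1 k) (mkposreal _ He).
  have [N2 HN2] := unif_cauchy_CVU _ (U2 k) (mkposreal _ He).
  exists (max N1 N2) => n Hn x.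
  have := HN1 n ltac:(lia) x I; have := HN2 n ltac:(lia) x I => /= H2 H1.
  have -> : Cminus (d k n x) (L k x) =
     Cplus (RtoC (fst (d k n x) - fst (L k x))) (Cmult Ci (RtoC (snd (d k n x) - snd (L k x)))).
    by rewrite /Cminus /Cplus /Copp /Cmult /Ci /RtoC /=; congr pair; ring.
  apply: Rle_trans (Cmod_triangle _ _) _.
  rewrite Cmod_mult Cmod_Ci !Cmod_R /L /seq_limit /=; lra.
exists (L 0%nat); split=> // l eps.
have Hp : 0 < 2 ^ l by apply: pow_lt; lra.
(* [Clnorm_le_pow] costs 2^l, and halving eps makes the final inequality strict. *)
have He : 0 < eps / 2 / 2 ^ l by apply: Rdiv_lt_0_compat => //; have := cond_pos eps; lra.
have all : forall l', exists N : nat, forall n, (N <= n)%nat -> forall k, (k <= l')%nat -> forall x,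
    Cmod (Cminus (d k n x) (L k x)) <= eps / 2 / 2 ^ l.
  elim=> [|l' [N IH]].
    have [N HN] := CL 0%nat (mkposreal _ He); exists N => n Hn k Hk x.
    by have -> : k = 0%nat by [lia]; apply: HN.
  have [N' HN'] := CL (S l') (mkposreal _ He); exists (max N N') => n Hn k Hk x.
  have [->|Hk'] := Nat.eq_dec k (S l'); first by apply: HN'; lia.
  by apply: IH; lia.
have [N HN] := all l; exists N => n Hn.
apply: Rle_lt_trans (_ : 2 ^ l * (eps / 2 / 2 ^ l) < eps).
  apply: Clnorm_le_pow => k Hk; rewrite iter_Dtorus_fsub // IL.
  by apply: supnorm_le => x; rewrite fsubE; apply: HN.
have -> : 2 ^ l * (eps / 2 / 2 ^ l) = eps / 2 by field; lra.
have := cond_pos eps; lra.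
Qed.

(** * Hilbert space *)

Section HilbertSpace.

Context {H : CompleteNormedModule C_AbsRing} (ip : H -> H -> C) (E : nat -> H)
  (Hip : is_inner_product ip) (HE : is_orthonormal_basis ip E).

Local Notation Toep := (toeplitz ip E).
Local Notation KInf := (Kinf ip E).
Local Notation KNorm := (Knorm ip E).
Local Notation TInf := (Tinf ip E).
Local Notation TNorm := (Tnorm ip E).
Local Notation DeltaK := (deltaK ip E).
Local Notation Norm0 := (norm0 ip E).

Lemma ip_plus_right (x y z : H) : ip x (plus y z) = Cplus (ip x y) (ip x z).
Proof. exact: (ip_plus_r _ Hip). Qed.

Lemma ip_scal_right (x : H) (a : C) (y : H) : ip x (scal a y) = Cmult a (ip x y).
Proof. exact: (ip_scal_r _ Hip). Qed.

Lemma ip_sym (x y : H) : ip y x = Cconj (ip x y).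
Proof. exact: (ip_conj _ Hip). Qed.

Lemma ip_plus_left (x y z : H) : ip (plus x y) z = Cplus (ip x z) (ip y z).
Proof. by rewrite ip_sym ip_plus_right Cplus_conj -!ip_sym. Qed.

Lemma ip_scal_left (a : C) (x y : H) : ip (scal a x) y = Cmult (Cconj a) (ip x y).
Proof. by rewrite ip_sym ip_scal_right Cmult_conj -ip_sym. Qed.

Lemma scal_m1 (x : H) : scal (RtoC (-1)) x = opp x.
Proof.
rewrite -(scal_opp_one (V := H) x); congr (scal _ x).
by rewrite RtoC_m1.
Qed.

Lemma scal_0 (x : H) : scal (RtoC 0) x = zero.
Proof. exact: (scal_zero_l (V := H) x). Qed.

Lemma ip_zero_right (x : H) : ip x zero = RtoC 0.
Proof. by rewrite -(scal_0 x) ip_scal_right Cmult_0_l. Qed.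

Lemma ip_minus_right (x y z : H) : ip x (minus y z) = Cminus (ip x y) (ip x z).
Proof. by rewrite /minus -scal_m1 ip_plus_right ip_scal_right RtoC_m1; ring. Qed.

Lemma ip_minus_left (x y z : H) : ip (minus x y) z = Cminus (ip x z) (ip y z).
Proof.
rewrite /minus -scal_m1 ip_plus_left ip_scal_left RtoC_m1 Copp_conj.
by have -> : Cconj (RtoC 1) = RtoC 1 by [rewrite /Cconj /= Ropp_0]; ring.
Qed.

Lemma ip_sum_right (x : H) (u : nat -> H) (n : nat) :
  ip x (sum_n u n) = sum_n (fun k => ip x (u k)) n.
Proof.
elim: n => [|n IH]; first by rewrite !sum_O.
by rewrite !sum_Sn ip_plus_right IH.
Qed.

Lemma ip_self (x : H) : ip x x = RtoC (norm x ^ 2).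
Proof. exact: (ip_norm _ Hip). Qed.

(** The axioms of a normed module only give an inequality; equality comes from the inner product. *)
Lemma hnorm_scal (a : C) (x : H) : norm (scal a x) = Cmod a * norm x.
Proof.
have E2 : norm (scal a x) ^ 2 = (Cmod a * norm x) ^ 2.
  apply: RtoC_inj; rewrite -ip_self ip_scal_left ip_scal_right ip_self.
  rewrite Rpow_mult_distr RtoC_mult Cmod2_conj; ring.
apply: Rsqr_inj; first exact: norm_ge_0.
  by apply: Rmult_le_pos; [apply: Cmod_ge_0 | apply: norm_ge_0].
by rewrite !Rsqr_pow2.
Qed.

Lemma cauchy_schwarz (x y : H) : Cmod (ip x y) <= norm x * norm y.
Proof.
have [N0|N0] := Req_dec (norm x) 0.
  have -> : ip x y = RtoC 0.
    rewrite (norm_eq_zero _ N0) -(scal_0 x) ip_scal_left.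
    have -> : Cconj (RtoC 0) = RtoC 0 by rewrite /Cconj /= Ropp_0.
    by rewrite Cmult_0_l.
  by rewrite N0 Cmod_0; lra.
have Px : 0 < norm x by have := norm_ge_0 x; lra.
pose r := ip x y.
(* The component of y orthogonal to x, with denominators cleared; its squared norm is |x|^2 times
   the difference to be shown nonnegative. *)
pose w := minus (scal (RtoC (norm x ^ 2)) y) (scal r x).
have Ew : RtoC (norm w ^ 2) = RtoC (norm x ^ 2 * (norm x ^ 2 * norm y ^ 2 - Cmod r ^ 2)).
  rewrite -ip_self /w ip_minus_right !ip_minus_left !ip_scal_right !ip_scal_left !ip_self.
  rewrite (ip_sym x y) -/r.
  have -> : Cconj (RtoC (norm x ^ 2)) = RtoC (norm x ^ 2) by rewrite /Cconj /= Ropp_0.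
  by rewrite RtoC_mult RtoC_minus RtoC_mult Cmod2_conj; ring.
move: Ew => /RtoC_inj Ew.
have P := pow2_ge_0 (norm w); rewrite Ew in P.
have Px2 : 0 < norm x ^ 2 by apply: pow_lt.
have D : 0 <= norm x ^ 2 * norm y ^ 2 - Cmod r ^ 2.
  by apply: (Rmult_le_reg_l (norm x ^ 2)) => //; rewrite Rmult_0_r.
apply: Rsqr_incr_0_var.
  by rewrite !Rsqr_pow2 Rpow_mult_distr -/r; lra.
by apply: Rmult_le_pos; apply: norm_ge_0.
Qed.

Lemma hnorm_minus_comm (x y : H) : norm (minus x y) = norm (minus y x).
Proof. by rewrite -opp_minus norm_opp. Qed.

Lemma nlim_ip (u v : nat -> H) (x y : H) : nlim u x -> nlim v y ->
  climit (fun n => ip (u n) (v n)) (ip x y).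
Proof.
move=> Hu Hv.
have L1 := is_lim_seq_mult' _ _ _ _ (nlim_norm _ _ Hu) Hv.
have L2 := is_lim_seq_scal_r _ (norm y) 0 Hu.
have L := is_lim_seq_plus' _ _ _ _ L1 L2.
rewrite !(Rmult_0_r, Rmult_0_l, Rplus_0_r) in L.
apply: nlim_le L => n.
rewrite -[minus _ _]/(Cminus _ _) -[norm _]/(Cmod _).
have -> : Cminus (ip (u n) (v n)) (ip x y) =
          Cplus (ip (u n) (minus (v n) y)) (ip (minus (u n) x) y).
  by rewrite ip_minus_right ip_minus_left; ring.
apply: Rle_trans (Cmod_triangle _ _) _.
by apply: Rplus_le_compat; apply: cauchy_schwarz.
Qed.

Lemma hsum_eq (u : nat -> H) (s : H) : nlim (fun n => sum_n u n) s -> hsum u = s.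
Proof.
move=> L; apply: iota_unique; last exact/nlim_filterlim.
move=> y Hy; apply: nlim_unique L; exact/nlim_filterlim.
Qed.

Lemma abs_summable (u : nat -> H) (b : nat -> R) (M : R) :
  (forall n, norm (u n) <= b n) -> (forall n, sum_n b n <= M) ->
  nlim (fun n => sum_n u n) (hsum u) /\ norm (hsum u) <= M.
Proof.
move=> Hb HM.
have b0 : forall n, 0 <= b n by move=> n; apply: Rle_trans (Hb n); apply: norm_ge_0.
have [s Hs] := ex_series_le u b Hb (bounded_ex_series b M b0 HM).
have L : nlim (fun n => sum_n u n) s by apply/nlim_filterlim.
rewrite (hsum_eq _ _ L); split=> //.
apply: (nlim_norm_le _ _ _ L) => n.
by apply: Rle_trans (HM n); apply: sum_n_norm_le.
Qed.

Lemma ip_E (k l : nat) : ip (E k) (E l) = if Nat.eqb k l then RtoC 1 else RtoC 0.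
Proof.
by case: Nat.eqb_spec => [->|Hn]; [apply: (onb_norm _ _ HE) | apply: (onb_orth _ _ HE)].
Qed.

Lemma norm_E (k : nat) : norm (E k) = 1.
Proof.
have E2 : norm (E k) ^ 2 = 1 by apply: RtoC_inj; rewrite -ip_self ip_E Nat.eqb_refl.
have := norm_ge_0 (E k); nra.
Qed.

Lemma basis_expansion (x : H) : nlim (fun n => sum_n (fun k => scal (ip (E k) x) (E k)) n) x.
Proof. by apply/nlim_filterlim; apply: (onb_expand _ _ HE). Qed.

Lemma coef_ext (x y : H) : (forall k, ip (E k) x = ip (E k) y) -> x = y.
Proof.
move=> Exy; apply: nlim_unique (basis_expansion x) _.
apply: nlim_ext (basis_expansion y) => n; apply: sum_n_ext => k.
by rewrite Exy.
Qed.

Lemma coef_le (k : nat) (x : H) : Cmod (ip (E k) x) <= norm x.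
Proof. by have := cauchy_schwarz (E k) x; rewrite norm_E Rmult_1_l. Qed.

Lemma pythagoras (x y : H) : ip x y = RtoC 0 -> norm (plus x y) ^ 2 = norm x ^ 2 + norm y ^ 2.
Proof.
move=> E0; apply: RtoC_inj; rewrite -ip_self ip_plus_right !ip_plus_left !ip_self.
rewrite (ip_sym x y) E0 RtoC_plus.
by have -> : Cconj (RtoC 0) = RtoC 0 by [rewrite /Cconj /= Ropp_0]; ring.
Qed.

(** Blocks from n to m serve the Cauchy criterion in [orthogonal_contraction]; the vectors are not
    normalised because one of them may be 0, as for the adjoint of the shift. *)
Lemma norm_sq_orthogonal_sum (v : nat -> H) (x : nat -> C) (n m : nat) :
  (forall k l, k <> l -> ip (v k) (v l) = RtoC 0) ->
  norm (sum_n_m (fun k => scal (x k) (v k)) n m) ^ 2 =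
  sum_n_m (fun k => Cmod (x k) ^ 2 * norm (v k) ^ 2) n m.
Proof.
move=> Ho; have [Hnm|Hnm] := le_lt_dec n m; last first.
  by rewrite !sum_n_m_zero //= norm_zero /zero /=; ring.
have nz : norm (zero : H) ^ 2 = 0 by rewrite norm_zero; ring.
elim: m Hnm => [|m IH] Hnm.
  have -> : n = 0%nat by lia.
  by rewrite !sum_n_n hnorm_scal Rpow_mult_distr.
have [Hn|Hn] := Nat.eq_dec n (S m).
  by rewrite Hn !sum_n_n hnorm_scal Rpow_mult_distr.
rewrite !sum_n_Sm // pythagoras.
  by rewrite IH ?hnorm_scal ?Rpow_mult_distr //; lia.
rewrite ip_scal_right; have -> : ip (sum_n_m (fun k => scal (x k) (v k)) n m) (v (S m)) = RtoC 0.
  rewrite ip_sym.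
  have G : forall j, (j <= m)%nat -> ip (v (S m)) (sum_n_m (fun k => scal (x k) (v k)) n j) = RtoC 0.
    elim=> [|j IHj] Hj.
      case: n {IH Hnm Hn} => [|n]; first by rewrite sum_n_n ip_scal_right Ho ?Cmult_0_r.
      by rewrite sum_n_m_zero ?ip_zero_right //; lia.
    have [Hnj|Hnj] := le_lt_dec n (S j); last by rewrite sum_n_m_zero ?ip_zero_right.
    by rewrite sum_n_Sm // ip_plus_right IHj ?ip_scal_right ?Ho; try lia; rewrite Cmult_0_r Cplus_0_r.
  by rewrite G // /Cconj /= Ropp_0.
by rewrite Cmult_0_r.
Qed.

Lemma norm_sq_partial_sum (x : nat -> C) (n : nat) :
  norm (sum_n (fun k => scal (x k) (E k)) n) ^ 2 = sum_n (fun k => Cmod (x k) ^ 2) n.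
Proof.
rewrite /sum_n norm_sq_orthogonal_sum; last by move=> k l Hkl; apply: (onb_orth _ _ HE).
by apply: sum_n_m_ext => k; rewrite norm_E pow1 Rmult_1_r.
Qed.

(** * Bounded operators and their matrices *)

Record bounded_op (a : Op H) : Prop := {
  bl_plus : forall x y, a (plus x y) = plus (a x) (a y);
  bl_scal : forall (k : C) x, a (scal k x) = scal k (a x);
  bl_bound : exists B, 0 <= B /\ forall x, norm (a x) <= B * norm x }.

Lemma op_plusE (a b : Op H) (x : H) : (plus a b : Op H) x = plus (a x) (b x).
Proof. by []. Qed.

Lemma op_scalE (k : C) (a : Op H) (x : H) : (scal k a : Op H) x = scal k (a x).
Proof. by []. Qed.

Lemma op_zeroE (x : H) : (zero : Op H) x = zero.
Proof. by []. Qed.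

Lemma bl_zero (a : Op H) : bounded_op a -> a zero = zero.
Proof. by move=> Ha; rewrite -(scal_0 zero) (bl_scal _ Ha) !scal_0. Qed.

Lemma bl_opp (a : Op H) (x : H) : bounded_op a -> a (opp x) = opp (a x).
Proof. by move=> Ha; rewrite -!scal_m1 (bl_scal _ Ha). Qed.

Lemma bl_sum (a : Op H) (u : nat -> H) (n : nat) : bounded_op a ->
  a (sum_n u n) = sum_n (fun k => a (u k)) n.
Proof.
move=> Ha; elim: n => [|n IH]; first by rewrite !sum_O.
by rewrite !sum_Sn (bl_plus _ Ha) IH.
Qed.

Lemma bl_nlim (a : Op H) (u : nat -> H) (x : H) : bounded_op a ->
  nlim u x -> nlim (fun n => a (u n)) (a x).
Proof.
move=> Ha L; have [B [B0 HB]] := bl_bound _ Ha.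
have L' := is_lim_seq_scal_l _ B 0 L.
have E0 : Rbar_mult B 0 = 0 by rewrite /= Rmult_0_r.
rewrite E0 in L'; apply: nlim_le L' => n.
by rewrite /minus -(bl_opp _ _ Ha) -(bl_plus _ Ha); apply: HB.
Qed.

Lemma bl_expansion (a : Op H) (x : H) : bounded_op a ->
  nlim (fun n => sum_n (fun l => scal (ip (E l) x) (a (E l))) n) (a x).
Proof.
move=> Ha; apply: nlim_ext (bl_nlim _ _ _ Ha (basis_expansion x)) => n.
by rewrite bl_sum //; apply: sum_n_ext => k; rewrite (bl_scal _ Ha).
Qed.

Lemma bl_ext (a b : Op H) : bounded_op a -> bounded_op b ->
  (forall l, a (E l) = b (E l)) -> a = b.
Proof.
move=> Ha Hb Eab; apply: funext => x.
apply: nlim_unique (bl_expansion a x Ha) _.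
apply: nlim_ext (bl_expansion b x Hb) => n; apply: sum_n_ext => k.
by rewrite Eab.
Qed.

(** [dense_ext] reads only the columns of a, so a recipe involving the unbounded K is identified as
    soon as a bounded operator with these columns is known. *)
Lemma dense_ext_eq (a b : Op H) : bounded_op b ->
  (forall l, b (E l) = a (E l)) -> dense_ext ip E a = b.
Proof.
move=> Hb Eab; apply: funext => x; apply: hsum_eq.
apply: nlim_ext (bl_expansion b x Hb) => n; apply: sum_n_ext => k.
by rewrite Eab.
Qed.

Definition mat (a : Op H) (k l : nat) : C := ip (E k) (a (E l)).

Lemma mat_ext (a b : Op H) : bounded_op a -> bounded_op b ->
  (forall k l, mat a k l = mat b k l) -> a = b.
Proof. by move=> Ha Hb Eab; apply: bl_ext => // l; apply: coef_ext => k; apply: Eab. Qed.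

Lemma bounded_op_plus (a b : Op H) : bounded_op a -> bounded_op b ->
  bounded_op (plus a b).
Proof.
move=> Ha Hb; split.
- move=> x y; rewrite !op_plusE (bl_plus _ Ha) (bl_plus _ Hb).
  rewrite -!plus_assoc; congr plus; rewrite !plus_assoc; congr plus; exact: plus_comm.
- by move=> k x; rewrite !op_plusE (bl_scal _ Ha) (bl_scal _ Hb) scal_distr_l.
- have [[A [A0 HA]] [B [B0 HB]]] := (bl_bound _ Ha, bl_bound _ Hb).
  exists (A + B); split; first lra.
  move=> x; rewrite Rmult_plus_distr_r.
  by apply: Rle_trans (norm_triangle _ _) _; apply: Rplus_le_compat.
Qed.

Lemma bounded_op_scal (k : C) (a : Op H) : bounded_op a ->
  bounded_op (scal k a).
Proof.
move=> Ha; split.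
- by move=> x y; rewrite !op_scalE (bl_plus _ Ha) scal_distr_l.
- move=> c x; rewrite !op_scalE (bl_scal _ Ha) !scal_assoc.
  by rewrite -[mult k c]/(Cmult k c) Cmult_comm.
- have [A [A0 HA]] := bl_bound _ Ha.
  exists (Cmod k * A); split; first by apply: Rmult_le_pos => //; apply: Cmod_ge_0.
  move=> x; rewrite op_scalE hnorm_scal Rmult_assoc.
  by apply: Rmult_le_compat_l; [apply: Cmod_ge_0 | apply: HA].
Qed.

Lemma bounded_op_zero : bounded_op zero.
Proof.
split; first by move=> x y; rewrite !op_zeroE plus_zero_l.
- by move=> k x; rewrite !op_zeroE scal_zero_r.
- by exists 0; split; [lra | move=> x; rewrite !op_zeroE norm_zero; lra].
Qed.

Lemma bounded_op_comp (a b : Op H) : bounded_op a -> bounded_op b ->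
  bounded_op (op_comp a b).
Proof.
move=> Ha Hb; split.
- by move=> x y; rewrite /op_comp (bl_plus _ Hb) (bl_plus _ Ha).
- by move=> k x; rewrite /op_comp (bl_scal _ Hb) (bl_scal _ Ha).
- have [[A [A0 HA]] [B [B0 HB]]] := (bl_bound _ Ha, bl_bound _ Hb).
  exists (A * B); split; first exact: Rmult_le_pos.
  move=> x; rewrite /op_comp; apply: Rle_trans (HA _) _; rewrite Rmult_assoc.
  by apply: Rmult_le_compat_l.
Qed.

Lemma bounded_op_sum (a : nat -> Op H) (n : nat) :
  (forall k, bounded_op (a k)) -> bounded_op (sum_n a n).
Proof.
move=> Ha; elim: n => [|n IH]; first by rewrite sum_O.
by rewrite sum_Sn; apply: bounded_op_plus.
Qed.

Lemma op_sum_apply (a : nat -> Op H) (n : nat) (x : H) :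
  sum_n a n x = sum_n (fun k => a k x) n.
Proof. by elim: n => [|n IH]; rewrite ?sum_O // !sum_Sn -IH. Qed.

Lemma mat_plus (a b : Op H) (k l : nat) : mat (plus a b) k l = Cplus (mat a k l) (mat b k l).
Proof. exact: ip_plus_right. Qed.

Lemma mat_scal (c : C) (a : Op H) (k l : nat) : mat (scal c a) k l = Cmult c (mat a k l).
Proof. exact: ip_scal_right. Qed.

Lemma mat_sum (a : nat -> Op H) (n k l : nat) :
  mat (sum_n a n) k l = sum_n (fun j => mat (a j) k l) n.
Proof. by rewrite /mat op_sum_apply ip_sum_right. Qed.

Lemma mat_zero (k l : nat) : mat zero k l = RtoC 0.
Proof. exact: ip_zero_right. Qed.

Lemma mat_comp (a b : Op H) (k l : nat) : bounded_op a ->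
  climit (fun n => sum_n (fun j => Cmult (mat a k j) (mat b j l)) n)
    (mat (op_comp a b) k l).
Proof.
move=> Ha; have L := nlim_ip _ _ _ _ (nlim_const (E k)) (bl_expansion a (b (E l)) Ha).
apply: nlim_ext L => n; rewrite ip_sum_right; apply: csum_ext => j.
by rewrite ip_scal_right Cmult_comm.
Qed.

Lemma op_norm_spec (a : Op H) (B : R) :
  0 <= B -> (forall x, norm (a x) <= B * norm x) ->
  (forall x, norm x <= 1 -> norm (a x) <= op_norm a) /\ op_norm a <= B.
Proof.
move=> B0 HB.
have HB1 : forall r, (exists x, norm x <= 1 /\ r = norm (a x)) -> r <= B.
  move=> r [x [Hx ->]]; apply: Rle_trans (HB x) _.
  by rewrite -{2}(Rmult_1_r B); apply: Rmult_le_compat_l.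
have n0 : norm (zero : H) <= 1 by rewrite norm_zero; lra.
have [H1 H2] := lub_finite (fun r => exists x : H, norm x <= 1 /\ r = norm (a x)) (norm (a zero)) B
  (ex_intro _ zero (conj n0 eq_refl)) HB1.
by split=> // x Hx; apply: H1; exists x.
Qed.

Lemma op_norm_le (a : Op H) (B : R) :
  0 <= B -> (forall x, norm (a x) <= B * norm x) -> op_norm a <= B.
Proof. by move=> B0 HB; apply: (proj2 (op_norm_spec a B B0 HB)). Qed.

Lemma op_norm_ge0 (a : Op H) : bounded_op a -> 0 <= op_norm a.
Proof.
move=> Ha; have [B [B0 HB]] := bl_bound _ Ha.
apply: Rle_trans (proj1 (op_norm_spec a B B0 HB) zero _); first exact: norm_ge_0.
by rewrite norm_zero; lra.
Qed.

Lemma op_norm_ub (a : Op H) (x : H) : bounded_op a -> norm (a x) <= op_norm a * norm x.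
Proof.
move=> Ha; have [B [B0 HB]] := bl_bound _ Ha.
have [N0|N0] := Req_dec (norm x) 0.
  by rewrite (norm_eq_zero _ N0) bl_zero // norm_zero; lra.
have Px : 0 < norm x by have := norm_ge_0 x; lra.
have Hi : Cmod (RtoC (/ norm x)) = / norm x.
  by rewrite Cmod_R Rabs_pos_eq //; apply: Rlt_le; apply: Rinv_0_lt_compat.
have := proj1 (op_norm_spec a B B0 HB) (scal (RtoC (/ norm x)) x).
rewrite (bl_scal _ Ha) !hnorm_scal Hi => H1.
have {}H1 := H1 ltac:(right; field; lra).
have -> : norm (a x) = / norm x * norm (a x) * norm x by field; lra.
by apply: Rmult_le_compat_r => //; lra.
Qed.

Lemma op_norm_plus (a b : Op H) : bounded_op a -> bounded_op b ->
  op_norm (plus a b) <= op_norm a + op_norm b.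
Proof.
move=> Ha Hb; apply: op_norm_le.
  by have := op_norm_ge0 _ Ha; have := op_norm_ge0 _ Hb; lra.
move=> x; apply: Rle_trans (norm_triangle _ _) _; rewrite Rmult_plus_distr_r.
by apply: Rplus_le_compat; apply: op_norm_ub.
Qed.

Lemma op_norm_scal (k : C) (a : Op H) : bounded_op a ->
  op_norm (scal k a) = Cmod k * op_norm a.
Proof.
move=> Ha; have P := Cmod_ge_0 k; have Q := op_norm_ge0 _ Ha.
apply: Rle_antisym.
- apply: op_norm_le; first exact: Rmult_le_pos.
  move=> x; rewrite op_scalE hnorm_scal Rmult_assoc.
  by apply: Rmult_le_compat_l => //; apply: op_norm_ub.
- have Hk := bounded_op_scal k _ Ha.
  have [->|K0] := Req_dec (Cmod k) 0; first by rewrite Rmult_0_l; apply: op_norm_ge0.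
  have Pk : 0 < Cmod k by lra.
  rewrite Rmult_comm; apply/(Rle_div_r _ _ _ Pk); apply: op_norm_le.
    by apply: Rdiv_le_0_compat => //; apply: op_norm_ge0.
  move=> x; have := op_norm_ub _ x Hk.
  rewrite op_scalE hnorm_scal => H1.
  have -> : op_norm (scal k a) / Cmod k * norm x = (op_norm (scal k a) * norm x) / Cmod k by field.
  by apply/(Rle_div_r _ _ _ Pk); rewrite Rmult_comm.
Qed.

Lemma op_norm_comp (a b : Op H) : bounded_op a -> bounded_op b ->
  op_norm (op_comp a b) <= op_norm a * op_norm b.
Proof.
move=> Ha Hb; apply: op_norm_le; first by apply: Rmult_le_pos; apply: op_norm_ge0.
move=> x; apply: Rle_trans (op_norm_ub _ _ Ha) _; rewrite Rmult_assoc.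
by apply: Rmult_le_compat_l; [apply: op_norm_ge0 | apply: op_norm_ub].
Qed.

Lemma Cmod_mat_le (a : Op H) (k l : nat) : bounded_op a -> Cmod (mat a k l) <= op_norm a.
Proof.
move=> Ha; apply: Rle_trans (coef_le _ _) _.
by have := op_norm_ub _ (E l) Ha; rewrite norm_E Rmult_1_r.
Qed.

(* By density [|<y, a x>| <= B (|x|^2 + |y|^2) / 2] for all [x], [y]; this is used
   for the [y] proportional to [a x] with [|y| = |x|]. *)
Lemma norm_le_of_form (a : Op H) (B : R) : bounded_op a -> 0 <= B ->
  (forall m (x y : nat -> C),
    Cmod (sum_n (fun k => sum_n (fun l => Cmult (Cconj (y k)) (Cmult (mat a k l) (x l))) m) m) <=
    B * ((sum_n (fun k => Cmod (x k) ^ 2) m + sum_n (fun k => Cmod (y k) ^ 2) m) / 2)) ->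
  op_norm a <= B.
Proof.
move=> Ha B0 HB; apply: op_norm_le => // x.
have bil : forall y, Cmod (ip y (a x)) <= B * ((norm x ^ 2 + norm y ^ 2) / 2).
  move=> y.
  pose X n := sum_n (fun k => scal (ip (E k) x) (E k)) n.
  pose Y n := sum_n (fun k => scal (ip (E k) y) (E k)) n.
  have LX : nlim X x := basis_expansion x; have LY : nlim Y y := basis_expansion y.
  have L1 := nlim_norm _ _ (nlim_ip _ _ _ _ LY (bl_nlim _ _ _ Ha LX)).
  have sq : forall (u : nat -> H) (z : H), nlim u z -> is_lim_seq (fun n => norm (u n) ^ 2) (norm z ^ 2).
    move=> u z Huz; have L := nlim_norm _ _ Huz.
    apply: (is_lim_seq_ext (fun n => norm (u n) * norm (u n))).
      by move=> n; ring.
    have -> : norm z ^ 2 = norm z * norm z by ring.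
    exact: is_lim_seq_mult'.
  have L2 := is_lim_seq_scal_l _ (B / 2) _ (is_lim_seq_plus' _ _ _ _ (sq _ _ LX) (sq _ _ LY)).
  have -> : B * ((norm x ^ 2 + norm y ^ 2) / 2) = B / 2 * (norm x ^ 2 + norm y ^ 2) by field.
  apply: (is_lim_seq_le _ _ (Cmod (ip y (a x))) (B / 2 * (norm x ^ 2 + norm y ^ 2)) _ L1 L2) => n.
  have := HB n (fun k => ip (E k) x) (fun k => ip (E k) y).
  rewrite -!norm_sq_partial_sum -/(X n) -/(Y n).
  have -> : sum_n (fun k => sum_n (fun l =>
      Cmult (Cconj (ip (E k) y)) (Cmult (mat a k l) (ip (E l) x))) n) n = ip (Y n) (a (X n)).
    rewrite ip_sym /Y ip_sum_right csum_conj; apply: csum_ext => k.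
    rewrite ip_scal_right Cmult_conj csum_scal; congr Cmult.
    rewrite -ip_sym /X bl_sum // ip_sum_right; apply: csum_ext => l.
    by rewrite (bl_scal _ Ha) ip_scal_right Cmult_comm.
  by move=> H1; apply: Rle_trans H1 _; right; field.
have [N0|N0] := Req_dec (norm (a x)) 0.
  by rewrite N0; apply: Rmult_le_pos => //; apply: norm_ge_0.
have Pa : 0 < norm (a x) by have := norm_ge_0 (a x); lra.
have [X0|X0] := Req_dec (norm x) 0.
  by case: N0; rewrite (norm_eq_zero _ X0) bl_zero // norm_zero.
have Px : 0 < norm x by have := norm_ge_0 x; lra.
have Ps : 0 < norm x / norm (a x) by apply: Rdiv_lt_0_compat.
have := bil (scal (RtoC (norm x / norm (a x))) (a x)).
rewrite hnorm_scal ip_scal_left Cmod_mult ip_self Cmod_conj !Cmod_R.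
rewrite (Rabs_pos_eq (norm x / _)); last lra.
rewrite (Rabs_pos_eq (norm (a x) ^ 2)); last exact: pow2_ge_0.
have -> : norm x / norm (a x) * norm (a x) ^ 2 = norm x * norm (a x) by field; lra.
have -> : norm x / norm (a x) * norm (a x) = norm x by field; lra.
have -> : B * ((norm x ^ 2 + norm x ^ 2) / 2) = norm x * (B * norm x) by field.
exact: Rmult_le_reg_l.
Qed.

(** * Operators with rapidly decaying matrices *)

Lemma sum_inv_sq_scal (c : R) (n : nat) : 0 <= c -> sum_n (fun j => c * / (1 + INR j) ^ 2) n <= c * 2.
Proof.
move=> Hc; rewrite (sum_n_mult_l (K := R_Ring) c) /mult /=.
by apply: Rmult_le_compat_l => //; exact: sum_inv_sq.
Qed.

Lemma weight_ge0 (M N k l : nat) : 0 <= (1 + INR k) ^ M * (1 + INR l) ^ N.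
Proof.
by apply: Rmult_le_pos; apply: pow_le; have := pos_INR k; have := pos_INR l; lra.
Qed.

Lemma bounded_op_rank_one (l : nat) (v : H) : bounded_op (fun x => scal (ip (E l) x) v).
Proof.
split.
- by move=> x y; rewrite ip_plus_right (scal_distr_r (V := H)).
- by move=> c x; rewrite ip_scal_right (scal_assoc (V := H)).
- exists (norm v); split; first exact: norm_ge_0.
  move=> x; rewrite hnorm_scal Rmult_comm.
  by apply: Rmult_le_compat_l; [apply: norm_ge_0 | apply: coef_le].
Qed.

Lemma bounded_op_limit (u : nat -> Op H) (a : Op H) (B : R) : 0 <= B ->
  (forall n, bounded_op (u n)) -> (forall x, nlim (fun n => u n x) (a x)) ->
  (forall x, norm (a x) <= B * norm x) -> bounded_op a.
Proof.
move=> B0 Hu La HB; split; last by exists B.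
- move=> x y; apply: nlim_unique (La (plus x y)) _.
  by apply: nlim_ext (nlim_plus _ _ _ _ (La x) (La y)) => n; rewrite (bl_plus _ (Hu n)).
- move=> c x; apply: nlim_unique (La (scal c x)) _.
  by apply: nlim_ext (nlim_scal c _ _ (La x)) => n; rewrite (bl_scal _ (Hu n)).
Qed.

Lemma operator_of_columns (v : nat -> H) (a : Op H) (B : R) : 0 <= B ->
  (forall x, nlim (fun n => sum_n (fun l => scal (ip (E l) x) (v l)) n) (a x)) ->
  (forall x, norm (a x) <= B * norm x) -> bounded_op a /\ forall k, a (E k) = v k.
Proof.
move=> B0 La HB; split.
  pose t l : Op H := fun x => scal (ip (E l) x) (v l).
  apply: (bounded_op_limit (fun n => sum_n t n) a B) => //.
    by move=> n; apply: bounded_op_sum => l; apply: bounded_op_rank_one.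
  by move=> x; apply: nlim_ext (La x) => n; rewrite op_sum_apply.
move=> k; apply: nlim_unique (La (E k)) _.
apply: (nlim_eventually_const _ _ k) => n Hn; rewrite (sum_n_single _ _ k Hn).
  by rewrite ip_E Nat.eqb_refl; apply: (scal_one (V := H)).
by move=> j _ Hj; rewrite ip_E; case: Nat.eqb_spec => [?|_]; [congruence | rewrite scal_0].
Qed.

(** Two orders of decay in k make each column summable, two in l make the series of columns
    summable. Each summation of (1 + j)^(-2) costs a factor 2, hence 4. *)
Lemma matrix_operator (m : nat -> nat -> C) (B : R) :
  (forall k l, (1 + INR k) ^ 2 * (1 + INR l) ^ 2 * Cmod (m k l) <= B) ->
  exists a : Op H, bounded_op a /\ (forall k l, mat a k l = m k l) /\ op_norm a <= 4 * B.
Proof.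
move=> HB.
have pos : forall k : nat, 0 < (1 + INR k) ^ 2.
  by move=> k; apply: pow_lt; have := pos_INR k; lra.
have B0 : 0 <= B.
  apply: Rle_trans (HB 0%nat 0%nat).
  apply: Rmult_le_pos; last exact: Cmod_ge_0.
  by apply: Rmult_le_pos; apply: Rlt_le.
have Hm : forall k l, Cmod (m k l) <= (B * / (1 + INR l) ^ 2) * / (1 + INR k) ^ 2.
  move=> k l; have := HB k l; have Pk := pos k; have Pl := pos l => Hkl.
  apply/(Rle_div_r _ _ _ Pk); apply/(Rle_div_r _ _ _ Pl); lra.
pose v l := hsum (fun k => scal (m k l) (E k)).
have Bl : forall l, 0 <= B * / (1 + INR l) ^ 2.
  by move=> l; apply: Rmult_le_pos => //; apply: Rlt_le; apply: Rinv_0_lt_compat.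
have Hv : forall l, nlim (fun n => sum_n (fun k => scal (m k l) (E k)) n) (v l) /\
    norm (v l) <= B * / (1 + INR l) ^ 2 * 2.
  move=> l; apply: (abs_summable _ (fun k => (B * / (1 + INR l) ^ 2) * / (1 + INR k) ^ 2)) => n.
    by rewrite hnorm_scal norm_E Rmult_1_r.
  exact: sum_inv_sq_scal.
pose a : Op H := fun x => hsum (fun l => scal (ip (E l) x) (v l)).
have Ha : forall x, nlim (fun n => sum_n (fun l => scal (ip (E l) x) (v l)) n) (a x) /\
    norm (a x) <= (norm x * (B * 2)) * 2.
  move=> x; apply: (abs_summable _ (fun l => (norm x * (B * 2)) * / (1 + INR l) ^ 2)) => n.
    rewrite hnorm_scal.
    have := Rmult_le_compat _ _ _ _ (Cmod_ge_0 _) (norm_ge_0 _) (coef_le n x) (proj2 (Hv n)).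
    lra.
  apply: sum_inv_sq_scal; apply: Rmult_le_pos; [exact: norm_ge_0 | lra].
have [La Ea] := operator_of_columns v a (4 * B) ltac:(lra) (fun x => proj1 (Ha x))
  ltac:(by move=> x; have := proj2 (Ha x); lra).
exists a; split=> //; split; last first.
  apply: op_norm_le; first lra.
  by move=> x; have := proj2 (Ha x); lra.
move=> k l.
rewrite /mat Ea; apply: nlim_unique (nlim_ip _ _ _ _ (nlim_const (E k)) (proj1 (Hv l))) _.
apply: (nlim_eventually_const _ _ k) => n Hn; rewrite ip_sum_right (sum_n_single _ _ k Hn).
  by rewrite ip_scal_right ip_E Nat.eqb_refl Cmult_1_r.
move=> j _ Hj; rewrite ip_scal_right ip_E; case: Nat.eqb_spec => [?|_]; first congruence.
exact: Cmult_0_r.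
Qed.

Lemma op_norm_le_mat (a : Op H) (B : R) : bounded_op a ->
  (forall k l, (1 + INR k) ^ 2 * (1 + INR l) ^ 2 * Cmod (mat a k l) <= B) ->
  op_norm a <= 4 * B.
Proof.
move=> Ha HB; have [b [Hb [Eb Nb]]] := matrix_operator _ _ HB.
by rewrite (mat_ext a b Ha Hb).
Qed.

Lemma bounded_op_matrix_unit (k l : nat) : bounded_op (matrix_unit ip E k l).
Proof. exact: bounded_op_rank_one. Qed.

Lemma mat_matrix_unit (k l i j : nat) :
  mat (matrix_unit ip E k l) i j = if andb (Nat.eqb i k) (Nat.eqb l j) then RtoC 1 else RtoC 0.
Proof.
rewrite /mat /matrix_unit ip_scal_right !ip_E.
by case: Nat.eqb; case: Nat.eqb => /=; ring.
Qed.

Definition square_section (m : nat -> nat -> C) (n : nat) : Op H :=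
  sum_n (fun k => sum_n (fun l => scal (m k l) (matrix_unit ip E k l)) n) n.

Lemma square_section_apply (m : nat -> nat -> C) (n : nat) (x : H) :
  square_section m n x =
  sum_n (fun k => sum_n (fun l => scal (m k l) (matrix_unit ip E k l x)) n) n.
Proof.
rewrite /square_section op_sum_apply; apply: sum_n_ext => k.
by rewrite op_sum_apply.
Qed.

Lemma bounded_op_square_section (m : nat -> nat -> C) (n : nat) :
  bounded_op (square_section m n).
Proof.
apply: bounded_op_sum => k; apply: bounded_op_sum => l.
apply: bounded_op_scal; exact: bounded_op_matrix_unit.
Qed.

Lemma mat_square_section (m : nat -> nat -> C) (n i j : nat) :
  mat (square_section m n) i j =
  if andb (Nat.leb i n) (Nat.leb j n) then m i j else RtoC 0.
Proof.
have inner : forall k, mat (sum_n (fun l => scal (m k l) (matrix_unit ip E k l)) n) i j =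
    if andb (Nat.eqb i k) (Nat.leb j n) then m i j else RtoC 0.
  move=> k; rewrite mat_sum.
  have term : forall l, mat (scal (m k l) (matrix_unit ip E k l)) i j =
      if andb (Nat.eqb i k) (Nat.eqb l j) then m i j else RtoC 0.
    move=> l; rewrite mat_scal mat_matrix_unit.
    by case: Nat.eqb_spec => [<-|_]; case: Nat.eqb_spec => [->|_] /=; ring.
  case: Nat.eqb_spec => [Ek|Nk] /=; last first.
    rewrite (csum_ext _ (fun _ => RtoC 0)); first exact: (sum_n_zero (G := C_AbelianMonoid)).
    by move=> l; rewrite term; case: Nat.eqb_spec.
  case: Nat.leb_spec => Hj.
    rewrite (sum_n_single _ _ j Hj); first by rewrite term Ek !Nat.eqb_refl.
    by move=> l _ Hl; rewrite term; case: (Nat.eqb_spec l j) => [?|_]; [congruence | rewrite Bool.andb_false_r].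
  rewrite (csum_ext_loc _ (fun _ => RtoC 0)); first exact: (sum_n_zero (G := C_AbelianMonoid)).
  by move=> l Hl; rewrite term; case: (Nat.eqb_spec l j) => [?|_]; [lia | rewrite Bool.andb_false_r].
rewrite mat_sum; case: (Nat.leb_spec i n) => Hi /=.
  rewrite (sum_n_single _ _ i Hi); first by rewrite inner Nat.eqb_refl.
  by move=> k _ Hk; rewrite inner; case: Nat.eqb_spec => // E'; congruence.
rewrite (csum_ext_loc _ (fun _ => RtoC 0)); first exact: (sum_n_zero (G := C_AbelianMonoid)).
by move=> k Hk; rewrite inner; case: Nat.eqb_spec => // E'; lia.
Qed.

(** The difference has nonzero entries only where k > n or l > n, and there (1 + k) (1 + l) >= 1 +
    n. One order of decay beyond the two needed for the operator norm therefore gives an error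
    O(1/n). *)
Lemma square_section_cvg (c : Op H) (m : nat -> nat -> C) (x : H) : bounded_op c ->
  rapid_decay m -> (forall k l, mat c k l = m k l) -> nlim (fun n => square_section m n x) (c x).
Proof.
move=> Hc Hm Em; have [B HB] := Hm 3%nat 3%nat.
have B0 : 0 <= B.
  apply: Rle_trans (HB 0%nat 0%nat).
  by apply: Rmult_le_pos; [rewrite /=; lra | apply: Cmod_ge_0].
have key : forall n, op_norm (plus c (scal (RtoC (-1)) (square_section m n))) <= 4 * (B / (1 + INR n)).
  move=> n; have Pn := pos_INR n.
  have Hs := bounded_op_scal (RtoC (-1)) _ (bounded_op_square_section m n).
  apply: op_norm_le_mat; first exact: bounded_op_plus.
  move=> k l; rewrite mat_plus mat_scal mat_square_section Em.
  have [Pk Pl] := (pos_INR k, pos_INR l).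
  have Hn1 : 0 < 1 + INR n by lra.
  apply/(Rle_div_r _ _ _ Hn1).
  have [Hkl|Hkl] : (n <= k + l)%nat /\ Cmod (Cplus (m k l) (Cmult (RtoC (-1))
       (if andb (Nat.leb k n) (Nat.leb l n) then m k l else RtoC 0))) = Cmod (m k l) \/
     Cmod (Cplus (m k l) (Cmult (RtoC (-1))
       (if andb (Nat.leb k n) (Nat.leb l n) then m k l else RtoC 0))) = 0.
    case: (Nat.leb_spec k n) => Hk /=.
    + case: (Nat.leb_spec l n) => Hl /=.
      * right; rewrite RtoC_m1.
        by have -> : Cplus (m k l) (Cmult (Copp (RtoC 1)) (m k l)) = RtoC 0 by [ring]; rewrite Cmod_0.
      * by left; split; [lia | rewrite Cmult_0_r Cplus_0_r].
    + by left; split; [lia | rewrite Cmult_0_r Cplus_0_r].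
  - have [Hle ->] := Hkl; apply: Rle_trans (HB k l).
    have : INR n <= INR k + INR l by rewrite -plus_INR; apply: le_INR.
    move=> Hle'.
    have -> : (1 + INR k) ^ 3 * (1 + INR l) ^ 3 * Cmod (m k l) =
      (1 + INR k) ^ 2 * (1 + INR l) ^ 2 * Cmod (m k l) * ((1 + INR k) * (1 + INR l)) by ring.
    apply: Rmult_le_compat_l; last nra.
    apply: Rmult_le_pos; last exact: Cmod_ge_0.
    by apply: Rmult_le_pos; apply: pow2_ge_0.
  - by rewrite Hkl; lra.
have Li : is_lim_seq (fun n => 4 * B * norm x * / (1 + INR n)) 0.
  rewrite -(Rmult_0_r (4 * B * norm x)).
  apply: (is_lim_seq_scal_l _ _ 0).
  apply: (is_lim_seq_ext (fun n => / INR (S n))); first by move=> n; rewrite S_INR Rplus_comm.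
  have L := is_lim_seq_inv _ _ (proj1 (is_lim_seq_incr_1 _ _) is_lim_seq_INR).
  by apply: L.
apply: nlim_le Li => n; rewrite hnorm_minus_comm.
have Hb : bounded_op (plus c (scal (RtoC (-1)) (square_section m n))).
  apply: bounded_op_plus => //; apply: bounded_op_scal.
  exact: bounded_op_square_section.
have := op_norm_ub _ x Hb; rewrite op_plusE op_scalE scal_m1 => H1.
apply: Rle_trans H1 _.
have := Rmult_le_compat_r _ _ _ (norm_ge_0 x) (key n); rewrite /Rdiv; lra.
Qed.

(** A rapidly decaying array m defines an operator with matrix m; both this operator and c are the
    limit of the square sections of m, so they coincide. *)
Lemma Kinf_iff (c : Op H) : KInf c <-> bounded_op c /\ rapid_decay (mat c).
Proof.
split.
- move=> [m [Hm Hc]]; have [B HB] := Hm 2%nat 2%nat.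
  have [a [Ha [Ea _]]] := matrix_operator _ _ HB.
  have Eac : a = c.
    apply: funext => x.
    apply: nlim_unique (square_section_cvg a m x Ha Hm Ea) _.
    apply/nlim_filterlim; apply: filterlim_ext (Hc x) => n.
    by rewrite square_section_apply.
  rewrite -Eac; split=> // M N; have [B' HB'] := Hm M N.
  by exists B' => k l; rewrite Ea.
- move=> [Hc Hm]; exists (mat c); split=> // x.
  apply/nlim_filterlim; apply: nlim_ext (square_section_cvg c _ x Hc Hm (fun _ _ => eq_refl)) => n.
  by rewrite square_section_apply.
Qed.

Lemma Kinf_bounded_op (c : Op H) : KInf c -> bounded_op c.
Proof. by move=> /Kinf_iff []. Qed.

Lemma rapid_decay_operator (m : nat -> nat -> C) : rapid_decay m ->
  exists c, KInf c /\ forall k l, mat c k l = m k l.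
Proof.
move=> Hm; have [B HB] := Hm 2%nat 2%nat.
have [a [Ha [Ea _]]] := matrix_operator _ _ HB.
exists a; split=> //; apply/Kinf_iff; split=> // M N.
by have [B' HB'] := Hm M N; exists B' => k l; rewrite Ea.
Qed.

Lemma Kinf_zero : KInf zero.
Proof.
apply/Kinf_iff; split; first exact: bounded_op_zero.
by move=> M N; exists 0 => k l; rewrite mat_zero Cmod_0; lra.
Qed.

Lemma Kinf_plus (c d : Op H) : KInf c -> KInf d -> KInf (plus c d).
Proof.
move=> /Kinf_iff [Hc Rc] /Kinf_iff [Hd Rd]; apply/Kinf_iff.
split; first exact: bounded_op_plus.
move=> M N; have [[B HB] [B' HB']] := (Rc M N, Rd M N).
exists (B + B') => k l; rewrite mat_plus.
have P := weight_ge0 M N k l.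
have := Rmult_le_compat_l _ _ _ P (Cmod_triangle (mat c k l) (mat d k l)).
have := HB k l; have := HB' k l; lra.
Qed.

Lemma Kinf_scal (a : C) (c : Op H) : KInf c -> KInf (scal a c).
Proof.
move=> /Kinf_iff [Hc Rc]; apply/Kinf_iff.
split; first exact: bounded_op_scal.
move=> M N; have [B HB] := Rc M N; exists (Cmod a * B) => k l.
rewrite mat_scal Cmod_mult.
have := Rmult_le_compat_l _ _ _ (Cmod_ge_0 a) (HB k l); lra.
Qed.

Lemma op_minus_scal (a b : Op H) : minus a b = plus a (scal (RtoC (-1)) b).
Proof. by apply: funext => x; rewrite op_plusE op_scalE scal_m1. Qed.

Lemma Kinf_minus (c d : Op H) : KInf c -> KInf d -> KInf (minus c d).
Proof. by move=> Hc Hd; rewrite op_minus_scal; apply: Kinf_plus => //; apply: Kinf_scal. Qed.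

(** * The derivation and the weights *)

Lemma diagK_eq (y z : H) : (forall k, ip (E k) z = Cmult (RtoC (INR k)) (ip (E k) y)) ->
  diagK ip E y = z.
Proof.
move=> Hz; apply: hsum_eq; apply: nlim_ext (basis_expansion z) => n.
by apply: sum_n_ext => k; rewrite Hz.
Qed.

Lemma diagK_scal_E (c : C) (l : nat) :
  diagK ip E (scal c (E l)) = scal (Cmult (RtoC (INR l)) c) (E l).
Proof.
apply: diagK_eq => k; rewrite !ip_scal_right ip_E.
by case: Nat.eqb_spec => [->|_]; ring.
Qed.

Lemma scal_C1 (x : H) : scal (RtoC 1) x = x.
Proof. exact: (scal_one (V := H)). Qed.

Lemma iter_weight_E (N l : nat) :
  Nat.iter N (fun y => plus y (diagK ip E y)) (E l) = scal (RtoC ((1 + INR l) ^ N)) (E l).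
Proof.
elim: N => [|N IH]; first by rewrite /= scal_C1.
rewrite Nat.iter_succ IH diagK_scal_E -(scal_distr_r (V := H)); congr scal.
by rewrite -[plus _ _]/(Cplus _ _) -RtoC_mult -RtoC_plus; congr RtoC; rewrite /=; ring.
Qed.

Lemma deltaK_eq (c d : Op H) : bounded_op c -> bounded_op d ->
  (forall k l, mat d k l = Cmult (RtoC (INR k - INR l)) (mat c k l)) ->
  DeltaK c = d.
Proof.
move=> Hc Hd Hm; apply: dense_ext_eq => // l.
have -> : diagK ip E (E l) = scal (RtoC (INR l)) (E l).
  by rewrite -{1}(scal_C1 (E l)) diagK_scal_E Cmult_1_r.
rewrite (bl_scal _ Hc).
(* This includes the fact that c (E l) lies in the domain of K: the vector on the right has the
   coefficients of the series defining [diagK], which therefore converges. *)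
have -> : diagK ip E (c (E l)) = plus (d (E l)) (scal (RtoC (INR l)) (c (E l))).
  apply: diagK_eq => k; rewrite ip_plus_right ip_scal_right -/(mat c k l) -/(mat d k l) Hm.
  by rewrite RtoC_minus; ring.
by rewrite /minus -plus_assoc plus_opp_r plus_zero_r.
Qed.

Lemma norm0_eq (N : nat) (c d : Op H) : bounded_op c -> bounded_op d ->
  (forall k l, mat d k l = Cmult (RtoC ((1 + INR l) ^ N)) (mat c k l)) ->
  Norm0 N c = op_norm d.
Proof.
move=> Hc Hd Hm; rewrite /norm0; congr op_norm; apply: dense_ext_eq => // l.
rewrite iter_weight_E (bl_scal _ Hc); apply: coef_ext => k.
by rewrite ip_scal_right -/(mat c k l) -/(mat d k l) Hm.
Qed.

Lemma Rabs_INR_minus_le (k l : nat) : Rabs (INR k - INR l) <= (1 + INR k) * (1 + INR l).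
Proof.
have [Pk Pl] := (pos_INR k, pos_INR l).
by apply: Rabs_le; split; nra.
Qed.

Lemma Kinf_derivation (c : Op H) : KInf c -> exists d, KInf d /\
  forall k l, mat d k l = Cmult (RtoC (INR k - INR l)) (mat c k l).
Proof.
move=> /Kinf_iff [Hc Rc]; apply: rapid_decay_operator => M N.
have [B HB] := Rc (S M) (S N); exists B => k l.
apply: Rle_trans (HB k l); rewrite Cmod_mult Cmod_R.
have [Pk Pl] := (pos_INR k, pos_INR l).
have P : 0 <= (1 + INR k) ^ M * (1 + INR l) ^ N * Cmod (mat c k l).
  apply: Rmult_le_pos; last exact: Cmod_ge_0.
  by apply: Rmult_le_pos; apply: pow_le; lra.
have := Rmult_le_compat_l _ _ _ P (Rabs_INR_minus_le k l); rewrite /=; lra.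
Qed.

Lemma Kinf_weight (N : nat) (c : Op H) : KInf c -> exists d, KInf d /\
  forall k l, mat d k l = Cmult (RtoC ((1 + INR l) ^ N)) (mat c k l).
Proof.
move=> /Kinf_iff [Hc Rc]; apply: rapid_decay_operator => M N'.
have [B HB] := Rc M (N' + N)%nat; exists B => k l.
apply: Rle_trans (HB k l); rewrite Cmod_mult Cmod_R Rabs_pos_eq.
  by right; rewrite pow_add; ring.
by apply: pow_le; have := pos_INR l; lra.
Qed.

Lemma mat_deltaK (c : Op H) (k l : nat) : KInf c ->
  mat (DeltaK c) k l = Cmult (RtoC (INR k - INR l)) (mat c k l).
Proof.
move=> Hc; have [d [Hd Ed]] := Kinf_derivation c Hc.
by rewrite (deltaK_eq c d) //; apply: Kinf_bounded_op.
Qed.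

Lemma Kinf_deltaK (c : Op H) : KInf c -> KInf (DeltaK c).
Proof.
move=> Hc; have [d [Hd Ed]] := Kinf_derivation c Hc.
by rewrite (deltaK_eq c d) //; apply: Kinf_bounded_op.
Qed.

Lemma Knorm_0 (N : nat) (c : Op H) : KNorm 0 N c = Norm0 N c.
Proof. by rewrite /Knorm sum_O C_n_0 Rmult_1_l. Qed.

Lemma Knorm_succ (M N : nat) (c : Op H) :
  KNorm (S M) N c = KNorm M N c + KNorm M N (DeltaK c).
Proof.
rewrite /Knorm (binomial_sum_succ (fun j => Norm0 N (Nat.iter j (DeltaK) c))).
by congr Rplus; apply: sum_n_ext => j; rewrite Nat.iter_succ_r.
Qed.

Lemma norm0_ge0 (N : nat) (c : Op H) : KInf c -> 0 <= Norm0 N c.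
Proof.
move=> Hc; have [d [Hd Ed]] := Kinf_weight N c Hc.
by rewrite (norm0_eq N c d) //; try apply: op_norm_ge0; apply: Kinf_bounded_op.
Qed.

Lemma Knorm_ge0 (M N : nat) (c : Op H) : KInf c -> 0 <= KNorm M N c.
Proof.
elim: M c => [|M IH] c Hc; first by rewrite Knorm_0; apply: norm0_ge0.
rewrite Knorm_succ; apply: Rplus_le_le_0_compat; apply: IH => //; exact: Kinf_deltaK.
Qed.

Lemma deltaK_plus (c d : Op H) : KInf c -> KInf d ->
  DeltaK (plus c d) = plus (DeltaK c) (DeltaK d).
Proof.
move=> Hc Hd; apply: deltaK_eq.
- by apply: bounded_op_plus; apply: Kinf_bounded_op.
- by apply: bounded_op_plus; apply: Kinf_bounded_op; apply: Kinf_deltaK.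
- by move=> k l; rewrite !mat_plus !mat_deltaK //; ring.
Qed.

Lemma deltaK_scal (a : C) (c : Op H) : KInf c ->
  DeltaK (scal a c) = scal a (DeltaK c).
Proof.
move=> Hc; apply: deltaK_eq.
- by apply: bounded_op_scal; apply: Kinf_bounded_op.
- by apply: bounded_op_scal; apply: Kinf_bounded_op; apply: Kinf_deltaK.
- by move=> k l; rewrite !mat_scal !mat_deltaK //; ring.
Qed.

Lemma norm0_plus (N : nat) (c d : Op H) : KInf c -> KInf d ->
  Norm0 N (plus c d) <= Norm0 N c + Norm0 N d.
Proof.
move=> Hc Hd; have [[c' [Hc' Ec]] [d' [Hd' Ed]]] := (Kinf_weight N c Hc, Kinf_weight N d Hd).
have [Lc Ld] := (Kinf_bounded_op _ Hc, Kinf_bounded_op _ Hd).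
have [Lc' Ld'] := (Kinf_bounded_op _ Hc', Kinf_bounded_op _ Hd').
rewrite (norm0_eq N c c') // (norm0_eq N d d') // (norm0_eq N (plus c d) (plus c' d')).
- exact: op_norm_plus.
- exact: bounded_op_plus.
- exact: bounded_op_plus.
- by move=> k l; rewrite !mat_plus Ec Ed; ring.
Qed.

Lemma norm0_scal (N : nat) (a : C) (c : Op H) : KInf c ->
  Norm0 N (scal a c) = Cmod a * Norm0 N c.
Proof.
move=> Hc; have [c' [Hc' Ec]] := Kinf_weight N c Hc.
have [Lc Lc'] := (Kinf_bounded_op _ Hc, Kinf_bounded_op _ Hc').
rewrite (norm0_eq N c c') // (norm0_eq N (scal a c) (scal a c')).
- exact: op_norm_scal.
- exact: bounded_op_scal.
- exact: bounded_op_scal.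
- by move=> k l; rewrite !mat_scal Ec; ring.
Qed.

Lemma Knorm_plus (M N : nat) (c d : Op H) : KInf c -> KInf d ->
  KNorm M N (plus c d) <= KNorm M N c + KNorm M N d.
Proof.
elim: M c d => [|M IH] c d Hc Hd; first by rewrite !Knorm_0; apply: norm0_plus.
rewrite !Knorm_succ deltaK_plus //.
have := IH _ _ Hc Hd; have := IH _ _ (Kinf_deltaK _ Hc) (Kinf_deltaK _ Hd); lra.
Qed.

Lemma Knorm_scal (M N : nat) (a : C) (c : Op H) : KInf c ->
  KNorm M N (scal a c) = Cmod a * KNorm M N c.
Proof.
elim: M c => [|M IH] c Hc; first by rewrite !Knorm_0; apply: norm0_scal.
by rewrite !Knorm_succ deltaK_scal // !IH //; [ring | apply: Kinf_deltaK].
Qed.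

Lemma Knorm_mono_l (M M' N : nat) (c : Op H) : KInf c -> (M <= M')%nat ->
  KNorm M N c <= KNorm M' N c.
Proof.
move=> Hc; elim=> [|m _ IH]; first lra.
by rewrite Knorm_succ; have := Knorm_ge0 m N _ (Kinf_deltaK _ Hc); lra.
Qed.

Lemma mat_le_norm0 (N k l : nat) (c : Op H) : KInf c ->
  (1 + INR l) ^ N * Cmod (mat c k l) <= Norm0 N c.
Proof.
move=> Hc; have [d [Hd Ed]] := Kinf_weight N c Hc.
rewrite (norm0_eq N c d) //; try exact: Kinf_bounded_op.
apply: Rle_trans (Cmod_mat_le d k l (Kinf_bounded_op _ Hd)).
rewrite Ed Cmod_mult Cmod_R Rabs_pos_eq; first lra.
by apply: pow_le; have := pos_INR l; lra.
Qed.

(* With [Knorm_le_mat], a converse: the norms [Knorm] define the same topology as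
   the weighted sup norms of the matrix coefficients. *)
Lemma mat_le_Knorm (M N k l : nat) (c : Op H) : KInf c ->
  (1 + INR k) ^ M * (1 + INR l) ^ N * Cmod (mat c k l) <= KNorm M (M + N) c.
Proof.
move=> Hc; have [Pk Pl] := (pos_INR k, pos_INR l).
(* The recursion on M produces one factor 1 + |k - l| per step; trading it for 1 + k costs a factor
   1 + l, hence the second index M + N. *)
have G : forall M N' c, KInf c ->
    (1 + Rabs (INR k - INR l)) ^ M * (1 + INR l) ^ N' * Cmod (mat c k l) <= KNorm M N' c.
  elim=> [|M' IH] N' c' Hc'.
    by rewrite Knorm_0 Rmult_1_l; apply: mat_le_norm0.
  rewrite Knorm_succ; have := IH N' _ Hc'; have := IH N' _ (Kinf_deltaK _ Hc').
  rewrite mat_deltaK // Cmod_mult Cmod_R /=; lra.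
apply: Rle_trans (G M (M + N)%nat c Hc).
apply: Rmult_le_compat_r; first exact: Cmod_ge_0.
rewrite pow_add -Rmult_assoc -Rpow_mult_distr.
apply: Rmult_le_compat_r; first by apply: pow_le; lra.
apply: pow_incr; split; first lra.
have : INR k - INR l <= Rabs (INR k - INR l) by apply: Rle_abs.
have := Rabs_pos (INR k - INR l); nra.
Qed.

(** The exponents count 2 in each index for the operator norm, one more in each for every factor k -
    l, and N for the weight. The recursion on M doubles the bound at each step. *)
Lemma Knorm_le_mat (M N : nat) (c : Op H) (B : R) : KInf c ->
  (forall k l, (1 + INR k) ^ (M + 2) * (1 + INR l) ^ (M + N + 2) * Cmod (mat c k l) <= B) ->
  KNorm M N c <= 2 ^ M * (4 * B).
Proof.
elim: M c => [|M IH] c Hc HB.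
  have [d [Hd Ed]] := Kinf_weight N c Hc.
  rewrite Knorm_0 Rmult_1_l (norm0_eq N c d) //; try exact: Kinf_bounded_op.
  apply: op_norm_le_mat; first exact: Kinf_bounded_op.
  move=> k l; apply: Rle_trans (HB k l); right.
  rewrite Ed Cmod_mult Cmod_R Rabs_pos_eq; first by rewrite /= !pow_add /=; ring.
  by apply: pow_le; have := pos_INR l; lra.
rewrite Knorm_succ.
have P : forall k l, 0 <= (1 + INR k) ^ (M + 2) * (1 + INR l) ^ (M + N + 2) * Cmod (mat c k l).
  move=> k l; have [Pk Pl] := (pos_INR k, pos_INR l).
  apply: Rmult_le_pos; last exact: Cmod_ge_0.
  by apply: Rmult_le_pos; apply: pow_le; lra.
have H1 : KNorm M N c <= 2 ^ M * (4 * B).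
  apply: IH => // k l; apply: Rle_trans (HB k l).
  have [Pk Pl] := (pos_INR k, pos_INR l).
  have : 1 <= (1 + INR k) * (1 + INR l) by nra.
  move=> /(Rmult_le_compat_l _ _ _ (P k l)); rewrite /=; lra.
have H2 : KNorm M N (DeltaK c) <= 2 ^ M * (4 * B).
  apply: IH; first exact: Kinf_deltaK.
  move=> k l; apply: Rle_trans (HB k l).
  rewrite mat_deltaK // Cmod_mult Cmod_R.
  have := Rmult_le_compat_l _ _ _ (P k l) (Rabs_INR_minus_le k l); rewrite /=; lra.
rewrite /=; lra.
Qed.

(** * Adjoints *)

(** A relation avoids the description in [adj]: sums, products and double adjoints are immediate for
    it, and [adj_eq] returns to [adj]. *)
Definition is_adjoint (a b : Op H) : Prop := forall x y, ip (b y) x = ip y (a x).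

Lemma adj_eq (a b : Op H) : is_adjoint a b -> adj ip a = b.
Proof.
move=> Hab; apply: funext => y; apply: iota_unique.
- move=> z Hz; apply: coef_ext => k.
  by rewrite (ip_sym z) (ip_sym (b y)) Hz Hab.
- by move=> x; apply: Hab.
Qed.

Lemma is_adjoint_sym (a b : Op H) : is_adjoint a b -> is_adjoint b a.
Proof. by move=> Hab x y; rewrite ip_sym -Hab -ip_sym. Qed.

Lemma is_adjoint_of_mat (a b : Op H) : bounded_op a -> bounded_op b ->
  (forall k l, mat b k l = Cconj (mat a l k)) -> is_adjoint a b.
Proof.
move=> Ha Hb Hm.
have H1 : forall k x, ip (b (E k)) x = ip (E k) (a x).
  move=> k x.
  have L1 := nlim_ip _ _ _ _ (nlim_const (b (E k))) (basis_expansion x).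
  have L2 := nlim_ip _ _ _ _ (nlim_const (E k)) (bl_expansion a x Ha).
  apply: nlim_unique L1 _; apply: nlim_ext L2 => n.
  rewrite !ip_sum_right; apply: csum_ext => l.
  by rewrite !ip_scal_right (ip_sym (E l)) -[ip (E l) (b (E k))]/(mat b l k) Hm Cconj_conj.
move=> x y.
have L1 := nlim_ip _ _ _ _ (bl_expansion b y Hb) (nlim_const x).
have L2 := nlim_ip _ _ _ _ (basis_expansion y) (nlim_const (a x)).
apply: nlim_unique L1 _; apply: nlim_ext L2 => n.
rewrite (ip_sym (a x)) (ip_sym x) !ip_sum_right; congr Cconj; apply: csum_ext => k.
by rewrite !ip_scal_right (ip_sym (E k)) -H1 -ip_sym.
Qed.

Lemma is_adjoint_mat (a b : Op H) (k l : nat) : is_adjoint a b ->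
  mat b k l = Cconj (mat a l k).
Proof. by move=> Hab; rewrite /mat -Hab -ip_sym. Qed.

Lemma is_adjoint_plus (a b c d : Op H) : is_adjoint a b -> is_adjoint c d ->
  is_adjoint (plus a c) (plus b d).
Proof. by move=> H1 H2 x y; rewrite !op_plusE ip_plus_left ip_plus_right H1 H2. Qed.

Lemma is_adjoint_scal (k : C) (a b : Op H) : is_adjoint a b ->
  is_adjoint (scal k a) (scal (Cconj k) b).
Proof. by move=> H1 x y; rewrite !op_scalE ip_scal_left ip_scal_right H1 Cconj_conj. Qed.

Lemma is_adjoint_comp (a b c d : Op H) : is_adjoint a b -> is_adjoint c d ->
  is_adjoint (op_comp a c) (op_comp d b).
Proof. by move=> H1 H2 x y; rewrite /op_comp H2 H1. Qed.

Lemma Kinf_adjoint (c : Op H) : KInf c -> exists d, KInf d /\ is_adjoint c d.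
Proof.
move=> /Kinf_iff [Hc Rc].
have [d [Hd Ed]] : exists d, KInf d /\ forall k l, mat d k l = Cconj (mat c l k).
  apply: rapid_decay_operator => M N; have [B HB] := Rc N M; exists B => k l.
  by rewrite Cmod_conj (Rmult_comm (_ ^ M)).
exists d; split=> //; apply: is_adjoint_of_mat => //; exact: Kinf_bounded_op.
Qed.

(** By Pythagoras every block of the image series is bounded by the same block of the expansion of
    x, which gives the Cauchy criterion although the series need not converge absolutely. This
    builds the shift, its adjoint and (1 + K)^(-N). *)
Lemma orthogonal_contraction (v : nat -> H) :
  (forall k l, k <> l -> ip (v k) (v l) = RtoC 0) -> (forall k, norm (v k) <= 1) ->
  exists a : Op H, bounded_op a /\ (forall k, a (E k) = v k) /\
    (forall x, norm (a x) <= norm x) /\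
    (forall x, a x = hsum (fun k => scal (ip (E k) x) (v k))).
Proof.
move=> Ho Hv.
have Hle : forall (x : nat -> C) n m,
    norm (sum_n_m (fun k => scal (x k) (v k)) n m) <= norm (sum_n_m (fun k => scal (x k) (E k)) n m).
  move=> x n m; apply: Rsqr_incr_0_var; last exact: norm_ge_0.
  rewrite !Rsqr_pow2 !norm_sq_orthogonal_sum //; last by move=> k l Hkl; apply: (onb_orth _ _ HE).
  apply: sum_n_m_le => k; rewrite norm_E pow1.
  apply: Rmult_le_compat_l; first exact: pow2_ge_0.
  by rewrite -(pow1 2); apply: pow_incr; split; [apply: norm_ge_0 | apply: Hv].
pose a : Op H := fun x => hsum (fun k => scal (ip (E k) x) (v k)).
have Ha : forall x, nlim (fun n => sum_n (fun k => scal (ip (E k) x) (v k)) n) (a x).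
  move=> x.
  have Ex : ex_series (fun k => scal (ip (E k) x) (E k)) by exists x; apply: (onb_expand _ _ HE).
  have [s Hs] : ex_series (fun k => scal (ip (E k) x) (v k)).
    apply: ex_series_Cauchy => eps; have [N HN] := Cauchy_ex_series _ Ex eps.
    exists N => n m Hn Hm; apply: Rle_lt_trans (HN n m Hn Hm); exact: Hle.
  have L : nlim (fun n => sum_n (fun k => scal (ip (E k) x) (v k)) n) s by apply/nlim_filterlim.
  by rewrite /a (hsum_eq _ _ L).
have Na : forall x, norm (a x) <= norm x.
  move=> x; apply: (is_lim_seq_le _ _ _ _ _ (nlim_norm _ _ (Ha x)) (nlim_norm _ _ (basis_expansion x))) => n.
  exact: Hle.
have [La Ea] := operator_of_columns v a 1 Rle_0_1 Ha
  ltac:(by move=> x; rewrite Rmult_1_l).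
by exists a.
Qed.

(** * Toeplitz operators *)

Lemma shift_spec : bounded_op (shift ip E) /\
  (forall k, shift ip E (E k) = E (S k)) /\ (forall x, norm (shift ip E x) <= norm x).
Proof.
have [a [La [Ea [Na Da]]]] := orthogonal_contraction (fun k => E (S k))
  (fun k l Hkl => onb_orth _ _ HE (S k) (S l) (fun e => Hkl (Nat.succ_inj _ _ e)))
  (fun k => Req_le _ _ (norm_E (S k))).
by have <- : a = shift ip E by apply: funext => x; rewrite Da.
Qed.

Lemma adj_shift_spec : bounded_op (adj ip (shift ip E)) /\
  adj ip (shift ip E) (E 0%nat) = zero /\
  (forall k, adj ip (shift ip E) (E (S k)) = E k) /\
  (forall x, norm (adj ip (shift ip E) x) <= norm x).
Proof.
pose v k := match k with 0%nat => (zero : H) | S j => E j end.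
have Ho : forall k l, k <> l -> ip (v k) (v l) = RtoC 0.
  move=> [|k] [|l] Hkl //=; rewrite ?ip_zero_right //.
    by rewrite ip_sym ip_zero_right /Cconj /= Ropp_0.
  by apply: (onb_orth _ _ HE) => e; apply: Hkl; rewrite e.
have Hv : forall k, norm (v k) <= 1.
  by move=> [|k] /=; rewrite ?norm_zero ?norm_E; lra.
have [a [La [Ea [Na Da]]]] := orthogonal_contraction v Ho Hv.
have [Ls [Es Ns]] := shift_spec.
have -> : adj ip (shift ip E) = a.
  apply: adj_eq; apply: is_adjoint_of_mat => // k l.
  rewrite /mat Ea Es; case: l => [|l] /=.
    by rewrite ip_zero_right ip_E /= /Cconj /= Ropp_0.
  rewrite !ip_E -[Nat.eqb (S l) (S k)]/(Nat.eqb l k) Nat.eqb_sym.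
  by case: Nat.eqb; rewrite /Cconj /= Ropp_0.
split; [exact: La | split; [exact: (Ea 0%nat) | split; [move=> k; exact: (Ea (S k)) | exact: Na]]].
Qed.

Lemma iter_contraction (a : Op H) (n : nat) : bounded_op a ->
  (forall x, norm (a x) <= norm x) ->
  bounded_op (fun x => Nat.iter n a x) /\ forall x, norm (Nat.iter n a x) <= norm x.
Proof.
move=> La Na; elim: n => [|n [Ln Nn]].
  split; last by move=> x; apply: Rle_refl.
  by split=> //; exists 1; split; [lra | move=> x /=; lra].
split; last by move=> x /=; apply: Rle_trans (Na _) _.
exact: (bounded_op_comp a (fun x => Nat.iter n a x)).
Qed.

Lemma iter_shift_E (n l : nat) : Nat.iter n (shift ip E) (E l) = E (n + l)%nat.
Proof.
have [_ [Es _]] := shift_spec.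
by elim: n => [|n IH] //; rewrite Nat.iter_succ IH Es.
Qed.

Lemma iter_adj_shift_E (n l : nat) :
  Nat.iter n (adj ip (shift ip E)) (E l) = if Nat.leb n l then E (l - n)%nat else zero.
Proof.
have [La [E0 [Es _]]] := adj_shift_spec.
elim: n => [|n IH]; first by rewrite /= Nat.sub_0_r.
rewrite Nat.iter_succ IH.
case: (Nat.leb_spec n l) => Hn; case: (Nat.leb_spec (S n) l) => Hn'; try lia.
- by have -> : (l - n = S (l - S n))%nat by [lia]; rewrite Es.
- by have -> : (l - n = 0)%nat by [lia]; rewrite E0.
- exact: bl_zero.
Qed.

Lemma contraction_series (V : nat -> Op H) (phi : nat -> C) (B : R) : 0 <= B ->
  (forall n, bounded_op (V n)) -> (forall n x, norm (V n x) <= norm x) ->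
  (forall n, Cmod (phi n) <= B * / (1 + INR n) ^ 2) ->
  bounded_op (fun x => hsum (fun n => scal (phi n) (V n x))) /\
  forall x, nlim (fun J => sum_n (fun n => scal (phi n) (V n x)) J) (hsum (fun n => scal (phi n) (V n x))).
Proof.
move=> B0 LV NV Hphi.
have Ha : forall x, nlim (fun J => sum_n (fun n => scal (phi n) (V n x)) J)
      (hsum (fun n => scal (phi n) (V n x))) /\
    norm (hsum (fun n => scal (phi n) (V n x))) <= (B * norm x) * 2.
  move=> x; apply: (abs_summable _ (fun n => (B * norm x) * / (1 + INR n) ^ 2)) => n.
    rewrite hnorm_scal.
    have := Rmult_le_compat _ _ _ _ (Cmod_ge_0 _) (norm_ge_0 _) (Hphi n) (NV n x); lra.
  by apply: sum_inv_sq_scal; apply: Rmult_le_pos => //; apply: norm_ge_0.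
split; last by move=> x; case: (Ha x).
apply: (bounded_op_limit (fun J => sum_n (fun n => scal (phi n) (V n)) J) _ (2 * B)); first lra.
- by move=> J; apply: bounded_op_sum => n; apply: bounded_op_scal.
- by move=> x; apply: nlim_ext (proj1 (Ha x)) => J; rewrite op_sum_apply.
- by move=> x; have := proj2 (Ha x); lra.
Qed.

(** The powers of the shift fill the entries with l <= k, those of its adjoint the remaining ones;
    in each entry a single term of the series survives. *)
Lemma toeplitz_spec (f : R -> C) : smooth_torus f ->
  bounded_op (Toep f) /\
  forall k l, mat (Toep f) k l = fourier f (Z.of_nat k - Z.of_nat l).
Proof.
move=> Hf.
have [Ls [Es Ns]] := shift_spec; have [La [E0 [Ea Na]]] := adj_shift_spec.
have B0 : 0 <= Clnorm 2 f * (1 + INR 0) ^ 2.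
  by apply: Rmult_le_pos; [apply: Clnorm_ge0 | apply: pow2_ge_0].
have S1 := contraction_series (fun n x => Nat.iter n (shift ip E) x) (fun n => fourier f (Z.of_nat n)) _ B0
  (fun n => proj1 (iter_contraction _ n Ls Ns)) (fun n => proj2 (iter_contraction _ n Ls Ns))
  (fun n => fourier_decay_sq f 0 n (Z.of_nat n) Hf ltac:(lia)).
have S2 := contraction_series (fun n x => Nat.iter (S n) (adj ip (shift ip E)) x) (fun n => fourier f (- Z.of_nat (S n))) _ B0
  (fun n => proj1 (iter_contraction _ (S n) La Na)) (fun n => proj2 (iter_contraction _ (S n) La Na))
  (fun n => fourier_decay_sq f 0 n (- Z.of_nat (S n)) Hf ltac:(lia)).
split; first exact: (bounded_op_plus _ _ (proj1 S1) (proj1 S2)).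
move=> k l; rewrite /mat /toeplitz ip_plus_right.
have M1 : ip (E k) (hsum (fun n => scal (fourier f (Z.of_nat n)) (Nat.iter n (shift ip E) (E l)))) =
    if Nat.leb l k then fourier f (Z.of_nat k - Z.of_nat l) else RtoC 0.
  apply: nlim_unique (nlim_ip _ _ _ _ (nlim_const (E k)) (proj2 S1 (E l))) _.
  apply: (nlim_eventually_const _ _ k) => J HJ; rewrite ip_sum_right.
  case: Nat.leb_spec => Hlk.
    rewrite (sum_n_single _ _ (k - l)%nat); last 2 first.
    + lia.
    + move=> n _ Hn; rewrite ip_scal_right iter_shift_E ip_E.
      by case: Nat.eqb_spec => [?|_]; [lia | apply: Cmult_0_r].
    rewrite ip_scal_right iter_shift_E ip_E.
    have -> : (k - l + l = k)%nat by lia.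
    by rewrite Nat.eqb_refl Cmult_1_r Nat2Z.inj_sub.
  rewrite (csum_ext_loc _ (fun _ => RtoC 0)); first exact: (sum_n_zero (G := C_AbelianMonoid)).
  move=> n _; rewrite ip_scal_right iter_shift_E ip_E.
  by case: Nat.eqb_spec => [?|_]; [lia | apply: Cmult_0_r].
have M2 : ip (E k) (hsum (fun n => scal (fourier f (- Z.of_nat (S n))) (Nat.iter (S n) (adj ip (shift ip E)) (E l)))) =
    if Nat.leb l k then RtoC 0 else fourier f (Z.of_nat k - Z.of_nat l).
  apply: nlim_unique (nlim_ip _ _ _ _ (nlim_const (E k)) (proj2 S2 (E l))) _.
  have term : forall n, ip (E k) (scal (fourier f (- Z.of_nat (S n))) (Nat.iter (S n) (adj ip (shift ip E)) (E l))) =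
      if Nat.eqb (k + S n) l then fourier f (- Z.of_nat (S n)) else RtoC 0.
    move=> n; rewrite ip_scal_right iter_adj_shift_E.
    case: (Nat.leb_spec (S n) l) => Hn.
      rewrite ip_E; case: Nat.eqb_spec => Hk; case: Nat.eqb_spec => Hk'; try lia; try ring.
    rewrite ip_zero_right; case: Nat.eqb_spec => Hk; try lia; ring.
  apply: (nlim_eventually_const _ _ l) => J HJ; rewrite ip_sum_right.
  case: Nat.leb_spec => Hlk.
    rewrite (csum_ext _ (fun _ => RtoC 0)); first exact: (sum_n_zero (G := C_AbelianMonoid)).
    by move=> n; rewrite term; case: Nat.eqb_spec => // ?; lia.
  rewrite (sum_n_single _ _ (l - k - 1)%nat); last 2 first.
  + lia.
  + by move=> n _ Hn; rewrite term; case: Nat.eqb_spec => // ?; lia.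
  rewrite term; case: Nat.eqb_spec => Hk; last lia.
  by congr fourier; lia.
rewrite M1 M2; case: Nat.leb; ring.
Qed.

Lemma bounded_op_toeplitz (f : R -> C) : smooth_torus f -> bounded_op (Toep f).
Proof. by move=> /toeplitz_spec []. Qed.

Lemma mat_toeplitz (f : R -> C) (k l : nat) : smooth_torus f ->
  mat (Toep f) k l = fourier f (Z.of_nat k - Z.of_nat l).
Proof. by move=> /toeplitz_spec []. Qed.

Lemma op_norm_toeplitz (f : R -> C) : smooth_torus f -> op_norm (Toep f) <= supnorm f.
Proof.
move=> Hf; apply: norm_le_of_form.
- exact: bounded_op_toeplitz.
- exact: supnorm_ge0.
- move=> m x y.
  have := toeplitz_form_bound f (supnorm f) m 0 x y (smooth_ccont _ Hf) (fun t => supnorm_ub f t Hf).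
  congr (Cmod _ <= _); apply: csum_ext => k; apply: csum_ext => l.
  rewrite (mat_toeplitz _ _ _ Hf) Z.add_0_r; reflexivity.
Qed.

Lemma toeplitz_plus (f g : R -> C) : smooth_torus f -> smooth_torus g ->
  Toep (fun t => Cplus (f t) (g t)) = plus (Toep f) (Toep g).
Proof.
move=> Hf Hg; have Hfg := smooth_plus _ _ Hf Hg; apply: mat_ext.
- exact: bounded_op_toeplitz.
- by apply: bounded_op_plus; apply: bounded_op_toeplitz.
- move=> k l; apply: (eq_trans (mat_toeplitz _ k l Hfg)).
  apply: (eq_trans (fourier_plus _ _ _ (smooth_ccont _ Hf) (smooth_ccont _ Hg))).
  apply: (eq_trans _ (eq_sym (mat_plus _ _ k l))).
  exact: (f_equal2 Cplus (eq_sym (mat_toeplitz _ k l Hf)) (eq_sym (mat_toeplitz _ k l Hg))).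
Qed.

Lemma toeplitz_scal (c : C) (f : R -> C) : smooth_torus f ->
  Toep (fun t => Cmult c (f t)) = scal c (Toep f).
Proof.
move=> Hf; have Hcf := smooth_scal c _ Hf; apply: mat_ext.
- exact: bounded_op_toeplitz.
- by apply: bounded_op_scal; apply: bounded_op_toeplitz.
- move=> k l; apply: (eq_trans (mat_toeplitz _ k l Hcf)).
  apply: (eq_trans (fourier_scal _ _ _ (smooth_ccont _ Hf))).
  apply: (eq_trans _ (eq_sym (mat_scal _ _ k l))).
  exact: (f_equal (Cmult c) (eq_sym (mat_toeplitz _ k l Hf))).
Qed.

Lemma toeplitz_zero : Toep (fun _ => RtoC 0) = zero.
Proof.
apply: mat_ext; [apply: bounded_op_toeplitz; exact: smooth_const | exact: bounded_op_zero |].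
move=> k l; rewrite mat_toeplitz; last exact: smooth_const.
by rewrite fourier_const mat_zero; case: Z.eqb.
Qed.

Lemma is_adjoint_toeplitz (f : R -> C) : smooth_torus f ->
  is_adjoint (Toep f) (Toep (fun t => Cconj (f t))).
Proof.
move=> Hf; have Hcf := smooth_conj _ Hf.
apply: is_adjoint_of_mat; try exact: bounded_op_toeplitz.
move=> k l; apply: (eq_trans (mat_toeplitz _ k l Hcf)).
apply: (eq_trans (fourier_conj _ _ (smooth_ccont _ Hf))).
apply: (eq_trans _ (f_equal Cconj (eq_sym (mat_toeplitz _ l k Hf)))).
by congr (Cconj (fourier f _)); ring.
Qed.

(** * Products of smooth operators *)

(** Plays the part of [deltaK] for T(f) and for mixed products, to which the lemmas about [deltaK]
    on K^infty do not apply. *)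
Definition is_derivation (a a' : Op H) : Prop :=
  forall k l, mat a' k l = Cmult (RtoC (INR k - INR l)) (mat a k l).

Lemma is_derivation_toeplitz (f : R -> C) : smooth_torus f ->
  is_derivation (Toep f) (Toep (Dtorus f)).
Proof.
move=> Hf k l; apply: (eq_trans (mat_toeplitz _ k l (smooth_Dtorus _ Hf))).
apply: (eq_trans (fourier_Dtorus _ _ Hf)).
rewrite minus_IZR -!INR_IZR_INZ.
exact: (f_equal (Cmult _) (eq_sym (mat_toeplitz _ k l Hf))).
Qed.

Lemma is_derivation_deltaK (c : Op H) : KInf c -> is_derivation c (DeltaK c).
Proof. by move=> Hc k l; apply: mat_deltaK. Qed.

(** Leibniz rule: under the sum over the intermediate index j, k - l = (k - j) + (j - l). *)
Lemma is_derivation_comp (a a' b b' : Op H) : bounded_op a -> bounded_op a' ->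
  is_derivation a a' -> is_derivation b b' ->
  is_derivation (op_comp a b) (plus (op_comp a' b) (op_comp a b')).
Proof.
move=> La La' Da Db k l; rewrite mat_plus.
have L := nlim_plus _ _ _ _ (mat_comp a' b k l La') (mat_comp a b' k l La).
apply: nlim_unique L _.
have L' := nlim_scal (RtoC (INR k - INR l)) _ _ (mat_comp a b k l La).
apply: nlim_ext L' => n.
rewrite -sum_n_plus -[scal _ _]/(Cmult _ _) -csum_scal; apply: csum_ext => j.
rewrite Da Db -[plus _ _]/(Cplus _ _) !RtoC_minus; ring.
Qed.

Lemma norm0_comp_eq (N : nat) (a d d' : Op H) : bounded_op a -> bounded_op d ->
  bounded_op d' ->
  (forall k l, mat d' k l = Cmult (RtoC ((1 + INR l) ^ N)) (mat d k l)) ->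
  Norm0 N (op_comp a d) = op_norm (op_comp a d').
Proof.
move=> La Ld Ld' Ed; apply: norm0_eq; try exact: bounded_op_comp.
have Ed' : forall l, d' (E l) = scal (RtoC ((1 + INR l) ^ N)) (d (E l)).
  by move=> l; apply: coef_ext => k; rewrite ip_scal_right -/(mat d k l) -/(mat d' k l).
by move=> k l; rewrite /mat /op_comp Ed' (bl_scal _ La) ip_scal_right.
Qed.

Lemma norm0_comp (N : nat) (a d : Op H) : bounded_op a -> KInf d ->
  Norm0 N (op_comp a d) <= op_norm a * Norm0 N d.
Proof.
move=> La Hd; have [d' [Hd' Ed]] := Kinf_weight N d Hd.
have [Ld Ld'] := (Kinf_bounded_op _ Hd, Kinf_bounded_op _ Hd').
rewrite (norm0_comp_eq N a d d') // (norm0_eq N d d') //; exact: op_norm_comp.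
Qed.

(** What T(f) and the elements of K^infty have in common as left factors: repeated derivation leaves
    them bounded. *)
Fixpoint derivable_n (n : nat) (a : Op H) : Prop :=
  match n with
  | 0%nat => bounded_op a
  | S m => bounded_op a /\ exists a', is_derivation a a' /\ derivable_n m a'
  end.

Lemma derivable_n_bounded_op (n : nat) (a : Op H) : derivable_n n a -> bounded_op a.
Proof. by case: n => [|n] // []. Qed.

Lemma derivable_n_pred (n : nat) (a : Op H) : derivable_n (S n) a -> derivable_n n a.
Proof.
elim: n a => [|n IH] a [La [a' [Da Ha']]] //.
by split=> //; exists a'; split=> //; apply: IH.
Qed.

Lemma derivable_n_toeplitz (n : nat) (f : R -> C) : smooth_torus f ->
  derivable_n n (Toep f).
Proof.
elim: n f => [|n IH] f Hf; first exact: bounded_op_toeplitz.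
split; first exact: bounded_op_toeplitz.
exists (Toep (Dtorus f)); split; first exact: is_derivation_toeplitz.
by apply: IH; apply: smooth_Dtorus.
Qed.

Lemma derivable_n_Kinf (n : nat) (c : Op H) : KInf c -> derivable_n n c.
Proof.
elim: n c => [|n IH] c Hc; first exact: Kinf_bounded_op.
split; first exact: Kinf_bounded_op.
exists (DeltaK c); split; first exact: is_derivation_deltaK.
by apply: IH; apply: Kinf_deltaK.
Qed.

Lemma one_plus_INR_le (k l : nat) : 1 + INR k <= (1 + Rabs (INR k - INR l)) * (1 + INR l).
Proof.
have [Pk Pl] := (pos_INR k, pos_INR l).
have := Rle_abs (INR k - INR l); have := Rabs_pos (INR k - INR l); nra.
Qed.

(** The right factor supplies decay in l, since the weight acts on it alone, and the Leibniz rule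
    supplies powers of 1 + |k - l|; together they give decay in k by [one_plus_INR_le]. *)
Lemma Kinf_comp_l (a d : Op H) : (forall n, derivable_n n a) -> KInf d ->
  KInf (op_comp a d).
Proof.
move=> Ha Hd.
have G : forall n N a d, derivable_n n a -> KInf d -> exists B, forall k l,
    (1 + Rabs (INR k - INR l)) ^ n * (1 + INR l) ^ N * Cmod (mat (op_comp a d) k l) <= B.
  elim=> [|n IH] N a1 d1 Ha1 Hd1.
    have [d' [Hd' Ed]] := Kinf_weight N d1 Hd1.
    have [Ld Ld'] := (Kinf_bounded_op _ Hd1, Kinf_bounded_op _ Hd').
    exists (op_norm (op_comp a1 d')) => k l.
    apply: Rle_trans (Cmod_mat_le _ k l (bounded_op_comp _ _ Ha1 Ld')).
    have Ed' : d' (E l) = scal (RtoC ((1 + INR l) ^ N)) (d1 (E l)).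
      by apply: coef_ext => j; rewrite ip_scal_right -/(mat d1 j l) -/(mat d' j l).
    rewrite /mat /op_comp Ed' (bl_scal _ Ha1) ip_scal_right Cmod_mult Cmod_R (Rabs_pos_eq ((1 + INR l) ^ N)).
      by rewrite pow_O Rmult_1_l; apply: Rle_refl.
    by apply: pow_le; have := pos_INR l; lra.
  have [La1 [a' [Da Ha']]] := Ha1.
  have La' := derivable_n_bounded_op _ _ Ha'.
  have [B1 HB1] := IH N a1 d1 (derivable_n_pred _ _ Ha1) Hd1.
  have [B2 HB2] := IH N a' d1 Ha' Hd1.
  have [B3 HB3] := IH N a1 (DeltaK d1) (derivable_n_pred _ _ Ha1) (Kinf_deltaK _ Hd1).
  exists (B1 + (B2 + B3)) => k l.
  have D := is_derivation_comp _ _ _ _ La1 La' Da (is_derivation_deltaK _ Hd1) k l.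
  have := f_equal Cmod D; rewrite Cmod_mult Cmod_R mat_plus => D'.
  have T := Cmod_triangle (mat (op_comp a' d1) k l) (mat (op_comp a1 (DeltaK d1)) k l).
  have P : 0 <= (1 + Rabs (INR k - INR l)) ^ n * (1 + INR l) ^ N.
    by apply: Rmult_le_pos; apply: pow_le; have := pos_INR l; have := Rabs_pos (INR k - INR l); lra.
  have := Rmult_le_compat_l _ _ _ P T; rewrite D'.
  have := HB1 k l; have := HB2 k l; have := HB3 k l; rewrite /=; lra.
apply/Kinf_iff; split.
  by apply: bounded_op_comp; [apply: (Ha 0%nat) | apply: Kinf_bounded_op].
move=> M N; have [B HB] := G M (M + N)%nat a d (Ha M) Hd; exists B => k l.
apply: Rle_trans (HB k l); apply: Rmult_le_compat_r; first exact: Cmod_ge_0.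
have [Pk Pl] := (pos_INR k, pos_INR l).
rewrite pow_add -Rmult_assoc -Rpow_mult_distr.
apply: Rmult_le_compat_r; first by apply: pow_le; lra.
apply: pow_incr; split; [lra | exact: one_plus_INR_le].
Qed.

Lemma Kinf_of_adjoint (c d : Op H) : bounded_op c -> is_adjoint c d -> KInf d -> KInf c.
Proof.
move=> Lc Hcd /Kinf_iff [Ld Rd]; apply/Kinf_iff; split=> // M N.
have [B HB] := Rd N M; exists B => k l.
rewrite (is_adjoint_mat _ _ k l (is_adjoint_sym _ _ Hcd)) Cmod_conj (Rmult_comm (_ ^ M)).
exact: HB.
Qed.

Lemma Kinf_toeplitz_comp (f : R -> C) (d : Op H) : smooth_torus f -> KInf d ->
  KInf (op_comp (Toep f) d).
Proof. by move=> Hf Hd; apply: Kinf_comp_l => // n; apply: derivable_n_toeplitz. Qed.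

(** Taking adjoints puts the Toeplitz factor on the left, where the ideal property is known. *)
Lemma Kinf_comp_toeplitz (f : R -> C) (c : Op H) : smooth_torus f -> KInf c ->
  KInf (op_comp c (Toep f)).
Proof.
move=> Hf Hc; have [d [Hd Acd]] := Kinf_adjoint c Hc.
apply: (Kinf_of_adjoint _ _ _ (is_adjoint_comp _ _ _ _ Acd (is_adjoint_toeplitz _ Hf))).
  by apply: bounded_op_comp; [apply: Kinf_bounded_op | apply: bounded_op_toeplitz].
by apply: Kinf_toeplitz_comp => //; apply: smooth_conj.
Qed.

Lemma Kinf_comp (c d : Op H) : KInf c -> KInf d -> KInf (op_comp c d).
Proof. by move=> Hc Hd; apply: Kinf_comp_l => // n; apply: derivable_n_Kinf. Qed.

Lemma deltaK_comp (a a' b b' : Op H) :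
  bounded_op a -> bounded_op a' -> bounded_op b -> bounded_op b' ->
  is_derivation a a' -> is_derivation b b' ->
  DeltaK (op_comp a b) = plus (op_comp a' b) (op_comp a b').
Proof.
move=> La La' Lb Lb' Da Db; apply: deltaK_eq.
- exact: bounded_op_comp.
- by apply: bounded_op_plus; apply: bounded_op_comp.
- exact: is_derivation_comp.
Qed.

(** * Norm estimates for products with a factor in K^infty *)

Lemma Knorm_toeplitz_comp (M N : nat) (f : R -> C) (d : Op H) : smooth_torus f -> KInf d ->
  KNorm M N (op_comp (Toep f) d) <= Clnorm M f * KNorm M N d.
Proof.
elim: M f d => [|M IH] f d Hf Hd.
  rewrite !Knorm_0 Clnorm_0; apply: Rle_trans (norm0_comp _ _ _ (bounded_op_toeplitz _ Hf) Hd) _.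
  by apply: Rmult_le_compat_r; [apply: norm0_ge0 | apply: op_norm_toeplitz].
have Hf' := smooth_Dtorus _ Hf; have Hd' := Kinf_deltaK _ Hd.
rewrite !Knorm_succ Clnorm_succ.
rewrite (deltaK_comp _ _ _ _ (bounded_op_toeplitz _ Hf) (bounded_op_toeplitz _ Hf')
  (Kinf_bounded_op _ Hd) (Kinf_bounded_op _ Hd') (is_derivation_toeplitz _ Hf)
  (is_derivation_deltaK _ Hd)).
have := Knorm_plus M N _ _ (Kinf_toeplitz_comp _ _ Hf' Hd) (Kinf_toeplitz_comp _ _ Hf Hd').
have := IH _ _ Hf Hd; have := IH _ _ Hf' Hd; have := IH _ _ Hf Hd'.
have := Rmult_le_pos _ _ (Clnorm_ge0 M _ Hf') (Knorm_ge0 M N _ Hd').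
move=> ? ? ? ? ?; lra.
Qed.

(* [c = (c (1 + K)^N) (1 + K)^{-N}] and the second factor is a contraction. *)
Lemma op_norm_le_norm0 (N : nat) (c : Op H) : KInf c -> op_norm c <= Norm0 N c.
Proof.
move=> Hc; have [d [Hd Ed]] := Kinf_weight N c Hc.
have [Lc Ld] := (Kinf_bounded_op _ Hc, Kinf_bounded_op _ Hd).
have P : forall l : nat, 1 <= (1 + INR l) ^ N.
  by move=> l; apply: pow_R1_Rle; have := pos_INR l; lra.
pose v l := scal (RtoC (/ (1 + INR l) ^ N)) (E l).
have [w [Lw [Ew [Nw _]]]] : exists a : Op H, bounded_op a /\ (forall k, a (E k) = v k) /\
    (forall x, norm (a x) <= norm x) /\
    (forall x, a x = hsum (fun k => scal (ip (E k) x) (v k))).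
  apply: orthogonal_contraction.
  - move=> k l Hkl; rewrite /v ip_scal_left ip_scal_right (onb_orth _ _ HE k l Hkl).
    by rewrite !Cmult_0_r.
  - move=> k; rewrite /v hnorm_scal norm_E Rmult_1_r Cmod_R Rabs_pos_eq.
      by rewrite -[X in _ <= X]Rinv_1; apply: Rinv_le_contravar; [lra | apply: P].
    by apply: Rlt_le; apply: Rinv_0_lt_compat; have := P k; lra.
have Ec : c = op_comp d w.
  apply: mat_ext => //; first exact: bounded_op_comp.
  move=> k l; rewrite /mat /op_comp Ew (bl_scal _ Ld) ip_scal_right -/(mat d k l) Ed.
  rewrite Cmult_assoc -RtoC_mult Rinv_l ?Cmult_1_l //.
  by have := P l; lra.
rewrite (norm0_eq N c d Lc Ld Ed) Ec.
apply: Rle_trans (op_norm_comp _ _ Ld Lw) _.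
rewrite -{2}(Rmult_1_r (op_norm d)); apply: Rmult_le_compat_l; first exact: op_norm_ge0.
by apply: op_norm_le; [lra | move=> x; rewrite Rmult_1_l].
Qed.

Lemma Knorm_comp (M N : nat) (c d : Op H) : KInf c -> KInf d ->
  KNorm M N (op_comp c d) <= KNorm M N c * KNorm M N d.
Proof.
elim: M c d => [|M IH] c d Hc Hd.
  rewrite !Knorm_0; apply: Rle_trans (norm0_comp _ _ _ (Kinf_bounded_op _ Hc) Hd) _.
  by apply: Rmult_le_compat_r; [apply: norm0_ge0 | apply: op_norm_le_norm0].
have Hc' := Kinf_deltaK _ Hc; have Hd' := Kinf_deltaK _ Hd.
rewrite !Knorm_succ (deltaK_comp _ _ _ _ (Kinf_bounded_op _ Hc) (Kinf_bounded_op _ Hc')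
  (Kinf_bounded_op _ Hd) (Kinf_bounded_op _ Hd') (is_derivation_deltaK _ Hc)
  (is_derivation_deltaK _ Hd)).
have := Knorm_plus M N _ _ (Kinf_comp _ _ Hc' Hd) (Kinf_comp _ _ Hc Hd').
have := IH _ _ Hc Hd; have := IH _ _ Hc' Hd; have := IH _ _ Hc Hd'.
have := Rmult_le_pos _ _ (Knorm_ge0 M N _ Hc') (Knorm_ge0 M N _ Hd').
move=> ? ? ? ? ?; lra.
Qed.

Lemma norm0_succ (N : nat) (c d : Op H) : KInf c -> KInf d ->
  (forall k l, mat d k l = Cmult (RtoC ((1 + INR l) ^ 1)) (mat c k l)) ->
  Norm0 (S N) c = Norm0 N d.
Proof.
move=> Hc Hd Ed; have [w [Hw Ew]] := Kinf_weight N d Hd.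
have [[Lc Ld] Lw] := (Kinf_bounded_op _ Hc, Kinf_bounded_op _ Hd, Kinf_bounded_op _ Hw).
rewrite (norm0_eq N d w) // (norm0_eq (S N) c w) //.
move=> k l; rewrite Ew Ed Cmult_assoc -RtoC_mult; congr (Cmult (RtoC _) _).
by rewrite /=; ring.
Qed.

Lemma norm0_mono_succ (N : nat) (c : Op H) : KInf c -> Norm0 N c <= Norm0 (S N) c.
Proof.
move=> Hc; have [d [Hd Ed]] := Kinf_weight N c Hc; have [w [Hw Ew]] := Kinf_weight 1 d Hd.
have [[Lc Ld] Lw] := (Kinf_bounded_op _ Hc, Kinf_bounded_op _ Hd, Kinf_bounded_op _ Hw).
rewrite (norm0_eq N c d) //; apply: Rle_trans (op_norm_le_norm0 1 d Hd) _.
right; rewrite (norm0_eq 1 d w) // (norm0_eq (S N) c w) //.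
move=> k l; rewrite Ew Ed Cmult_assoc -RtoC_mult; congr (Cmult (RtoC _) _).
by rewrite /=; ring.
Qed.

(* [T(g) (1 + K) = (1 + K) T(g) - T(Dg)], in abstract form. *)
Lemma mat_weight_comp (c d b b' : Op H) (k l : nat) : bounded_op c -> bounded_op d ->
  (forall k l, mat d k l = Cmult (RtoC ((1 + INR l) ^ 1)) (mat c k l)) ->
  is_derivation b b' ->
  mat (plus (op_comp d b) (scal (RtoC (-1)) (op_comp c b'))) k l =
  Cmult (RtoC ((1 + INR l) ^ 1)) (mat (op_comp c b) k l).
Proof.
move=> Lc Ld Ed Db; rewrite mat_plus mat_scal.
have L := nlim_plus _ _ _ _ (mat_comp d b k l Ld)
   (nlim_scal (RtoC (-1)) _ _ (mat_comp c b' k l Lc)).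
apply: nlim_unique L _.
have L' := nlim_scal (RtoC ((1 + INR l) ^ 1)) _ _ (mat_comp c b k l Lc).
apply: nlim_ext L' => n.
rewrite -[plus _ _]/(Cplus _ _) -![scal _ _]/(Cmult _ _) -!csum_scal.
rewrite -[Cplus _ _](sum_n_plus (G := C_AbelianMonoid)); apply: csum_ext => j.
rewrite Ed (Db j l) -[plus _ _]/(Cplus _ _) RtoC_m1.
by rewrite !pow_1 RtoC_minus !RtoC_plus; ring.
Qed.

(** One factor 1 + K at a time is moved to the left of T(g) and absorbed by c; each move adds a term
    with D g, and the two terms follow the recursion of [Clnorm]. *)
Lemma norm0_comp_toeplitz (N : nat) (c : Op H) (g : R -> C) : smooth_torus g -> KInf c ->
  Norm0 N (op_comp c (Toep g)) <= Norm0 N c * Clnorm N g.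
Proof.
elim: N c g => [|N IH] c g Hg Hc.
  have Lg := bounded_op_toeplitz _ Hg; have Lc := Kinf_bounded_op _ Hc.
  have m1 : forall (a : Op H) k l, mat a k l = Cmult (RtoC ((1 + INR l) ^ 0)) (mat a k l).
    by move=> a k l; rewrite /= Cmult_1_l.
  have Lcg := bounded_op_comp _ _ Lc Lg.
  rewrite (norm0_eq 0 _ _ Lcg Lcg (m1 _)) (norm0_eq 0 _ _ Lc Lc (m1 _)) Clnorm_0.
  apply: Rle_trans (op_norm_comp _ _ Lc Lg) _.
  by apply: Rmult_le_compat_l; [apply: op_norm_ge0 | apply: op_norm_toeplitz].
have Hg' := smooth_Dtorus _ Hg.
have [d [Hd Ed]] := Kinf_weight 1 c Hc.
have Lg := bounded_op_toeplitz _ Hg; have Lg' := bounded_op_toeplitz _ Hg'.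
have [Lc Ld] := (Kinf_bounded_op _ Hc, Kinf_bounded_op _ Hd).
have Hcg' := Kinf_comp_toeplitz _ _ Hg' Hc; have Hdg := Kinf_comp_toeplitz _ _ Hg Hd.
have Hm := Kinf_scal (RtoC (-1)) _ Hcg'.
rewrite (norm0_succ N _ (plus (op_comp d (Toep g))
    (scal (RtoC (-1)) (op_comp c (Toep (Dtorus g)))))).
- apply: Rle_trans (norm0_plus N _ _ Hdg Hm) _.
  rewrite norm0_scal // Cmod_R Rabs_left; last lra.
  rewrite Clnorm_succ (norm0_succ N c d Hc Hd Ed).
  have := IH _ _ Hg Hd; have := IH _ _ Hg' Hc; have := norm0_mono_succ N c Hc.
  rewrite (norm0_succ N c d Hc Hd Ed) => H1 H2 H3.
  have := Rmult_le_compat_r _ _ _ (Clnorm_ge0 N _ Hg') H1; lra.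
- exact: Kinf_comp_toeplitz.
- exact: Kinf_plus.
- by move=> k l; apply: mat_weight_comp => //; apply: is_derivation_toeplitz.
Qed.

Lemma Knorm_comp_toeplitz (M N : nat) (c : Op H) (g : R -> C) : smooth_torus g -> KInf c ->
  KNorm M N (op_comp c (Toep g)) <= KNorm M N c * Clnorm (M + N) g.
Proof.
elim: M c g => [|M IH] c g Hg Hc; first by rewrite !Knorm_0; apply: norm0_comp_toeplitz.
have Hg' := smooth_Dtorus _ Hg; have Hc' := Kinf_deltaK _ Hc.
rewrite !Knorm_succ Clnorm_succ -/(Nat.add M N).
rewrite (deltaK_comp _ _ _ _ (Kinf_bounded_op _ Hc) (Kinf_bounded_op _ Hc')
  (bounded_op_toeplitz _ Hg) (bounded_op_toeplitz _ Hg')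
  (is_derivation_deltaK _ Hc) (is_derivation_toeplitz _ Hg)).
have := Knorm_plus M N _ _ (Kinf_comp_toeplitz _ _ Hg Hc') (Kinf_comp_toeplitz _ _ Hg' Hc).
have := IH _ _ Hg Hc; have := IH _ _ Hg Hc'; have := IH _ _ Hg' Hc.
have := Rmult_le_pos _ _ (Knorm_ge0 M N _ Hc') (Clnorm_ge0 (M + N) _ Hg').
move=> ? ? ? ? ?; lra.
Qed.

(** * The semicommutator *)

Definition semicommutator (f g : R -> C) : Op H :=
  plus (op_comp (Toep f) (Toep g))
       (scal (RtoC (-1)) (Toep (fun t => Cmult (f t) (g t)))).

Lemma bounded_op_semicommutator (f g : R -> C) : smooth_torus f -> smooth_torus g ->
  bounded_op (semicommutator f g).
Proof.
move=> Hf Hg; apply: bounded_op_plus.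
  by apply: bounded_op_comp; apply: bounded_op_toeplitz.
by apply: bounded_op_scal; apply: bounded_op_toeplitz; apply: smooth_mult.
Qed.

Lemma mat_comp_minus (a b t : Op H) (k l : nat) (F G r : nat -> C) : bounded_op a ->
  (forall j, mat a k j = F j) -> (forall j, mat b j l = G j) ->
  climit (fun J => sum_n (fun j => Cplus (Cmult (F j) (G j)) (r j)) J) (mat t k l) ->
  climit (fun J => sum_n (fun j => Copp (r j)) J)
    (mat (plus (op_comp a b) (scal (RtoC (-1)) t)) k l).
Proof.
move=> La EF EG L2; rewrite mat_plus mat_scal.
have L := nlim_plus _ _ _ _ (mat_comp a b k l La) (nlim_scal (RtoC (-1)) _ _ L2).
apply: nlim_ext L => J.
rewrite -[scal _ _]/(Cmult _ _) -csum_scal -sum_n_plus; apply: csum_ext => j.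
rewrite EF EG -[plus _ _]/(Cplus _ _) RtoC_m1; ring.
Qed.

Lemma mat_semicommutator (f g : R -> C) (k l : nat) : smooth_torus f -> smooth_torus g ->
  climit (fun J => sum_n (fun j => Copp
    (Cmult (fourier f (Z.of_nat k + Z.of_nat (S j))) (fourier g (- Z.of_nat (S j) - Z.of_nat l)))) J)
    (mat (semicommutator f g) k l).
Proof.
move=> Hf Hg.
apply: (mat_comp_minus _ _ _ k l (fun j => fourier f (Z.of_nat k - Z.of_nat j))
  (fun j => fourier g (Z.of_nat j - Z.of_nat l))).
- exact: bounded_op_toeplitz.
- by move=> j; apply: mat_toeplitz.
- by move=> j; apply: mat_toeplitz.
- rewrite (mat_toeplitz _ k l (smooth_mult _ _ Hf Hg)).
  exact: fourier_convolution.
Qed.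

(** Here 1 + |n| = 2 + j + l: N of the N + 2 powers dominate the weight (1 + l)^N, the last two give
    a summable factor in j. This is the origin of the 2 in the order M + N + 2. *)
Lemma fourier_decay_shift (g : R -> C) (N j l : nat) : smooth_torus g ->
  (1 + INR l) ^ N * Cmod (fourier g (- Z.of_nat (S j) - Z.of_nat l)) <=
  Clnorm (N + 2) g * / (2 + INR j) ^ 2.
Proof.
move=> Hg; have [Pl Pj] := (pos_INR l, pos_INR j).
have D := fourier_decay g (N + 2) (- Z.of_nat (S j) - Z.of_nat l) Hg.
have Ea : Rabs (IZR (- Z.of_nat (S j) - Z.of_nat l)) = 1 + INR j + INR l.
  rewrite minus_IZR opp_IZR -!INR_IZR_INZ S_INR Rabs_left1; lra.
rewrite Ea pow_add in D.
have P2 : 0 < (2 + INR j) ^ 2 by apply: pow_lt; lra.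
apply/(Rle_div_r _ _ _ P2); apply: Rle_trans D.
rewrite Rmult_assoc (Rmult_comm (Cmod _)) -Rmult_assoc.
apply: Rmult_le_compat_r; first exact: Cmod_ge_0.
apply: Rmult_le_compat; try (by apply: pow_le; lra); apply: pow_incr; lra.
Qed.

(** Up to sign this is a product of two Hankel matrices: the frequencies k + j + 1 of f and -(j + 1
    + l) of g grow in modulus with k and l, so f gives the decay in k and g the decay in l. *)
Lemma Kinf_semicommutator (f g : R -> C) : smooth_torus f -> smooth_torus g ->
  KInf (semicommutator f g).
Proof.
move=> Hf Hg; apply/Kinf_iff; split; first exact: bounded_op_semicommutator.
move=> M N; exists (Clnorm M f * Clnorm (N + 2) g) => k l.
have [Pk Pl] := (pos_INR k, pos_INR l).
have PkM : 0 <= (1 + INR k) ^ M by apply: pow_le; lra.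
have PlN : 0 <= (1 + INR l) ^ N by apply: pow_le; lra.
have L := nlim_scal (RtoC ((1 + INR k) ^ M * (1 + INR l) ^ N)) _ _ (mat_semicommutator f g k l Hf Hg).
have -> : (1 + INR k) ^ M * (1 + INR l) ^ N * Cmod (mat (semicommutator f g) k l) =
  norm (scal (RtoC ((1 + INR k) ^ M * (1 + INR l) ^ N)) (mat (semicommutator f g) k l) : C_NormedModule).
  rewrite -[norm _]/(Cmod _) -[scal _ _]/(Cmult _ _) Cmod_mult Cmod_R Rabs_pos_eq //.
  exact: Rmult_le_pos.
apply: (nlim_norm_le _ _ _ L) => J.
have F0 := Clnorm_ge0 M _ Hf; have G0 := Clnorm_ge0 (N + 2) _ Hg.
apply: Rle_trans (_ : sum_n (fun j => (Clnorm M f * Clnorm (N + 2) g) * / (2 + INR j) ^ 2) J <= _).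
  rewrite -(sum_n_scal_l (V := C_NormedModule)); apply: sum_n_norm_le => j.
  rewrite -[norm _]/(Cmod _) -[scal _ _]/(Cmult _ _) Cmod_mult Cmod_opp Cmod_mult Cmod_R Rabs_pos_eq;
    last exact: Rmult_le_pos.
  have D1 := fourier_decay f M (Z.of_nat k + Z.of_nat (S j)) Hf.
  have D2 := fourier_decay_shift g N j l Hg.
  have D3 : (1 + INR k) ^ M * Cmod (fourier f (Z.of_nat k + Z.of_nat (S j))) <= Clnorm M f.
    apply: Rle_trans D1; apply: Rmult_le_compat_r; first exact: Cmod_ge_0.
    apply: pow_incr; split; first lra.
    rewrite plus_IZR -!INR_IZR_INZ S_INR Rabs_pos_eq; have := pos_INR j; lra.
  have := Rmult_le_compat _ _ _ _ (Rmult_le_pos _ _ PkM (Cmod_ge_0 _))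
    (Rmult_le_pos _ _ PlN (Cmod_ge_0 _)) D3 D2.
  lra.
rewrite (sum_n_mult_l (K := R_Ring) (Clnorm M f * Clnorm (N + 2) g)) /mult /=.
rewrite -[X in _ <= X]Rmult_1_r; apply: Rmult_le_compat_l; first exact: Rmult_le_pos.
exact: sum_inv_sq_shift.
Qed.

Lemma nlim_sum {V : NormedModule C_AbsRing} (u : nat -> nat -> V) (s : nat -> V) (m : nat) :
  (forall k, nlim (u k) (s k)) -> nlim (fun J => sum_n (fun k => u k J) m) (sum_n s m).
Proof.
move=> Hu; elim: m => [|m IH].
  by rewrite sum_O; apply: nlim_ext (Hu 0%nat) => J; rewrite sum_O.
rewrite sum_Sn; apply: nlim_ext (nlim_plus _ _ _ _ IH (Hu (S m))) => J.
by rewrite sum_Sn.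
Qed.

Lemma sum_n_shift (u : nat -> C) (l J : nat) :
  sum_n (fun i => if Nat.leb l i then u (i - l)%nat else RtoC 0) (J + l) = sum_n u J.
Proof.
elim: J => [|J IH].
  rewrite Nat.add_0_l sum_O (sum_n_single _ l l) ?Nat.leb_refl ?Nat.sub_diag //.
  by move=> i Hi Hne; case: Nat.leb_spec => // ?; lia.
rewrite Nat.add_succ_l !sum_Sn IH.
case: Nat.leb_spec => ?; last lia.
by have -> : (S (J + l) - l = S J)%nat by lia.
Qed.

(* Summing along [n = j + l + 1] writes the semicommutator as
   [- sum_(n >= 1) g_{-n} T(f e_{-n}) Q_n], with [Q_n] the projection on
   [E 0, ..., E (n - 1)], which is what the norm estimate uses. *)
Lemma mat_semicommutator_diag (f g : R -> C) (k l : nat) : smooth_torus f -> smooth_torus g ->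
  climit (fun J => sum_n (fun i => if Nat.leb l i then Copp
    (Cmult (fourier f (Z.of_nat k - Z.of_nat l + Z.of_nat (S i))) (fourier g (- Z.of_nat (S i))))
    else RtoC 0) J)
    (mat (semicommutator f g) k l).
Proof.
move=> Hf Hg; have L := mat_semicommutator f g k l Hf Hg.
apply/(is_lim_seq_incr_n _ l).
apply: is_lim_seq_ext L => J; congr (norm (minus _ _)).
rewrite -(sum_n_shift _ l J); apply: csum_ext => i; case: Nat.leb_spec => Hi; last reflexivity.
have -> : (Z.of_nat k + Z.of_nat (S (i - l)) = Z.of_nat k - Z.of_nat l + Z.of_nat (S i))%Z by lia.
have -> : (- Z.of_nat (S (i - l)) - Z.of_nat l = - Z.of_nat (S i))%Z by lia.
reflexivity.
Qed.

Lemma norm0_semicommutator (N : nat) (f g : R -> C) : smooth_torus f -> smooth_torus g ->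
  Norm0 N (semicommutator f g) <= supnorm f * Clnorm (N + 2) g.
Proof.
move=> Hf Hg; have [d [Hd Ed]] := Kinf_weight N _ (Kinf_semicommutator f g Hf Hg).
have Ld := Kinf_bounded_op _ Hd.
have F0 := supnorm_ge0 _ Hf; have G0 := Clnorm_ge0 (N + 2) _ Hg.
rewrite (norm0_eq N _ d (bounded_op_semicommutator f g Hf Hg) Ld Ed).
apply: norm_le_of_form => //; first exact: Rmult_le_pos.
move=> m x y.
set Q := (_ / 2).
have Q0 : 0 <= Q.
  rewrite /Q; apply: Rdiv_le_0_compat; last lra.
  by apply: Rplus_le_le_0_compat; apply: sum_n_nonneg => k; apply: pow2_ge_0.
(* On the range l <= i of the projection, (1 + l)^N is split into (1 + i)^N, put on the coefficient
   of g in [w], and a ratio at most 1 left on the vector. So X i is entrywise no larger than x, and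
   [form i] is the form of T(f e_(-n)) with n = i + 1. *)
pose X i l := if Nat.leb l i then Cmult (RtoC (((1 + INR l) / (1 + INR i)) ^ N)) (x l) else RtoC 0.
pose w i := Copp (Cmult (RtoC ((1 + INR i) ^ N)) (fourier g (- Z.of_nat (S i)))).
pose form i := sum_n (fun k => sum_n (fun l => Cmult (Cconj (y k))
   (Cmult (fourier f (Z.of_nat k - Z.of_nat l + Z.of_nat (S i))) (X i l))) m) m.
have L : climit (fun J => sum_n (fun i => Cmult (w i) (form i)) J)
   (sum_n (fun k => sum_n (fun l => Cmult (Cconj (y k)) (Cmult (mat d k l) (x l))) m) m).
  pose t k l i := if Nat.leb l i then Copp
    (Cmult (fourier f (Z.of_nat k - Z.of_nat l + Z.of_nat (S i))) (fourier g (- Z.of_nat (S i))))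
    else RtoC 0.
  pose b k l := Cmult (Cconj (y k)) (Cmult (RtoC ((1 + INR l) ^ N)) (x l)).
  (* The vectors have finitely many coordinates, so the entrywise limit passes through the double
     sum, and the sum over i can then be pulled outside. *)
  have L0 : climit (fun J => sum_n (fun k => sum_n (fun l =>
      Cmult (b k l) (sum_n (t k l) J)) m) m)
     (sum_n (fun k => sum_n (fun l => Cmult (Cconj (y k)) (Cmult (mat d k l) (x l))) m) m).
    apply: (nlim_sum (V := C_NormedModule) (fun k J => sum_n (fun l => Cmult (b k l) (sum_n (t k l) J)) m)) => k.
    apply: (nlim_sum (V := C_NormedModule) (fun l J => Cmult (b k l) (sum_n (t k l) J))) => l.
    have -> : Cmult (Cconj (y k)) (Cmult (mat d k l) (x l)) = Cmult (b k l) (mat (semicommutator f g) k l).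
      by rewrite Ed /b; ring.
    exact: (nlim_scal (V := C_NormedModule) (b k l) _ _ (mat_semicommutator_diag f g k l Hf Hg)).
  apply: nlim_ext L0 => J.
  transitivity (sum_n (fun k => sum_n (fun l => sum_n (fun i => Cmult (b k l) (t k l i)) J) m) m).
    by apply: csum_ext => k; apply: csum_ext => l; rewrite csum_scal.
  transitivity (sum_n (fun k => sum_n (fun i => sum_n (fun l => Cmult (b k l) (t k l i)) m) J) m).
    by apply: csum_ext => k; rewrite (sum_n_switch (G := C_AbelianMonoid)).
  rewrite (sum_n_switch (G := C_AbelianMonoid)); apply: csum_ext => i.
  rewrite /form -csum_scal; apply: csum_ext => k; rewrite -csum_scal; apply: csum_ext => l.
  rewrite /b /t /w /X; case: Nat.leb_spec => Hl; last by ring.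
  have Pi : 0 < (1 + INR i) ^ N by apply: pow_lt; have := pos_INR i; lra.
  have -> : RtoC ((1 + INR l) ^ N) = Cmult (RtoC ((1 + INR i) ^ N)) (RtoC (((1 + INR l) / (1 + INR i)) ^ N)).
    rewrite -RtoC_mult -Rpow_mult_distr; congr (RtoC (_ ^ N)); field.
    by have := pos_INR i; lra.
  by ring.
apply: (nlim_norm_le _ _ _ L) => J.
apply: Rle_trans (_ : sum_n (fun i => (supnorm f * Clnorm (N + 2) g * Q) * / (2 + INR i) ^ 2) J <= _).
  apply: sum_n_norm_le => i; rewrite -[norm _]/(Cmod _) Cmod_mult.
  have Pi := pos_INR i.
  have B1 : Cmod (form i) <= supnorm f * Q.
    have := toeplitz_form_bound f (supnorm f) m (Z.of_nat (S i)) (X i) y (smooth_ccont _ Hf)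
      (fun t => supnorm_ub f t Hf).
    move=> H1; apply: Rle_trans H1 _; apply: Rmult_le_compat_l => //.
    rewrite /Q; apply: Rmult_le_compat_r; first lra.
    apply: Rplus_le_compat_r; apply: sum_n_le => l _.
    apply: pow_incr; split; first exact: Cmod_ge_0.
    rewrite /X; case: Nat.leb_spec => Hl; last by rewrite Cmod_0; apply: Cmod_ge_0.
    have [Pl Hli] := (pos_INR l, le_INR _ _ Hl).
    have Hq : 0 <= (1 + INR l) / (1 + INR i) <= 1.
      split; first by apply: Rdiv_le_0_compat; lra.
      by apply/Rle_div_l; lra.
    rewrite Cmod_mult Cmod_R Rabs_pos_eq; last by apply: pow_le; lra.
    rewrite -[X in _ <= X]Rmult_1_l; apply: Rmult_le_compat_r; first exact: Cmod_ge_0.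
    by rewrite -[X in _ <= X](pow1 N); apply: pow_incr.
  have B2 : Cmod (w i) <= Clnorm (N + 2) g * / (2 + INR i) ^ 2.
    rewrite Cmod_opp Cmod_mult Cmod_R Rabs_pos_eq; last by apply: pow_le; lra.
    have D := fourier_decay g (N + 2) (- Z.of_nat (S i)) Hg.
    have Ea : Rabs (IZR (- Z.of_nat (S i))) = 1 + INR i.
      rewrite opp_IZR -INR_IZR_INZ S_INR Rabs_left1; lra.
    rewrite Ea pow_add in D.
    have P2 : 0 < (2 + INR i) ^ 2 by apply: pow_lt; lra.
    apply/(Rle_div_r _ _ _ P2); apply: Rle_trans D.
    rewrite Rmult_assoc (Rmult_comm (Cmod _)) -Rmult_assoc.
    apply: Rmult_le_compat_r; first exact: Cmod_ge_0.
    apply: Rmult_le_compat; try (by apply: pow_le; lra); apply: pow_incr; lra.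
  have := Rmult_le_compat _ _ _ _ (Cmod_ge_0 _) (Cmod_ge_0 _) B2 B1; lra.
rewrite (sum_n_mult_l (K := R_Ring) (supnorm f * Clnorm (N + 2) g * Q)) /mult /=.
rewrite -[X in _ <= X]Rmult_1_r; apply: Rmult_le_compat_l; last exact: sum_inv_sq_shift.
by apply: Rmult_le_pos => //; apply: Rmult_le_pos.
Qed.

Lemma is_derivation_combination (c : C) (a a1 a2 b b1 b2 : Op H) :
  is_derivation a (plus a1 a2) -> is_derivation b (plus b1 b2) ->
  is_derivation (plus a (scal c b)) (plus (plus a1 (scal c b1)) (plus a2 (scal c b2))).
Proof.
move=> Da Db k l; have := Da k l; have := Db k l; rewrite !mat_plus !mat_scal => Eb Ea.
by rewrite Cmult_plus_distr_l -Ea (Cmult_comm c (mat b k l)) Cmult_assoc -Eb; ring.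
Qed.

Lemma is_derivation_semicommutator (f g : R -> C) : smooth_torus f -> smooth_torus g ->
  is_derivation (semicommutator f g)
    (plus (semicommutator (Dtorus f) g) (semicommutator f (Dtorus g))).
Proof.
move=> Hf Hg; have [Hf' Hg'] := (smooth_Dtorus _ Hf, smooth_Dtorus _ Hg).
apply: is_derivation_combination.
- by apply: is_derivation_comp; try exact: bounded_op_toeplitz; exact: is_derivation_toeplitz.
- have D := is_derivation_toeplitz _ (smooth_mult _ _ Hf Hg).
  rewrite (Dtorus_mult _ _ (smooth_cdiff _ Hf) (smooth_cdiff _ Hg)) in D.
  by rewrite (toeplitz_plus _ _ (smooth_mult _ _ Hf' Hg) (smooth_mult _ _ Hf Hg')) in D.
Qed.

Lemma Knorm_semicommutator (M N : nat) (f g : R -> C) : smooth_torus f -> smooth_torus g ->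
  KNorm M N (semicommutator f g) <= Clnorm M f * Clnorm (M + N + 2) g.
Proof.
elim: M f g => [|M IH] f g Hf Hg.
  by rewrite Knorm_0 Clnorm_0; apply: norm0_semicommutator.
have [Hf' Hg'] := (smooth_Dtorus _ Hf, smooth_Dtorus _ Hg).
have [K1 K2] := (Kinf_semicommutator _ _ Hf' Hg, Kinf_semicommutator _ _ Hf Hg').
have -> : (S M + N + 2 = S (M + N + 2))%nat by [].
rewrite Knorm_succ !Clnorm_succ.
rewrite (deltaK_eq _ _ (bounded_op_semicommutator _ _ Hf Hg)
  (Kinf_bounded_op _ (Kinf_plus _ _ K1 K2)) (is_derivation_semicommutator _ _ Hf Hg)).
have := Knorm_plus M N _ _ K1 K2.
have := IH _ _ Hf Hg; have := IH _ _ Hf' Hg; have := IH _ _ Hf Hg'.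
have := Rmult_le_pos _ _ (Clnorm_ge0 M _ Hf') (Clnorm_ge0 (M + N + 2) _ Hg').
move=> ? ? ? ? ?; lra.
Qed.

(** * The Toeplitz algebra *)

(** Along the diagonal k - l = n the entries of T(f) are constant, while those of an element of
    K^infty tend to 0. *)
Lemma toeplitz_decomposition_unique (f g : R -> C) (c d : Op H) :
  smooth_torus f -> smooth_torus g -> KInf c -> KInf d ->
  plus (Toep f) c = plus (Toep g) d -> f = g /\ c = d.
Proof.
move=> Hf Hg Hc Hd Eq.
have Em : forall k l, Cplus (fourier f (Z.of_nat k - Z.of_nat l)) (mat c k l) =
                      Cplus (fourier g (Z.of_nat k - Z.of_nat l)) (mat d k l).
  move=> k l.
  apply: (eq_trans (f_equal (fun z => Cplus z _) (eq_sym (mat_toeplitz _ k l Hf)))).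
  apply: (eq_trans _ (f_equal (fun z => Cplus z _) (mat_toeplitz _ k l Hg))).
  apply: (eq_trans (eq_sym (mat_plus _ _ k l))); apply: (eq_trans _ (mat_plus _ _ k l)).
  exact: (f_equal (fun a => mat a k l) Eq).
have Efg : f = g.
  apply: fourier_injective => // n.
  have [[_ Rc] [_ Rd]] := (proj1 (Kinf_iff c) Hc, proj1 (Kinf_iff d) Hd).
  have [[B1 HB1] [B2 HB2]] := (Rc 1%nat 0%nat, Rd 1%nat 0%nat).
  set h := Cmod (Cminus (fourier f n) (fourier g n)).
  have Hh : forall j : nat, (1 + INR j) * h <= B1 + B2.
    (* [Z.to_nat] is 0 on negative integers, so k - l = n for either sign of n. *)
    move=> j; pose k := (j + Z.to_nat n)%nat; pose l := (j + Z.to_nat (- n))%nat.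
    have En : (Z.of_nat k - Z.of_nat l)%Z = n by lia.
    have := Em k l; rewrite En => E1.
    have -> : h = Cmod (Cplus (mat d k l) (Copp (mat c k l))).
      rewrite /h; congr Cmod.
      have -> : fourier f n = Cminus (Cplus (fourier g n) (mat d k l)) (mat c k l).
        by rewrite -E1; ring.
      by ring.
    have Hk : 1 + INR j <= 1 + INR k.
      by apply: Rplus_le_compat_l; apply: le_INR; lia.
    have T := Cmod_triangle (mat d k l) (Copp (mat c k l)); rewrite Cmod_opp in T.
    have Pj := pos_INR j.
    have := HB1 k l; have := HB2 k l; rewrite /= !Rmult_1_r => H2 H1.
    have P := Cmod_ge_0 (Cplus (mat d k l) (Copp (mat c k l))).
    nra.
  have h0 : 0 <= h by apply: Cmod_ge_0.
  have hz : h = 0.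
    have [->//|Hne] := Req_dec h 0.
    have Ph : 0 < h by lra.
    have [j Hj] := INR_unbounded ((B1 + B2) / h).
    have := Hh j; have : (B1 + B2) / h * h = B1 + B2 by field.
    nra.
  have := Cmod_eq_0 _ hz => E0.
  have -> : fourier f n = Cplus (Cminus (fourier f n) (fourier g n)) (fourier g n) by ring.
  by rewrite E0 Cplus_0_l.
split=> //; apply: (mat_ext c d); try exact: Kinf_bounded_op.
move=> k l; have := Em k l; rewrite Efg => E1.
have -> : mat c k l = Cminus (Cplus (fourier g (Z.of_nat k - Z.of_nat l)) (mat c k l))
   (fourier g (Z.of_nat k - Z.of_nat l)) by ring.
by rewrite E1; ring.
Qed.

Lemma Tnorm_decomposition (s : R) (M N : nat) (f : R -> C) (c : Op H) :
  smooth_torus f -> KInf c ->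
  TNorm s M N (plus (Toep f) c) = s * Clnorm (M + N + 2) f + KNorm M N c.
Proof.
move=> Hf Hc; apply: (iota_unique (V := R_CompleteNormedModule)).
- move=> r [g [d [Hg [Hd [Eq ->]]]]].
  by have [-> ->] := toeplitz_decomposition_unique _ _ _ _ Hf Hg Hc Hd Eq.
- by exists f, c.
Qed.

Lemma Tinf_decomposition (f : R -> C) (c : Op H) : smooth_torus f -> KInf c ->
  TInf (plus (Toep f) c).
Proof. by move=> Hf Hc; exists f, c. Qed.

Lemma Tinf_bounded_op (a : Op H) : TInf a -> bounded_op a.
Proof.
move=> [f [c [Hf [Hc ->]]]]; apply: bounded_op_plus.
  exact: bounded_op_toeplitz.
exact: Kinf_bounded_op.
Qed.

Lemma plus_exchange {G : AbelianMonoid} (a b c d : G) :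
  plus (plus a b) (plus c d) = plus (plus a c) (plus b d).
Proof.
by rewrite -!plus_assoc; congr plus; rewrite !plus_assoc; congr plus; apply: plus_comm.
Qed.

Lemma decomposition_plus (f g : R -> C) (c d : Op H) : smooth_torus f -> smooth_torus g ->
  plus (plus (Toep f) c) (plus (Toep g) d) =
  plus (Toep (fun t => Cplus (f t) (g t))) (plus c d).
Proof.
by move=> Hf Hg; rewrite plus_exchange toeplitz_plus.
Qed.

Lemma decomposition_scal (k : C) (f : R -> C) (c : Op H) : smooth_torus f ->
  scal k (plus (Toep f) c) =
  plus (Toep (fun t => Cmult k (f t))) (scal k c).
Proof.
move=> Hf; rewrite toeplitz_scal //.
exact: (scal_distr_l (V := op_ModuleSpace H)).
Qed.

Lemma comp_expansion (a b c d t : Op H) : bounded_op a -> bounded_op c ->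
  op_comp (plus a c) (plus b d) =
  plus t (plus (plus (op_comp a b) (scal (RtoC (-1)) t))
    (plus (op_comp a d) (plus (op_comp c b) (op_comp c d)))).
Proof.
move=> La Lc; apply: funext => x.
change (plus (a (plus (b x) (d x))) (c (plus (b x) (d x))) =
  plus (t x) (plus (plus (a (b x)) (scal (RtoC (-1)) (t x)))
    (plus (a (d x)) (plus (c (b x)) (c (d x)))))).
rewrite (bl_plus _ La) (bl_plus _ Lc) scal_m1 (plus_comm (a (b x)) (opp (t x))).
by rewrite !plus_assoc plus_opp_r plus_zero_l.
Qed.

Definition remainder (f g : R -> C) (c d : Op H) : Op H :=
  plus (semicommutator f g)
    (plus (op_comp (Toep f) d) (plus (op_comp c (Toep g)) (op_comp c d))).

Lemma decomposition_comp (f g : R -> C) (c d : Op H) :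
  smooth_torus f -> smooth_torus g -> KInf c -> KInf d ->
  op_comp (plus (Toep f) c) (plus (Toep g) d) =
  plus (Toep (fun t => Cmult (f t) (g t))) (remainder f g c d).
Proof.
move=> Hf Hg Hc Hd; apply: comp_expansion.
  exact: bounded_op_toeplitz.
exact: Kinf_bounded_op.
Qed.

Lemma Kinf_remainder (f g : R -> C) (c d : Op H) :
  smooth_torus f -> smooth_torus g -> KInf c -> KInf d ->
  KInf (remainder f g c d).
Proof.
move=> Hf Hg Hc Hd; apply: Kinf_plus; first exact: Kinf_semicommutator.
apply: Kinf_plus; first exact: Kinf_toeplitz_comp.
by apply: Kinf_plus; [apply: Kinf_comp_toeplitz | apply: Kinf_comp].
Qed.

(** The four estimates use orders M, M + N and M + N + 2; only the semicommutator requires the last,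
    to which the others are raised so that all terms match [Tnorm]. *)
Lemma Knorm_remainder (M N : nat) (f g : R -> C) (c d : Op H) :
  smooth_torus f -> smooth_torus g -> KInf c -> KInf d ->
  KNorm M N (remainder f g c d) <=
  Clnorm (M + N + 2) f * Clnorm (M + N + 2) g + Clnorm (M + N + 2) f * KNorm M N d +
  KNorm M N c * Clnorm (M + N + 2) g + KNorm M N c * KNorm M N d.
Proof.
move=> Hf Hg Hc Hd.
have H1 := Kinf_semicommutator _ _ Hf Hg; have H2 := Kinf_toeplitz_comp _ _ Hf Hd.
have H3 := Kinf_comp_toeplitz _ _ Hg Hc; have H4 := Kinf_comp _ _ Hc Hd.
have T1 := Knorm_plus M N _ _ H1 (Kinf_plus _ _ H2 (Kinf_plus _ _ H3 H4)).
have T2 := Knorm_plus M N _ _ H2 (Kinf_plus _ _ H3 H4).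
have T3 := Knorm_plus M N _ _ H3 H4.
have B1 := Knorm_semicommutator M N _ _ Hf Hg.
have B2 := Knorm_toeplitz_comp M N _ _ Hf Hd.
have B3 := Knorm_comp_toeplitz M N _ _ Hg Hc.
have B4 := Knorm_comp M N _ _ Hc Hd.
have F := Clnorm_mono M (M + N + 2) f Hf ltac:(lia).
have G := Clnorm_mono (M + N) (M + N + 2) g Hg ltac:(lia).
have P1 := Rmult_le_compat_r _ _ _ (Clnorm_ge0 (M + N + 2) _ Hg) F.
have P2 := Rmult_le_compat_r _ _ _ (Knorm_ge0 M N _ Hd) F.
have P3 := Rmult_le_compat_l _ _ _ (Knorm_ge0 M N _ Hc) G.
rewrite /remainder; lra.
Qed.

Lemma Tinf_zero : TInf zero.
Proof.
have -> : (zero : Op H) = plus (Toep (fun _ => RtoC 0)) zero.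
  by rewrite toeplitz_zero plus_zero_l.
by apply: Tinf_decomposition; [apply: smooth_const | apply: Kinf_zero].
Qed.

Lemma Tinf_plus (a b : Op H) : TInf a -> TInf b -> TInf (plus a b).
Proof.
move=> [f [c [Hf [Hc ->]]]] [g [d [Hg [Hd ->]]]]; rewrite decomposition_plus //.
by apply: Tinf_decomposition; [apply: smooth_plus | apply: Kinf_plus].
Qed.

Lemma Tinf_scal (k : C) (a : Op H) : TInf a -> TInf (scal k a).
Proof.
move=> [f [c [Hf [Hc ->]]]]; rewrite decomposition_scal //.
by apply: Tinf_decomposition; [apply: smooth_scal | apply: Kinf_scal].
Qed.

Lemma Tinf_minus (a b : Op H) : TInf a -> TInf b -> TInf (minus a b).
Proof. by move=> Ha Hb; rewrite op_minus_scal; apply: Tinf_plus => //; apply: Tinf_scal. Qed.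

Lemma Tinf_comp (a b : Op H) : TInf a -> TInf b -> TInf (op_comp a b).
Proof.
move=> [f [c [Hf [Hc ->]]]] [g [d [Hg [Hd ->]]]]; rewrite decomposition_comp //.
by apply: Tinf_decomposition; [apply: smooth_mult | apply: Kinf_remainder].
Qed.

Lemma Tinf_adjoint (a : Op H) : TInf a -> exists b, TInf b /\ is_adjoint a b.
Proof.
move=> [f [c [Hf [Hc ->]]]]; have [d [Hd Acd]] := Kinf_adjoint c Hc.
exists (plus (Toep (fun t => Cconj (f t))) d); split.
  by apply: Tinf_decomposition => //; apply: smooth_conj.
by apply: is_adjoint_plus => //; apply: is_adjoint_toeplitz.
Qed.

Lemma Tinf_is_adjoint (a : Op H) : TInf a -> is_adjoint a (adj ip a).
Proof. by move=> /Tinf_adjoint [b [_ Hab]]; rewrite (adj_eq _ _ Hab). Qed.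

Lemma Tinf_adj (a : Op H) : TInf a -> TInf (adj ip a).
Proof. by move=> /Tinf_adjoint [b [Hb Hab]]; rewrite (adj_eq _ _ Hab). Qed.

Lemma Tinf_star_algebra : is_star_algebra TInf op_comp (adj ip).
Proof.
split.
- exact: Tinf_zero.
- exact: Tinf_plus.
- exact: Tinf_scal.
- exact: Tinf_comp.
- exact: Tinf_adj.
- by [].
- by [].
- move=> a b c Ha Hb Hc; apply: funext => x.
  exact: (bl_plus _ (Tinf_bounded_op _ Ha)).
- by [].
- move=> k a b Ha Hb; apply: funext => x.
  exact: (bl_scal _ (Tinf_bounded_op _ Ha)).
- move=> a b Ha Hb; apply: adj_eq.
  by apply: is_adjoint_plus; apply: Tinf_is_adjoint.
- by move=> k a Ha; apply: adj_eq; apply: is_adjoint_scal; apply: Tinf_is_adjoint.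
- by move=> a b Ha Hb; apply: adj_eq; apply: is_adjoint_comp; apply: Tinf_is_adjoint.
- by move=> a Ha; apply: adj_eq; apply: is_adjoint_sym; apply: Tinf_is_adjoint.
Qed.

(** * Monotonicity, adjoints and completeness for the norms of K^infty *)

Lemma norm0_mono (N N' : nat) (c : Op H) : KInf c -> (N <= N')%nat ->
  Norm0 N c <= Norm0 N' c.
Proof.
move=> Hc; elim=> [|m _ IH]; first lra.
by apply: Rle_trans IH _; apply: norm0_mono_succ.
Qed.

Lemma Knorm_mono (M M' N N' : nat) (c : Op H) : KInf c -> (M <= M')%nat -> (N <= N')%nat ->
  KNorm M N c <= KNorm M' N' c.
Proof.
move=> Hc HM HN; apply: Rle_trans (Knorm_mono_l M M' N' c Hc HM).
elim: M c Hc {HM} => [|M IH] c Hc; first by rewrite !Knorm_0; apply: norm0_mono.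
by rewrite !Knorm_succ; apply: Rplus_le_compat; apply: IH => //; apply: Kinf_deltaK.
Qed.

(** The adjoint moves the weight to the other side. The weighted entries are symmetric in this
    respect, and the passage through them raises the indices, which is harmless for continuity. *)
Lemma Knorm_adjoint (M N : nat) (c d : Op H) : KInf c -> KInf d -> is_adjoint c d ->
  KNorm M N d <= 2 ^ M * 4 * KNorm (M + N + 2) (M + N + 2 + (M + 2)) c.
Proof.
move=> Hc Hd Acd; rewrite Rmult_assoc; apply: Knorm_le_mat => // k l.
rewrite (is_adjoint_mat _ _ k l Acd) Cmod_conj (Rmult_comm (_ ^ (M + 2))).
exact: mat_le_Knorm.
Qed.

Lemma C_complete (u : nat -> C) :
  (forall eps : posreal, exists N : nat, forall n m, (N <= n)%nat -> (N <= m)%nat ->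
     Cmod (Cminus (u n) (u m)) < eps) ->
  climit u
    (real (Lim_seq (fun n => fst (u n))), real (Lim_seq (fun n => snd (u n)))).
Proof.
move=> HC.
have L1 : ex_finite_lim_seq (fun n => fst (u n)).
  apply/ex_lim_seq_cauchy_corr => eps; have [N HN] := HC eps; exists N => n m Hn Hm.
  apply: Rle_lt_trans (HN n m Hn Hm).
  exact: Rle_trans (Rmax_l _ _) (Rmax_Cmod (Cminus (u n) (u m))).
have L2 : ex_finite_lim_seq (fun n => snd (u n)).
  apply/ex_lim_seq_cauchy_corr => eps; have [N HN] := HC eps; exists N => n m Hn Hm.
  apply: Rle_lt_trans (HN n m Hn Hm).
  exact: Rle_trans (Rmax_r _ _) (Rmax_Cmod (Cminus (u n) (u m))).
have [l1 Hl1] := L1; have [l2 Hl2] := L2.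
rewrite (is_lim_seq_unique _ _ Hl1) (is_lim_seq_unique _ _ Hl2) /=.
apply/nlim_filterlim.
move=> Q [eps HQ].
have [N1 HN1] := Hl1 _ (locally_ball l1 eps); have [N2 HN2] := Hl2 _ (locally_ball l2 eps).
by exists (max N1 N2) => n Hn; apply: HQ; split; [apply: HN1 | apply: HN2]; lia.
Qed.

(** [mat_le_Knorm] makes the entries Cauchy for every weighted supremum, so their limit decays
    rapidly; [Knorm_le_mat] turns convergence of the entries back into convergence in norm. *)
Lemma Kinf_complete (c : nat -> Op H) : (forall n, KInf (c n)) ->
  (forall M N (eps : posreal), exists n0 : nat, forall n m, (n0 <= n)%nat -> (n0 <= m)%nat ->
     KNorm M N (minus (c n) (c m)) < eps) ->
  exists d, KInf d /\ forall M N (eps : posreal), exists n0 : nat, forall n, (n0 <= n)%nat ->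
     KNorm M N (minus (c n) d) < eps.
Proof.
move=> Hc HC.
have Hs : forall n m, KInf (minus (c n) (c m)) by move=> n m; apply: Kinf_minus.
have Ms : forall a b k l, mat (minus a b) k l = Cminus (mat a k l) (mat b k l).
  by move=> a b k l; rewrite op_minus_scal mat_plus mat_scal RtoC_m1; ring.
pose m k l : C := (real (Lim_seq (fun n => fst (mat (c n) k l))), real (Lim_seq (fun n => snd (mat (c n) k l)))).
have Lm : forall k l, climit (fun n => mat (c n) k l) (m k l).
  move=> k l; apply: C_complete => eps; have [n0 Hn0] := HC 0%nat 0%nat eps.
  exists n0 => n n' Hn Hn'; apply: Rle_lt_trans (Hn0 n n' Hn Hn').
  by have := mat_le_Knorm 0 0 k l _ (Hs n n'); rewrite Ms !pow_O !Rmult_1_l.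
have W : forall M N (eps : posreal), exists n0 : nat, forall n k l, (n0 <= n)%nat ->
    (1 + INR k) ^ M * (1 + INR l) ^ N * Cmod (Cminus (mat (c n) k l) (m k l)) <= eps.
  move=> M N eps; have [n0 Hn0] := HC M (M + N)%nat eps; exists n0 => n k l Hn.
  have L : is_lim_seq (fun j => norm (Cminus (mat (c j) k l) (m k l) : C_NormedModule)) 0 := Lm k l.
  have Lw := is_lim_seq_scal_l _ ((1 + INR k) ^ M * (1 + INR l) ^ N) _ L.
  have Lw' := is_lim_seq_plus' _ _ _ _ (is_lim_seq_const eps) Lw.
  rewrite Rmult_0_r Rplus_0_r in Lw'.
  apply: (is_lim_seq_le_loc (fun _ => (1 + INR k) ^ M * (1 + INR l) ^ N * Cmod (Cminus (mat (c n) k l) (m k l)))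
    _ ((1 + INR k) ^ M * (1 + INR l) ^ N * Cmod (Cminus (mat (c n) k l) (m k l))) eps _ (is_lim_seq_const _) Lw').
  exists n0 => j Hj.
  have := mat_le_Knorm M N k l _ (Hs n j); rewrite Ms => H1.
  have H2 := Hn0 n j Hn Hj.
  have T := Cmod_triangle (Cminus (mat (c n) k l) (mat (c j) k l)) (Cminus (mat (c j) k l) (m k l)).
  have ET : Cplus (Cminus (mat (c n) k l) (mat (c j) k l)) (Cminus (mat (c j) k l) (m k l)) =
            Cminus (mat (c n) k l) (m k l) by ring.
  rewrite ET in T.
  have P := weight_ge0 M N k l.
  have := Rmult_le_compat_l _ _ _ P T; rewrite -[norm _]/(Cmod _); lra.
have Rm : rapid_decay m.
  move=> M N; have [n0 Hn0] := W M N (mkposreal 1 Rlt_0_1).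
  have [_ Rc] := proj1 (Kinf_iff _) (Hc n0); have [B HB] := Rc M N.
  exists (B + 1) => k l.
  have := Hn0 n0 k l (le_n _); have := HB k l => /= H1 H2.
  have T := Cmod_triangle (mat (c n0) k l) (Copp (Cminus (mat (c n0) k l) (m k l))).
  have ET : Cplus (mat (c n0) k l) (Copp (Cminus (mat (c n0) k l) (m k l))) = m k l by ring.
  rewrite ET Cmod_opp in T.
  have P := weight_ge0 M N k l.
  have := Rmult_le_compat_l _ _ _ P T; lra.
have [d [Hd Ed]] := rapid_decay_operator m Rm.
exists d; split=> // M N eps.
have Pp : 0 < 2 ^ M * 4 by apply: Rmult_lt_0_compat; [apply: pow_lt | ]; lra.
have He : 0 < eps / 2 / (2 ^ M * 4) by apply: Rdiv_lt_0_compat => //; have := cond_pos eps; lra.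
have [n0 Hn0] := W (M + 2)%nat (M + N + 2)%nat (mkposreal _ He).
exists n0 => n Hn.
have Hnd := Kinf_minus _ _ (Hc n) Hd.
have := Knorm_le_mat M N (minus (c n) d) (eps / 2 / (2 ^ M * 4)) Hnd
  (fun k l => ltac:(rewrite Ms Ed; exact: (Hn0 n k l Hn))).
have -> : 2 ^ M * (4 * (eps / 2 / (2 ^ M * 4))) = eps / 2.
  by field; have : 0 < 2 ^ M by [apply: pow_lt; lra]; lra.
have := cond_pos eps; lra.
Qed.

(** * The norms of the Toeplitz algebra *)

Lemma Tnorm_ge0 (s : R) (M N : nat) (a : Op H) : 0 <= s -> TInf a ->
  0 <= TNorm s M N a.
Proof.
move=> Hs [f [c [Hf [Hc ->]]]]; rewrite Tnorm_decomposition //.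
apply: Rplus_le_le_0_compat; last exact: Knorm_ge0.
by apply: Rmult_le_pos => //; apply: Clnorm_ge0.
Qed.

Lemma Tnorm_plus (s : R) (M N : nat) (a b : Op H) : 0 <= s -> TInf a -> TInf b ->
  TNorm s M N (plus a b) <= TNorm s M N a + TNorm s M N b.
Proof.
move=> Hs [f [c [Hf [Hc ->]]]] [g [d [Hg [Hd ->]]]].
rewrite decomposition_plus //.
rewrite (Tnorm_decomposition s M N _ _ (smooth_plus _ _ Hf Hg) (Kinf_plus _ _ Hc Hd)).
rewrite (Tnorm_decomposition s M N _ _ Hf Hc) (Tnorm_decomposition s M N _ _ Hg Hd).
have := Knorm_plus M N _ _ Hc Hd.
have := Rmult_le_compat_l _ _ _ Hs (Clnorm_plus (M + N + 2) _ _ Hf Hg); lra.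
Qed.

Lemma Tnorm_scal (s : R) (M N : nat) (k : C) (a : Op H) : TInf a ->
  TNorm s M N (scal k a) = Cmod k * TNorm s M N a.
Proof.
move=> [f [c [Hf [Hc ->]]]]; rewrite decomposition_scal //.
rewrite (Tnorm_decomposition s M N _ _ (smooth_scal k _ Hf) (Kinf_scal k _ Hc)).
by rewrite (Tnorm_decomposition s M N _ _ Hf Hc) Clnorm_scal // Knorm_scal //; ring.
Qed.

Lemma Tnorm_eq0 (s : R) (M N : nat) (a : Op H) : 0 < s -> TInf a ->
  TNorm s M N a = 0 -> a = zero.
Proof.
move=> Hs [f [c [Hf [Hc ->]]]]; rewrite Tnorm_decomposition // => E0.
have F := Clnorm_ge0 (M + N + 2) _ Hf; have K := Knorm_ge0 M N _ Hc.
have Ef : Clnorm (M + N + 2) f = 0.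
  have := Rmult_le_pos _ _ (Rlt_le _ _ Hs) F => P.
  have Z : s * Clnorm (M + N + 2) f = 0 by lra.
  by case: (Rmult_integral _ _ Z) => // ?; lra.
rewrite (Clnorm_eq0 _ _ Hf Ef) toeplitz_zero plus_zero_l.
apply: mat_ext; [exact: Kinf_bounded_op | exact: bounded_op_zero |].
move=> k l; rewrite mat_zero; apply: Cmod_eq_0; apply: Rle_antisym; last exact: Cmod_ge_0.
have E1 : KNorm M N c = 0 by rewrite Ef in E0; lra.
have := mat_le_norm0 0 k l c Hc; rewrite pow_O Rmult_1_l.
have := norm0_mono 0 N c Hc ltac:(lia).
have := Knorm_mono_l 0 M N c Hc ltac:(lia); rewrite Knorm_0 E1; lra.
Qed.

Lemma Tnorm_mono (s : R) (M M' N N' : nat) (a : Op H) : 0 <= s -> TInf a ->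
  (M <= M')%nat -> (N <= N')%nat -> TNorm s M N a <= TNorm s M' N' a.
Proof.
move=> Hs [f [c [Hf [Hc ->]]]] HM HN; rewrite !Tnorm_decomposition //.
apply: Rplus_le_compat; last exact: Knorm_mono.
by apply: Rmult_le_compat_l => //; apply: Clnorm_mono => //; lia.
Qed.

(** With x, y the norms of the symbols and u, v those of the compact parts, the left side is at most
    (s + 1) x y + x v + u y + u v, to be compared with (s x + u) (s y + v): the term x y needs s + 1
    <= s^2, the mixed terms need 1 <= s. *)
Lemma Tnorm_comp (s : R) (M N : nat) (a b : Op H) : 1 <= s -> s + 1 <= s * s ->
  TInf a -> TInf b ->
  TNorm s M N (op_comp a b) <= TNorm s M N a * TNorm s M N b.
Proof.
move=> H1 H2 [f [c [Hf [Hc ->]]]] [g [d [Hg [Hd ->]]]].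
rewrite decomposition_comp //.
rewrite (Tnorm_decomposition s M N _ _ (smooth_mult _ _ Hf Hg) (Kinf_remainder _ _ _ _ Hf Hg Hc Hd)).
rewrite (Tnorm_decomposition s M N _ _ Hf Hc) (Tnorm_decomposition s M N _ _ Hg Hd).
have KR := Knorm_remainder M N _ _ _ _ Hf Hg Hc Hd.
have CM := Clnorm_mult (M + N + 2) _ _ Hf Hg.
have F := Clnorm_ge0 (M + N + 2) _ Hf; have G := Clnorm_ge0 (M + N + 2) _ Hg.
have c0 := Knorm_ge0 M N _ Hc; have d0 := Knorm_ge0 M N _ Hd.
have s0 : 0 <= s by lra.
have A := Rmult_le_compat_l _ _ _ s0 CM.
move: (Clnorm (M + N + 2) f) (Clnorm (M + N + 2) g) (KNorm M N c) (KNorm M N d) KR F G c0 d0 A.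
move=> x y u v KR x0 y0 u0 v0 A.
have P1 := Rmult_le_pos _ _ x0 y0.
have P2 := Rmult_le_pos _ _ x0 v0; have P3 := Rmult_le_pos _ _ u0 y0.
have Q1 := Rmult_le_compat_r _ _ _ P1 H2.
have Q2 := Rmult_le_compat_r _ _ _ P2 H1; have Q3 := Rmult_le_compat_r _ _ _ P3 H1.
lra.
Qed.

Lemma Tnorm_adj (s : R) (M N : nat) (a : Op H) : 1 <= s -> TInf a ->
  TNorm s M N (adj ip a) <=
  2 ^ M * 4 * TNorm s (M + N + 2) (M + N + 2 + (M + 2)) a.
Proof.
move=> Hs [f [c [Hf [Hc ->]]]]; have [d [Hd Acd]] := Kinf_adjoint c Hc.
rewrite (adj_eq _ _ (is_adjoint_plus _ _ _ _ (is_adjoint_toeplitz f Hf) Acd)).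
rewrite (Tnorm_decomposition s _ _ _ _ (smooth_conj _ Hf) Hd) (Tnorm_decomposition s _ _ _ _ Hf Hc).
rewrite Clnorm_conj // Rmult_plus_distr_l.
apply: Rplus_le_compat; last exact: Knorm_adjoint.
have P : 1 <= 2 ^ M by apply: pow_R1_Rle; lra.
have C1 := Clnorm_mono (M + N + 2) (M + N + 2 + (M + N + 2 + (M + 2)) + 2) f Hf ltac:(lia).
have C0 := Clnorm_ge0 (M + N + 2) _ Hf.
have C2 : s * Clnorm (M + N + 2) f <= s * Clnorm (M + N + 2 + (M + N + 2 + (M + 2)) + 2) f.
  by apply: Rmult_le_compat_l; lra.
have C3 : 0 <= s * Clnorm (M + N + 2) f by apply: Rmult_le_pos; lra.
nra.
Qed.

Lemma Tnorm_seminorm (s : R) (M N : nat) : 0 <= s ->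
  is_seminorm_on TInf (TNorm s M N).
Proof.
move=> Hs; split.
- by move=> a; apply: Tnorm_ge0.
- by move=> a b; apply: Tnorm_plus.
- by move=> k a; apply: Tnorm_scal.
Qed.

(** * Completeness of the Toeplitz algebra and continuity of its operations *)

Lemma decomposition_minus (f g : R -> C) (c d : Op H) : smooth_torus f -> smooth_torus g ->
  minus (plus (Toep f) c) (plus (Toep g) d) =
  plus (Toep (fsub f g)) (minus c d).
Proof.
move=> Hf Hg; rewrite !op_minus_scal decomposition_scal // decomposition_plus //.
exact: smooth_scal.
Qed.

Lemma Tnorm_minus_decomposition (s : R) (M N : nat) (f g : R -> C) (c d : Op H) :
  smooth_torus f -> smooth_torus g -> KInf c -> KInf d ->
  TNorm s M N (minus (plus (Toep f) c) (plus (Toep g) d)) =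
  s * Clnorm (M + N + 2) (fsub f g) + KNorm M N (minus c d).
Proof.
move=> Hf Hg Hc Hd; rewrite decomposition_minus //; apply: Tnorm_decomposition.
  exact: smooth_fsub.
by rewrite op_minus_scal; apply: Kinf_plus => //; apply: Kinf_scal.
Qed.

(** The norm of a difference is the weighted sum of the norms of its two components, so symbols and
    compact parts are both Cauchy and have limits separately. Extracting them as sequences uses a
    choice principle. *)
Lemma Tinf_complete (s : R) (u : nat -> Op H) : 1 <= s -> (forall n, TInf (u n)) ->
  (forall M N (eps : posreal), exists n0 : nat, forall n m,
     (n0 <= n)%nat -> (n0 <= m)%nat -> TNorm s M N (minus (u n) (u m)) < eps) ->
  exists a, TInf a /\ forall M N (eps : posreal), exists n0 : nat, forall n,
     (n0 <= n)%nat -> TNorm s M N (minus (u n) a) < eps.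
Proof.
move=> Hs Hu HC.
have dec : forall n, exists p : (R -> C) * Op H,
    smooth_torus (fst p) /\ KInf (snd p) /\ u n = plus (Toep (fst p)) (snd p).
  by move=> n; have [f [c Hfc]] := Hu n; exists (f, c).
pose p n := proj1_sig (constructive_indefinite_description _ (dec n)).
pose f n := fst (p n); pose c n := snd (p n).
have Hp : forall n, smooth_torus (f n) /\ KInf (c n) /\ u n = plus (Toep (f n)) (c n).
  by move=> n; apply: (proj2_sig (constructive_indefinite_description _ (dec n))).
have Hf : forall n, smooth_torus (f n) by move=> n; case: (Hp n).
have Hc : forall n, KInf (c n) by move=> n; case: (Hp n) => _ [].
have Eu : forall n, u n = plus (Toep (f n)) (c n) by move=> n; case: (Hp n) => _ [].
have Kc : forall n d, KInf d -> KInf (minus (c n) d) by move=> n d Hd; apply: Kinf_minus.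
have [F [HF LF]] : exists F, smooth_torus F /\ forall l (eps : posreal), exists N : nat,
    forall n, (N <= n)%nat -> Clnorm l (fsub (f n) F) < eps.
  apply: smooth_complete => // l eps; have [n0 Hn0] := HC l 0%nat eps.
  exists n0 => n m Hn Hm; have := Hn0 n m Hn Hm.
  rewrite !Eu Tnorm_minus_decomposition //.
  have Hfs := smooth_fsub _ _ (Hf n) (Hf m).
  have := Knorm_ge0 l 0 _ (Kc n (c m) (Hc m)).
  have := Clnorm_mono l (l + 0 + 2) _ Hfs ltac:(lia); have := Clnorm_ge0 l _ Hfs.
  nra.
have [d [Hd Ld]] : exists d, KInf d /\ forall M N (eps : posreal), exists n0 : nat,
    forall n, (n0 <= n)%nat -> KNorm M N (minus (c n) d) < eps.
  apply: Kinf_complete => // M N eps; have [n0 Hn0] := HC M N eps.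
  exists n0 => n m Hn Hm; have := Hn0 n m Hn Hm.
  rewrite !Eu Tnorm_minus_decomposition //.
  have := Clnorm_ge0 (M + N + 2) _ (smooth_fsub _ _ (Hf n) (Hf m)).
  nra.
exists (plus (Toep F) d); split; first exact: Tinf_decomposition.
move=> M N eps.
have He1 : 0 < eps / 2 / s by apply: Rdiv_lt_0_compat; [have := cond_pos eps|]; lra.
have He2 : 0 < eps / 2 by have := cond_pos eps; lra.
have [n1 Hn1] := LF (M + N + 2)%nat (mkposreal _ He1).
have [n2 Hn2] := Ld M N (mkposreal _ He2).
exists (max n1 n2) => n Hn; rewrite Eu Tnorm_minus_decomposition //.
have := Hn1 n ltac:(lia); have := Hn2 n ltac:(lia) => /= G1 G2.
have Hs0 : 0 < s by lra.
have := Rmult_lt_compat_l _ _ _ Hs0 G2.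
have -> : s * (eps / 2 / s) = eps / 2 by field; lra.
lra.
Qed.

Lemma Tinf_frechet (s : R) : 1 <= s -> is_frechet_space TInf (TNorm s).
Proof.
move=> Hs; have s0 : 0 <= s by lra.
split.
- by move=> M N; apply: Tnorm_seminorm.
- by move=> a Ha H0; apply: (Tnorm_eq0 s 0 0) => //; lra.
- move=> u Hu HC; have [a [Ha La]] := Tinf_complete s u Hs Hu HC.
  exists a; split=> // P [K [eps HP]].
  have [n0 Hn0] := La K K eps; exists n0 => n Hn; apply: HP => // M N HM HN.
  apply: Rle_lt_trans (Hn0 n Hn); apply: Tnorm_mono => //; exact: Tinf_minus.
Qed.

Lemma minus_comp_expansion (a b x y : Op H) : bounded_op x ->
  minus (op_comp x y) (op_comp a b) = plus (op_comp x (minus y b)) (op_comp (minus x a) b).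
Proof.
move=> Lx; apply: funext => z.
change (minus (x (y z)) (a (b z)) = plus (x (minus (y z) (b z))) (minus (x (b z)) (a (b z)))).
rewrite /minus (bl_plus _ Lx) (bl_opp _ _ Lx).
by rewrite !plus_assoc -(plus_assoc (x (y z))) plus_opp_l plus_zero_r.
Qed.

Lemma Tinf_mul_continuous (s : R) (a b : Op H) : 1 <= s -> s + 1 <= s * s ->
  TInf a -> TInf b ->
  filterlim (fun z => op_comp (fst z) (snd z))
    (filter_prod (seminorm_nbhs TInf (TNorm s) a)
                 (seminorm_nbhs TInf (TNorm s) b))
    (seminorm_nbhs TInf (TNorm s) (op_comp a b)).
Proof.
move=> H1 H2 Ha Hb P [K [eps HP]]; have s0 : 0 <= s by lra.
(* The norms increase in both indices, so this one controls all those of the target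
   neighbourhood. *)
pose q := TNorm s K K.
have [qa qb] : 0 <= q a /\ 0 <= q b by split; apply: Tnorm_ge0.
(* With [del] at most 1, [q x] is at most 1 + [q a], so the error is at most [del] times
   [q a + q b + 1]; the constant 2 makes the comparison with eps strict. *)
have He : 0 < eps / (q a + q b + 2).
  by apply: Rdiv_lt_0_compat; [apply: cond_pos | lra].
pose del := mkposreal _ (Rmin_pos _ _ Rlt_0_1 He).
exists (fun x => TInf x /\ q (minus x a) < del) (fun y => TInf y /\ q (minus y b) < del).
- by exists K, del => x Hx Hxa; split=> //; apply: Hxa.
- by exists K, del => x Hx Hxa; split=> //; apply: Hxa.
- move=> x y [Hx Hxa] [Hy Hyb]; apply: HP; first exact: Tinf_comp.
  move=> M N HM HN; have [Hxa' Hyb'] := (Tinf_minus _ _ Hx Ha, Tinf_minus _ _ Hy Hb).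
  have Hd := Tinf_minus _ _ (Tinf_comp _ _ Hx Hy) (Tinf_comp _ _ Ha Hb).
  apply: Rle_lt_trans (Tnorm_mono s M K N K _ s0 Hd HM HN) _.
  rewrite minus_comp_expansion; last exact: Tinf_bounded_op.
  have T := Tnorm_plus s K K _ _ s0 (Tinf_comp _ _ Hx Hyb') (Tinf_comp _ _ Hxa' Hb).
  have T1 := Tnorm_comp s K K _ _ H1 H2 Hx Hyb'; have T2 := Tnorm_comp s K K _ _ H1 H2 Hxa' Hb.
  have T3 : q x <= q (minus x a) + q a.
    have {1}-> : x = plus (minus x a) a.
      by rewrite /minus -plus_assoc plus_opp_l plus_zero_r.
    exact: Tnorm_plus.
  have D1 : del <= 1 by apply: Rmin_l.
  have D2 : del * (q a + q b + 2) <= eps.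
    apply: (Rle_trans _ (eps / (q a + q b + 2) * (q a + q b + 2))).
      by apply: Rmult_le_compat_r; [lra | apply: Rmin_r].
    by right; field; lra.
  have D0 := cond_pos del.
  have [x0 y0] : 0 <= q (minus x a) /\ 0 <= q (minus y b) by split; apply: Tnorm_ge0.
  have qx : 0 <= q x by apply: Tnorm_ge0.
  rewrite -/q in T T1 T2 *.
  have M1 : q x * q (minus y b) <= (1 + q a) * del by apply: Rmult_le_compat; lra.
  have M2 : q (minus x a) * q b <= del * q b by apply: Rmult_le_compat_r; lra.
  nra.
Qed.

Lemma Tinf_star_continuous (s : R) (a : Op H) : 1 <= s -> TInf a ->
  filterlim (adj ip) (seminorm_nbhs TInf (TNorm s) a)
    (seminorm_nbhs TInf (TNorm s) (adj ip a)).
Proof.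
move=> Hs Ha P [K [eps HP]]; have s0 : 0 <= s by lra.
have Pp : 0 < 2 ^ K * 4 by apply: Rmult_lt_0_compat; [apply: pow_lt|]; lra.
have He : 0 < eps / (2 ^ K * 4) by apply: Rdiv_lt_0_compat => //; apply: cond_pos.
(* The larger of the two indices that [Tnorm_adj] produces for M = N = K. *)
exists (K + K + 2 + (K + 2))%nat, (mkposreal _ He) => b Hb Hba.
apply: HP; first exact: Tinf_adj.
move=> M N HM HN.
have Hd := Tinf_minus _ _ Hb Ha.
have Em : minus (adj ip b) (adj ip a) = adj ip (minus b a).
  rewrite !op_minus_scal; apply: eq_sym; apply: adj_eq; apply: is_adjoint_plus.
    exact: Tinf_is_adjoint.
  have {2}<- : Cconj (RtoC (-1)) = RtoC (-1) by rewrite /Cconj /= Ropp_0.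
  by apply: is_adjoint_scal; apply: Tinf_is_adjoint.
rewrite Em; apply: Rle_lt_trans (Tnorm_mono s M K N K _ s0 (Tinf_adj _ Hd) HM HN) _.
apply: Rle_lt_trans (Tnorm_adj s K K _ Hs Hd) _.
have := Hba (K + K + 2)%nat (K + K + 2 + (K + 2))%nat ltac:(lia) ltac:(lia) => /= /(Rmult_lt_compat_l _ _ _ Pp).
by have -> : 2 ^ K * 4 * (eps / (2 ^ K * 4)) = eps by field; lra.
Qed.

End HilbertSpace.

Theorem proposition3p2
    (H : CompleteNormedModule C_AbsRing) (ip : H -> H -> C) (E : nat -> H)
    (S : R)
    (Hip : is_inner_product ip)
    (HE : is_orthonormal_basis ip E)
    (HS : 1 / 2 + sqrt ((4 * PI ^ 2 - 9) / 12) <= S) :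
  (forall (M N : nat) (f : R -> C) (c : Op H),
     smooth_torus f -> Kinf ip E c ->
     Tnorm ip E S M N (plus (toeplitz ip E f) c) =
       S * Clnorm (M + N + 2) f + Knorm ip E M N c) /\
  (forall M N : nat, is_norm_on (Tinf ip E) (Tnorm ip E S M N)) /\
  (forall M N : nat,
     submultiplicative_on (Tinf ip E) op_comp (Tnorm ip E S M N)) /\
  is_star_frechet_algebra (Tinf ip E) op_comp (adj ip) (Tnorm ip E S).
Proof.
have S2 : 2 <= S.
  (* PI >= 3, so the square root is at least sqrt (27 / 12) = 3 / 2 *)
  have P3 : 3 <= PI by have := PI2_3_2; lra.
  have : 3 / 2 <= sqrt ((4 * PI ^ 2 - 9) / 12); last lra.
  by rewrite -(sqrt_pow2 (3 / 2)); [apply: sqrt_le_1_alt; nra | lra].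
have S1 : 1 <= S by lra.
have SS : S + 1 <= S * S by nra.
split; first by move=> M N f c; apply: Tnorm_decomposition.
split.
  move=> M N; split; first by apply: Tnorm_seminorm => //; lra.
  by move=> a Ha; apply: (Tnorm_eq0 ip E Hip HE S M N) => //; lra.
split; first by move=> M N a b; apply: Tnorm_comp.
split.
- exact: Tinf_star_algebra.
- exact: Tinf_frechet.
- by move=> a b; apply: Tinf_mul_continuous.
- by move=> a; apply: Tinf_star_continuous.
Qed.
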